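(* Let $M$ be a 4-dimensional QKT manifold with parallel torsion 3-form (that is, $\nabla T=0$ for the QKT-connection $\nabla$ with torsion $T$). Then $M$ is a strong QKT manifold, the torsion 1-form is parallel with respect to the Levi-Civita connection, and $M$ is locally isometric to the product $N^3\times\mathbb{R}$, where $N^3$ is a three-dimensional Riemannian manifold admitting a Riemannian (metric) connection $\nabla$ with totally skew-symmetric torsion, parallel with respect to $\nabla$.
   Context: An almost quaternionic structure on a $4n$-dimensional manifold $M$ is a rank-3 subbundle $Q\subset \mathrm{End}(TM)$ locally spanned by triples $(J_1,J_2,J_3)$ of almost complex structures with $J_\alpha^2=-\mathrm{id}$, $J_1J_2=-J_2J_1=J_3$ (admissible bases, locally defined). A linear connection is quaternionic if it preserves $Q$. A Riemannian metric $g$ is $Q$-hermitian if it is Hermitian with respect to each almost complex structure in $Q$. For a connection $\nabla$, $T(X,Y)=\nabla_XY-\nabla_YX-[X,Y]$ and $T(X,Y,Z)=g(T(X,Y),Z)$. An almost quaternionic manifold with $Q$-hermitian metric is a QKT manifold if it is endowed with a metric quaternionic connection $\nabla$ (QKT-connection) whose torsion is totally skew-symmetric and of type $(1,2)+(2,1)$ with respect to each $J_\alpha$, i.e. $T(X,Y,Z)=T(J_\alpha X,J_\alpha Y,Z)+T(J_\alpha X,Y,J_\alpha Z)+T(X,J_\alpha Y,J_\alpha Z)$. It is a strong QKT manifold if the 3-form $T$ is closed. For an $r$-form $\psi$, $(J_\alpha\psi)(X_1,\dots,X_r)=(-1)^r\psi(J_\alpha X_1,\dots,J_\alpha X_r)$.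 With $t_\alpha(X)=-\frac12\sum_{i}T(X,e_i,J_\alpha e_i)$, $(e_i)$ orthonormal, the 1-form $t=J_\alpha t_\alpha$ is independent of $\alpha$ and is called the torsion 1-form. In dimension 4, a QKT structure on an oriented manifold amounts to a pair $(g,t)$ of a Riemannian metric and a 1-form; $T=*t$ with $*$ the Hodge operator, and $\nabla=\nabla^g+\frac12 T$.
   Formalization: The local splitting N^3 × R is asserted only at points whose connected component contains a point where the torsion T is nonzero; for T = 0 it fails, e.g. for the round 4-sphere with its Levi-Civita connection. *)

(* Defs.v *)
From HB Require Import structures.
From mathcomp Require Import all_boot all_order all_algebra.
From mathcomp Require Import all_classical all_reals all_analysis.
Import numFieldNormedType.Exports.

Set Implicit Arguments.
Unset Strict Implicit.
Unset Printing Implicit Defensive.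

Import Order.TTheory GRing.Theory Num.Theory.

Local Open Scope classical_set_scope.
Local Open Scope ring_scope.

(* Conventions.  Points of R^n and tangent vectors in a chart are columns, and
   endomorphisms act on the left.  A field on a manifold is the family, indexed
   by the charts of an atlas, of its components as functions of the chart
   coordinates, subject to the usual transformation law.  Values of component
   functions outside the image of a chart are irrelevant. *)

Section Calculus.
Variables (R : realType) (n : nat).

Definition partial (k : 'I_n) (f : 'cV[R]_n -> R) : 'cV[R]_n -> R :=
  fun x => 'D_(delta_mx k 0) f x.

Definition iter_partial (s : seq 'I_n) (f : 'cV[R]_n -> R) : 'cV[R]_n -> R :=
  foldr partial f s.

(* C^oo when V is open; only the germs of f at points of V matter. *)
Definition smooth_on (V : set 'cV[R]_n) (f : 'cV[R]_n -> R) : Prop :=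
  forall s x, V x -> differentiable (iter_partial s f) x.

Definition jac m (f : 'cV[R]_n -> 'cV[R]_m) (x : 'cV[R]_n) : 'M[R]_(m, n) :=
  \matrix_(k, a) partial a (fun y => f y k 0) x.

End Calculus.

Section LocalTensors.
Variables (R : realType) (n : nat).
Implicit Types (x : 'cV[R]_n).

(* G x m a b is the Christoffel symbol with
   nabla_(d_a) d_b = \sum_m (G x m a b) d_m. *)
Definition christoffel := 'cV[R]_n -> 'I_n -> 'I_n -> 'I_n -> R.

Definition nabla_form1 (G : christoffel) (t : 'cV[R]_n -> 'I_n -> R) x
    (k a : 'I_n) : R :=
  partial k (fun y => t y a) x - \sum_m G x m k a * t x m.

Definition nabla_metric (G : christoffel) (g : 'cV[R]_n -> 'M[R]_n) x
    (k a b : 'I_n) : R :=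
  partial k (fun y => g y a b) x
  - \sum_m G x m k a * g x m b - \sum_m G x m k b * g x a m.

Definition nabla_form3 (G : christoffel)
    (T : 'cV[R]_n -> 'I_n -> 'I_n -> 'I_n -> R) x (k a b c : 'I_n) : R :=
  partial k (fun y => T y a b c) x
  - \sum_m G x m k a * T x m b c
  - \sum_m G x m k b * T x a m c
  - \sum_m G x m k c * T x a b m.

Definition nabla_end (G : christoffel) (A : 'cV[R]_n -> 'M[R]_n) x
    (k : 'I_n) : 'M[R]_n :=
  let Gk := \matrix_(a, b) G x a k b in
  \matrix_(a, b) partial k (fun y => A y a b) x + Gk *m A x - A x *m Gk.

(* g(T(d_a, d_b), d_c), where
   T(d_a, d_b) = nabla_(d_a) d_b - nabla_(d_b) d_a since [d_a, d_b] = 0. *)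
Definition torsion (g : 'cV[R]_n -> 'M[R]_n) (G : christoffel) x
    (a b c : 'I_n) : R :=
  \sum_m (G x m a b - G x m b a) * g x m c.

Definition ext_deriv3 (T : 'cV[R]_n -> 'I_n -> 'I_n -> 'I_n -> R) x
    (a b c d : 'I_n) : R :=
  partial a (fun y => T y b c d) x - partial b (fun y => T y a c d) x
  + partial c (fun y => T y a b d) x - partial d (fun y => T y a b c) x.

Definition levi_civita (g : 'cV[R]_n -> 'M[R]_n) : christoffel :=
  fun x m a b => 2^-1 * \sum_l invmx (g x) m l *
    (partial a (fun y => g y b l) x + partial b (fun y => g y a l) x
     - partial l (fun y => g y a b) x).

End LocalTensors.

Section PointwiseAlgebra.
Variables (R : realType) (n : nat).

Definition trilinear (T : 'I_n -> 'I_n -> 'I_n -> R) (X Y Z : 'cV[R]_n) : R :=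
  \sum_a \sum_b \sum_c T a b c * X a 0 * Y b 0 * Z c 0.

Definition quaternion_triple (J : 'I_3 -> 'M[R]_n) : Prop :=
  [/\ forall al, J al *m J al = - 1%:M,
      J 0 *m J 1 = J 2%:R & J 1 *m J 0 = - J 2%:R].

Definition admissible_basis (S : set 'M[R]_n) (J : 'I_3 -> 'M[R]_n) : Prop :=
  quaternion_triple J /\
  forall A, S A <-> exists c : 'I_3 -> R, A = \sum_al c al *: J al.

Definition orthonormal (g : 'M[R]_n) (e : 'I_n -> 'cV[R]_n) : Prop :=
  forall i j, (e i)^T *m g *m e j = (i == j)%:R%:M.

Definition t_alpha (T : 'I_n -> 'I_n -> 'I_n -> R) (J : 'M[R]_n)
    (e : 'I_n -> 'cV[R]_n) (X : 'cV[R]_n) : R :=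
  - 2^-1 * \sum_i trilinear T X (e i) (J *m e i).

End PointwiseAlgebra.

Section Manifolds.
Variable R : realType.

Record atlas (M : topologicalType) (n : nat) := Atlas {
  chart : Type;
  dom : chart -> set M;
  phi : chart -> M -> 'cV[R]_n;
  psi : chart -> 'cV[R]_n -> M   (* inverse of phi on its image *)
}.

Definition cod M n (A : atlas M n) (i : chart A) : set 'cV[R]_n :=
  phi i @` dom i.

Definition overlap M n (A : atlas M n) (i j : chart A) : set 'cV[R]_n :=
  phi i @` (dom i `&` dom j).

Definition transition M n (A : atlas M n) (i j : chart A) :
  'cV[R]_n -> 'cV[R]_n := fun x => phi j (psi i x).

Record smooth_manifold M n (A : atlas M n) : Prop := SmoothManifold {
  manifold_hausdorff : hausdorff_space M;
  manifold_second_countable : @second_countable M;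
  manifold_cover : forall p : M, exists i : chart A, dom i p;
  manifold_open_dom : forall i : chart A, open (dom i);
  manifold_open_cod : forall i : chart A, open (cod i);
  manifold_phiK : forall (i : chart A) p, dom i p -> psi i (phi i p) = p;
  manifold_phi_cont : forall i : chart A, {within dom i, continuous (phi i)};
  manifold_psi_cont : forall i : chart A, {within cod i, continuous (psi i)};
  manifold_smooth : forall (i j : chart A) k,
    smooth_on (overlap i j) (fun x => transition i j x k 0)
}.

Section Fields.
Variables (M : topologicalType) (n : nat) (A : atlas M n).

Record one_form (t : chart A -> 'cV[R]_n -> 'I_n -> R) : Prop := OneForm {
  one_form_smooth : forall i a, smooth_on (cod i) (fun x => t i x a);
  one_form_trans : forall i j x, overlap i j x -> forall a,
    t i x a = \sum_b jac (transition i j) x b a * t j (transition i j x) b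
}.

Record riemannian_metric (g : chart A -> 'cV[R]_n -> 'M[R]_n) : Prop :=
  RiemannianMetric {
  metric_smooth : forall i a b, smooth_on (cod i) (fun x => g i x a b);
  metric_sym : forall i x, cod i x -> (g i x)^T = g i x;
  metric_pos : forall i x, cod i x -> forall v : 'cV[R]_n, v != 0 ->
    0 < (v^T *m g i x *m v) 0 0;
  metric_trans : forall i j x, overlap i j x ->
    g i x = (jac (transition i j) x)^T *m g j (transition i j x)
            *m jac (transition i j) x
}.

Record connection (G : chart A -> christoffel R n) : Prop := Connection {
  connection_smooth : forall i m a b, smooth_on (cod i) (fun x => G i x m a b);
  connection_trans : forall i j x, overlap i j x ->
    let D := jac (transition i j) x in forall m a b,
    \sum_l D m l * G i x l a b =
    \sum_c \sum_d G j (transition i j x) m c d * D c a * D d b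
    + partial a (partial b (fun y => transition i j y m 0)) x
}.

(* Rank-3 subbundle Q of End(TM), given by its fibres in each chart. *)
Record almost_quaternionic (Q : chart A -> 'cV[R]_n -> set 'M[R]_n) : Prop :=
  AlmostQuaternionic {
  quaternionic_trans : forall i j x, overlap i j x ->
    let D := jac (transition i j) x in forall B C, D *m B = C *m D ->
    Q i x B <-> Q j (transition i j x) C;
  quaternionic_local_basis : forall i x, cod i x ->
    exists (V : set 'cV[R]_n) (J : 'I_3 -> 'cV[R]_n -> 'M[R]_n),
    [/\ open V, V x, V `<=` cod i,
        forall al a b, smooth_on V (fun y => J al y a b) &
        forall y, V y -> admissible_basis (Q i y) (fun al => J al y)]
}.

Definition hermitian (Q : chart A -> 'cV[R]_n -> set 'M[R]_n)
    (g : chart A -> 'cV[R]_n -> 'M[R]_n) : Prop :=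
  forall i x, cod i x -> forall J, Q i x J -> J *m J = - 1%:M ->
  J^T *m g i x *m J = g i x.

Definition metric_connection (g : chart A -> 'cV[R]_n -> 'M[R]_n)
    (G : chart A -> christoffel R n) : Prop :=
  forall i x, cod i x -> forall k a b, nabla_metric (G i) (g i) x k a b = 0.

Definition quaternionic_connection (Q : chart A -> 'cV[R]_n -> set 'M[R]_n)
    (G : chart A -> christoffel R n) : Prop :=
  forall i (V : set 'cV[R]_n) (B : 'cV[R]_n -> 'M[R]_n),
  open V -> V `<=` cod i ->
  (forall a b, smooth_on V (fun y => B y a b)) ->
  (forall y, V y -> Q i y (B y)) ->
  forall y k, V y -> Q i y (nabla_end (G i) B y k).

Definition skew_torsion (g : chart A -> 'cV[R]_n -> 'M[R]_n)
    (G : chart A -> christoffel R n) : Prop :=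
  forall i x, cod i x -> forall a b c,
  torsion (g i) (G i) x a b c = - torsion (g i) (G i) x b a c /\
  torsion (g i) (G i) x a b c = - torsion (g i) (G i) x a c b.

Definition torsion_type12 (Q : chart A -> 'cV[R]_n -> set 'M[R]_n)
    (g : chart A -> 'cV[R]_n -> 'M[R]_n) (G : chart A -> christoffel R n) :
    Prop :=
  forall i x, cod i x -> forall J, admissible_basis (Q i x) J ->
  let T := trilinear (torsion (g i) (G i) x) in
  forall al X Y Z,
  T X Y Z = T (J al *m X) (J al *m Y) Z + T (J al *m X) Y (J al *m Z)
            + T X (J al *m Y) (J al *m Z).

Record QKT (Q : chart A -> 'cV[R]_n -> set 'M[R]_n)
    (g : chart A -> 'cV[R]_n -> 'M[R]_n) (G : chart A -> christoffel R n) :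
    Prop := MkQKT {
  QKT_quaternionic : almost_quaternionic Q;
  QKT_riemannian : riemannian_metric g;
  QKT_hermitian : hermitian Q g;
  QKT_connection : connection G;
  QKT_metric_connection : metric_connection g G;
  QKT_quaternionic_connection : quaternionic_connection Q G;
  QKT_skew : skew_torsion g G;
  QKT_type12 : torsion_type12 Q g G
}.

Definition parallel_torsion (g : chart A -> 'cV[R]_n -> 'M[R]_n)
    (G : chart A -> christoffel R n) : Prop :=
  forall i x, cod i x -> forall k a b c,
  nabla_form3 (G i) (torsion (g i) (G i)) x k a b c = 0.

Definition closed_torsion (g : chart A -> 'cV[R]_n -> 'M[R]_n)
    (G : chart A -> christoffel R n) : Prop :=
  forall i x, cod i x -> forall a b c d,
  ext_deriv3 (torsion (g i) (G i)) x a b c d = 0.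

Definition strong_QKT (Q : chart A -> 'cV[R]_n -> set 'M[R]_n)
    (g : chart A -> 'cV[R]_n -> 'M[R]_n) (G : chart A -> christoffel R n) :
    Prop :=
  QKT Q g G /\ closed_torsion g G.

Definition torsion_nonzero_at (g : chart A -> 'cV[R]_n -> 'M[R]_n)
    (G : chart A -> christoffel R n) (q : M) : Prop :=
  exists (i : chart A) a b c,
    dom i q /\ torsion (g i) (G i) (phi i q) a b c != 0.

(* t = J_alpha t_alpha, that is t(X) = - t_alpha(J_alpha X), for all admissible
   bases, all alpha and all orthonormal frames. *)
Definition torsion_one_form (Q : chart A -> 'cV[R]_n -> set 'M[R]_n)
    (g : chart A -> 'cV[R]_n -> 'M[R]_n) (G : chart A -> christoffel R n)
    (t : chart A -> 'cV[R]_n -> 'I_n -> R) : Prop :=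
  one_form t /\
  forall i x, cod i x -> forall J e,
  admissible_basis (Q i x) J -> orthonormal (g i x) e ->
  forall al (X : 'cV[R]_n),
  \sum_a t i x a * X a 0
  = - t_alpha (torsion (g i) (G i) x) (J al) e (J al *m X).

Definition levi_civita_parallel (g : chart A -> 'cV[R]_n -> 'M[R]_n)
    (t : chart A -> 'cV[R]_n -> 'I_n -> R) : Prop :=
  forall i x, cod i x -> forall k a,
  nabla_form1 (levi_civita (g i)) (t i) x k a = 0.

End Fields.

Section Maps.
Variables (M N : topologicalType) (m n : nat) (A : atlas M m) (B : atlas N n).

Definition map_dom (U : set M) (F : M -> N) (i : chart A) (j : chart B) :
    set 'cV[R]_m :=
  phi i @` (dom i `&` U `&` F @^-1` dom j).

Definition map_in_charts (F : M -> N) (i : chart A) (j : chart B) :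
  'cV[R]_m -> 'cV[R]_n := fun x => phi j (F (psi i x)).

Definition smooth_map (U : set M) (F : M -> N) : Prop :=
  {within U, continuous F} /\
  forall i j k, smooth_on (map_dom U F i j) (fun x => map_in_charts F i j x k 0).

Definition preserves_metric (g : chart A -> 'cV[R]_m -> 'M[R]_m)
    (h : chart B -> 'cV[R]_n -> 'M[R]_n) (U : set M) (F : M -> N) : Prop :=
  forall i j x, map_dom U F i j x ->
  let D := jac (map_in_charts F i j) x in
  g i x = D^T *m h j (map_in_charts F i j x) *m D.

End Maps.

(* Some open neighbourhood U of p is isometric to an open subset W of N;
   F : U -> W is the isometry and H : W -> U its inverse. *)
Definition isometric_near (M N : topologicalType) (n : nat) (A : atlas M n)
    (B : atlas N n) (g : chart A -> 'cV[R]_n -> 'M[R]_n)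
    (h : chart B -> 'cV[R]_n -> 'M[R]_n) (p : M) : Prop :=
  exists (U : set M) (W : set N) (F : M -> N) (H : N -> M),
  [/\ [/\ open U, U p & open W],
      (forall q, U q -> W (F q) /\ H (F q) = q) /\
      (forall q, W q -> U (H q) /\ F (H q) = q),
      smooth_map A B U F, smooth_map B A W H & preserves_metric g h U F].

(* The charts of N x R are (phi_i, s); the product metric is h + ds^2. *)
Definition prod_line (N : topologicalType) (n : nat) (B : atlas N n) :
    atlas (N * R)%type (n + 1) :=
  {| chart := chart B;
     dom := fun i => dom i `*` setT;
     phi := fun i q => col_mx (phi i q.1) (const_mx q.2);
     psi := fun i y => (psi i (usubmx y), dsubmx y 0 0) |}.

Definition prod_line_metric (N : topologicalType) (n : nat) (B : atlas N n)
    (h : chart B -> 'cV[R]_n -> 'M[R]_n) :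
    chart (prod_line B) -> 'cV[R]_(n + 1) -> 'M[R]_(n + 1) :=
  fun i y => block_mx (h i (usubmx y)) 0 0 1%:M.

(* The factor (N, h) is allowed to depend on p. *)
Definition locally_product_at (M : topologicalType) (A : atlas M 4)
    (g : chart A -> 'cV[R]_4 -> 'M[R]_4) (p : M) : Prop :=
  exists (N : topologicalType) (B : atlas N 3)
         (h : chart B -> 'cV[R]_3 -> 'M[R]_3) (G : chart B -> christoffel R 3),
  [/\ smooth_manifold B /\ riemannian_metric h,
      connection G /\ metric_connection h G,
      skew_torsion h G, parallel_torsion h G &
      @isometric_near M (N * R)%type 4 A (prod_line B) g
        (prod_line_metric h) p].

End Manifolds.

(* Main.v *)
Require Import Defs.
From HB Require Import structures.
From mathcomp Require Import all_boot all_order all_algebra.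
From mathcomp Require Import all_classical all_reals all_analysis.
From mathcomp Require Import ring lra.
Import numFieldNormedType.Exports.
Import Order.TTheory GRing.Theory Num.Theory.
Local Open Scope classical_set_scope.
Local Open Scope ring_scope.

(** The torsion 3-form T of a QKT structure in dimension four is dual to a
    1-form t, and everything follows from an identity that recovers t from T
    without a trace: for every tangent vector X and every admissible basis (J0,
    J1, J2) of Q, t(X) g(X, X) = T(J0 X, J1 X, J2 X). It holds because X, J0 X,
    J1 X, J2 X are orthogonal of equal length, so that the trace defining t can
    be taken in this frame (frame_trace, torsion_traceE). The identity shows
    that t does not depend on the chosen complex structure
    (torsion_form_unique), that it is a smooth 1-form (torsion_form_smooth,
    torsion_form_trans), that T and t have the same zeros (dual_eq0), and that
    the dual vector of t lies in the kernel of T (dual_kernel).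

    Closedness of T: when T is parallel, dT is quadratic in T, namely the sum of
    i_e T ^ i_e T over an orthonormal frame, and i_e T ^ i_e T = i_e (T ^ i_e T)
    contracts a 5-form (wedge_square_eq0, parallel_torsion_closed).

    Parallelism of t: differentiate the identity at a constant coordinate vector
    X. The metric and T are parallel, and the covariant derivative of J_a lies
    in Q without a component along J_a because J_a has constant square, so it
    only contributes terms with a repeated argument of T. What remains is the
    polarized identity, and t is parallel for the QKT connection
    (torsion_form_parallel). The Levi-Civita connection differs from the latter
    by T/2 (levi_civita_torsion), whose contraction with the dual vector of t
    vanishes; hence t is parallel for the Levi-Civita connection too
    (torsion_form_levi_civita).

    Splitting: the length of t is locally constant (partial_norm2), so the set
    where the torsion does not vanish is open and closed and contains the
    component of each of its points (torsion_nonzero_component). Where t is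
    nonzero, its dual vector divided by its length is a unit Killing field xi
    whose dual form is closed, with a primitive f (poincare). Flowing along xi
    from a transverse slice for the time that gives f a prescribed value s
    yields coordinates (y, s) in which the metric is h(y) + ds^2: it has no
    mixed terms because f = s, and it does not depend on s because xi is Killing
    (splitting). This rests on the smooth dependence of the flow on its initial
    point (sol_smooth_on) and on the inverse function theorem (local_inverse).
    The slice is parametrized by the whole of R^3 through the arc tangent, so h
    is a metric on R^3 and the single identity chart makes it a manifold; its
    Levi-Civita connection has vanishing, hence skew and parallel, torsion.

    Smoothness is handled by smooth_on_class: a class of differentiable
    functions stable under partial derivatives consists of smooth functions.
    Differentiability of the functions that are constructed by limits comes from
    diff_quad: a quadratic remainder determines the partial derivatives. *)

Set Implicit Arguments.
Unset Strict Implicit.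
Unset Printing Implicit Defensive.

(** * Differentials and partial derivatives *)

Section Basics.
Variable R : realType.

Lemma norm_coord_le n (x : 'cV[R]_n) k : `|x k 0| <= `|x|.
Proof.
rewrite [leRHS]mx_normrE.
exact: (le_bigmax _ (fun ij : 'I_n * 'I_1 => `|x ij.1 ij.2|) (k, 0)).
Qed.

Lemma norm_le_coord n (x : 'cV[R]_n) c :
  0 <= c -> (forall k, `|x k 0| <= c) -> `|x| <= c.
Proof.
move=> c0 xc; rewrite [leLHS]mx_normrE; apply/bigmax_leP; split=> // -[i j] _ /=.
by rewrite ord1.
Qed.

Lemma norm_lt_coord n (x : 'cV[R]_n) c :
  0 < c -> (forall k, `|x k 0| < c) -> `|x| < c.
Proof.
move=> c0 xc; rewrite [ltLHS]mx_normrE; apply/bigmax_ltP; split=> // -[i j] _ /=.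
by rewrite ord1.
Qed.

Lemma norm_delta n (k : 'I_n) : `|delta_mx k 0 : 'cV[R]_n| = 1.
Proof.
apply/eqP; rewrite eq_le; apply/andP; split.
  by apply: norm_le_coord => // j; rewrite mxE; case: (_ && _); rewrite ?normr1 ?normr0.
by apply: le_trans (norm_coord_le _ k); rewrite mxE !eqxx normr1.
Qed.

Lemma col_sum_delta n (v : 'cV[R]_n) : v = \sum_k v k 0 *: delta_mx k 0.
Proof. by rewrite {1}[v]matrix_sum_delta; apply: eq_bigr => i _; rewrite big_ord1. Qed.

Lemma differentiable_col n m (f : 'cV[R]_n -> 'cV[R]_m) x :
  (forall k, differentiable (fun y => f y k 0) x) -> differentiable f x.
Proof.
move=> df.
have -> : f = \sum_k (fun y => f y k 0 *: delta_mx k 0).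
  by apply/funext => y; rewrite fct_sumE -col_sum_delta.
apply: differentiable_sum => k.
exact: (@differentiableZl _ _ _ (fun y => f y k 0)).
Qed.

Lemma derive_partial n (f : 'cV[R]_n -> R) x v : differentiable f x ->
  'D_v f x = \sum_k v k 0 * partial k f x.
Proof.
move=> df; rewrite deriveE // {1}(col_sum_delta v) linear_sum.
by apply: eq_bigr => k _; rewrite linearZ /= /partial deriveE.
Qed.

Lemma diff_partial n (f : 'cV[R]_n -> R) x v : differentiable f x ->
  'd f x v = \sum_k v k 0 * partial k f x.
Proof. by move=> df; rewrite -derive_partial // deriveE. Qed.

Lemma diff_col n m (f : 'cV[R]_n -> 'cV[R]_m) x v k : differentiable f x ->
  ('d f x v) k 0 = 'D_v (fun y => f y k 0) x.
Proof.
by move=> df; rewrite -deriveE // derive_mx ?mxE //; exact: diff_derivable.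
Qed.

Lemma partial_comp n m (h : 'cV[R]_m -> R) (f : 'cV[R]_n -> 'cV[R]_m) x k :
  (forall j, differentiable (fun y => f y j 0) x) -> differentiable h (f x) ->
  differentiable (h \o f) x /\
  partial k (h \o f) x = \sum_j partial k (fun y => f y j 0) x * partial j h (f x).
Proof.
move=> df dh; have dF := differentiable_col df.
have dc : differentiable (h \o f) x by exact: differentiable_comp.
split=> //; rewrite /partial deriveE // diff_comp //= diff_partial //.
by apply: eq_bigr => j _; rewrite diff_col.
Qed.

Lemma partial_eq n (V : set 'cV[R]_n) (f g : 'cV[R]_n -> R) x k :
  open V -> V x -> (forall y, V y -> f y = g y) -> partial k f x = partial k g x.
Proof.
move=> oV Vx fg; apply: near_eq_derive.
by apply: filterS (open_nbhs_nbhs (conj oV Vx)) => y; exact: fg.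
Qed.

(** Turns an explicit estimate of the remainder into the differential; a
    continuous linear part is unique up to such a remainder. *)
Lemma diff_epsilonP (U W : normedModType R) (f : U -> W) x (L : {linear U -> W}) :
  continuous L ->
  (forall e, 0 < e -> exists2 d, 0 < d & forall h, `|h| < d ->
     `|f (h + x) - f x - L h| <= e * `|h|) ->
  differentiable f x /\ 'd f x = L :> (U -> W).
Proof.
move=> cL H.
have E : f \o shift x = cst (f x) + L +o_ 0 id.
  apply/eqaddoP => e e0; have [d d0 Hd] := H e e0.
  apply/nbhs_ballP; exists d => //= h.
  rewrite -ball_normE /= sub0r normrN => hd.
  by have := Hd h hd; rewrite !fctE /= opprD addrA.
have dL := diff_unique cL E.
by split=> //; apply/diff_locallyP; rewrite dL.
Qed.

Lemma diff_epsilon n (f : 'cV[R]_n -> R) x : differentiable f x ->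
  forall e, 0 < e -> exists2 d, 0 < d & forall h, `|h| < d ->
     `|f (h + x) - f x - 'd f x h| <= e * `|h|.
Proof.
move=> /diff_locallyP [_ /eqaddoP H] e e0; have /nbhs_ballP [d /= d0 Hd] := H e e0.
exists d => // h hd.
have := Hd h; rewrite -ball_normE /= sub0r normrN => /(_ hd).
by rewrite !fctE /= opprD addrA.
Qed.

Lemma differentiable_eq n (V : set 'cV[R]_n) (f g : 'cV[R]_n -> R) x :
  open V -> V x -> (forall y, V y -> f y = g y) ->
  differentiable f x -> differentiable g x.
Proof.
move=> oV Vx fg df.
have /nbhs_ballP [r /= r0 Hr] := open_nbhs_nbhs (conj oV Vx).
suff [//] : differentiable g x /\ 'd g x = 'd f x :> ('cV[R]_n -> R).
apply: diff_epsilonP; first exact: diff_continuous.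
move=> e e0.
have [d d0 Hd] := diff_epsilon df e0.
exists (Num.min d r); first by rewrite lt_min d0.
move=> h; rewrite lt_min => /andP[hd hr].
rewrite -!fg //; first exact: Hd.
by apply: Hr; rewrite -ball_normE /= opprD addrCA subrr addr0 normrN.
Qed.

Lemma row_linear n (l : 'I_n -> R) :
  exists2 L : {linear 'cV[R]_n -> R}, continuous L & forall h, L h = \sum_k h k 0 * l k.
Proof.
pose f := fun h : 'cV[R]_n => \sum_k h k 0 * l k.
have f_lin : linear f.
  move=> a u v; rewrite /f scaler_sumr -big_split; apply: eq_bigr => k _ /=.
  by rewrite !mxE mulrDl /GRing.scale /= mulrA.
pose fM := GRing.isLinear.Build _ _ _ _ f f_lin.
pose L : {linear _ -> _} := HB.pack f fM.
exists L => // h; rewrite /L /= /f => /=.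
rewrite -/f (_ : f = \sum_k (fun h : 'cV[R]_n => h k 0 * l k)); last first.
  by apply/funext => z; rewrite fct_sumE.
apply: differentiable_continuous; apply: differentiable_sum => k.
apply: (@differentiableM _ _ (fun h : 'cV[R]_n => h k 0) (cst (l k))) => //.
exact: differentiable_coord.
Qed.

(** A quadratic remainder determines the differential. Solutions of differential
    equations, primitives and local inverses are all shown differentiable
    through this estimate. *)
Lemma diff_quad n (f : 'cV[R]_n -> R) x (l : 'I_n -> R) c d : 0 < d ->
  (forall h, `|h| < d -> `|f (x + h) - f x - \sum_k h k 0 * l k| <= c * `|h| ^+ 2) ->
  differentiable f x /\ forall k, partial k f x = l k.
Proof.
move=> d0 H; have [L cL LE] := row_linear l.
have [] := @diff_epsilonP _ _ f x L cL.
  move=> e e0; exists (Num.min d (e / (`|c| + 1))).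
    by rewrite lt_min d0 divr_gt0 // ltr_wpDl.
  move=> h; rewrite lt_min => /andP[hd he].
  rewrite LE [h + x]addrC (le_trans (H h hd)) // expr2 mulrA ler_wpM2r //.
  rewrite (le_trans (ler_norm _)) // normrM normr_id.
  have c1 : 0 < `|c| + 1 by rewrite ltr_wpDl.
  move: he; rewrite ltr_pdivlMr // => /ltW; apply: le_trans.
  by rewrite mulrC ler_wpM2l // lerDl.
move=> df dE; split=> // k; rewrite /partial deriveE // dE LE (bigD1 k) //=.
rewrite !mxE !eqxx mul1r big1 ?addr0 // => j jk; rewrite !mxE (negPf jk).
by rewrite mul0r.
Qed.

(** * Smooth functions *)

Lemma smooth_diff n (V : set 'cV[R]_n) f x : smooth_on V f -> V x ->
  differentiable f x.
Proof. by move=> sf Vx; exact: (sf [::]). Qed.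

Lemma iter_partial_rcons n s k (f : 'cV[R]_n -> R) :
  iter_partial (rcons s k) f = iter_partial s (partial k f).
Proof. by rewrite /iter_partial foldr_rcons. Qed.

Lemma smooth_partial n (V : set 'cV[R]_n) k f : smooth_on V f ->
  smooth_on V (partial k f).
Proof. by move=> sf s x Vx; rewrite -iter_partial_rcons; exact: sf. Qed.

Lemma smooth_onS n (V W : set 'cV[R]_n) f : V `<=` W -> smooth_on W f -> smooth_on V f.
Proof. by move=> VW sf s x /VW; exact: sf. Qed.

Lemma smooth_on_local n (V : set 'cV[R]_n) f :
  (forall x, V x -> exists2 W, W x & smooth_on W f) -> smooth_on V f.
Proof. by move=> H s x /H [W Wx]; apply. Qed.

(** Induction on the multi-index: stability under partial derivatives replaces
    every iterated derivative by a member of the class, which is differentiable.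
    The class is only required to be stable up to equality on the open set. *)
Lemma smooth_on_class n (V : set 'cV[R]_n) (C : ('cV[R]_n -> R) -> Prop) :
  open V ->
  (forall f, C f -> forall x, V x -> differentiable f x) ->
  (forall f k, C f -> exists2 f', C f' & forall x, V x -> partial k f x = f' x) ->
  forall f, C f -> smooth_on V f.
Proof.
move=> oV dC pC f Cf s.
suff [f' Cf' E] : exists2 f', C f' & forall x, V x -> iter_partial s f x = f' x.
  move=> x Vx; apply: (@differentiable_eq _ V f') => //; last exact: dC.
  by move=> y Vy; rewrite E.
elim: s => [|k s [f' Cf' E]]; first by exists f.
have [f'' Cf'' E'] := pC f' k Cf'; exists f'' => // x Vx.
by rewrite /= (partial_eq k oV Vx E) E'.
Qed.

Lemma smooth_eq n (V : set 'cV[R]_n) f g : open V -> (forall x, V x -> f x = g x) ->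
  smooth_on V f -> smooth_on V g.
Proof.
move=> oV fg sf.
apply: (@smooth_on_class _ V (fun g => exists2 f, smooth_on V f & forall x, V x -> f x = g x)) => //.
- move=> h [f' sf' E] x Vx; apply: (differentiable_eq oV Vx E).
  exact: smooth_diff sf' Vx.
- move=> h k [f' sf' E]; exists (partial k f').
    by exists (partial k f') => //; exact: smooth_partial.
  by move=> x Vx; apply/esym; exact: (partial_eq k oV Vx E).
- by exists f.
Qed.

Lemma smooth_intro n (V : set 'cV[R]_n) f (d : 'I_n -> 'cV[R]_n -> R) : open V ->
  (forall x, V x -> differentiable f x) ->
  (forall k x, V x -> partial k f x = d k x) -> (forall k, smooth_on V (d k)) ->
  smooth_on V f.
Proof.
move=> oV df pf sd.
apply: (@smooth_on_class _ V (fun g => g = f \/ smooth_on V g)) => //.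
- by move=> h [-> //|sh] x Vx; exact: smooth_diff sh Vx.
- move=> h k [->|sh].
    by exists (d k); [right|exact: pf].
  by exists (partial k h); [right; exact: smooth_partial|].
- by left.
Qed.

(** The rules of differentiation express the derivative of each of these terms
    by terms of the same kind, which is the stability that smooth_on_class asks
    for. Composition is among them because the chain rule only involves partial
    derivatives of the outer function. *)
Inductive smooth_closure n (V : set 'cV[R]_n) : ('cV[R]_n -> R) -> Prop :=
| Sm_base f : smooth_on V f -> smooth_closure V f
| Sm_cst c : smooth_closure V (cst c)
| Sm_coord k : smooth_closure V (fun x => x k 0)
| Sm_add f g : smooth_closure V f -> smooth_closure V g -> smooth_closure V (fun x => f x + g x)
| Sm_mul f g : smooth_closure V f -> smooth_closure V g -> smooth_closure V (fun x => f x * g x)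
| Sm_inv f : (forall x, V x -> f x != 0) -> smooth_closure V f -> smooth_closure V (fun x => (f x)^-1)
| Sm_comp m (h : 'cV[R]_m -> R) (W : set 'cV[R]_m) (phi : 'cV[R]_n -> 'cV[R]_m) :
    smooth_on W h -> (forall x, V x -> W (phi x)) ->
    (forall k, smooth_closure V (fun x => phi x k 0)) ->
    smooth_closure V (fun x => h (phi x)).

Lemma smooth_closure_sum n (V : set 'cV[R]_n) m (f : 'I_m -> 'cV[R]_n -> R) :
  (forall k, smooth_closure V (f k)) -> smooth_closure V (fun x => \sum_k f k x).
Proof.
move=> sf; rewrite -(_ : (\sum_k f k) = fun x => \sum_k f k x); last first.
  by apply/funext => x; rewrite fct_sumE.
elim/big_rec: _ => [|k g _ sg]; first exact: Sm_cst.
exact: (Sm_add (sf k) sg).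
Qed.

Lemma partialD n (f g : 'cV[R]_n -> R) k x : differentiable f x -> differentiable g x ->
  partial k (fun y => f y + g y) x = partial k f x + partial k g x.
Proof. by move=> df dg; rewrite /partial (@deriveD _ _ _ f g) //; exact: diff_derivable. Qed.

Lemma partialB n (f g : 'cV[R]_n -> R) k x : differentiable f x -> differentiable g x ->
  partial k (fun y => f y - g y) x = partial k f x - partial k g x.
Proof. by move=> df dg; rewrite /partial (@deriveB _ _ _ f g) //; exact: diff_derivable. Qed.

Lemma partialM n (f g : 'cV[R]_n -> R) k x : differentiable f x -> differentiable g x ->
  partial k (fun y => f y * g y) x = partial k f x * g x + f x * partial k g x.
Proof.
move=> df dg; rewrite /partial (@deriveM _ _ f g) //; try exact: diff_derivable.
by rewrite /GRing.scale /= addrC [g x * _]mulrC.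
Qed.

Lemma partialV n (f : 'cV[R]_n -> R) k x : differentiable f x -> f x != 0 ->
  partial k (fun y => (f y)^-1) x = - (f x)^-1 ^+ 2 * partial k f x.
Proof.
move=> df fx; rewrite /partial (@deriveV _ _ f) //; last exact: diff_derivable.
by rewrite /GRing.scale /= exprVn.
Qed.

Lemma partial_cst n c k (x : 'cV[R]_n) : partial k (cst c : _ -> R) x = 0.
Proof. by rewrite /partial derive_cst. Qed.

Lemma partial_coord n j k (x : 'cV[R]_n) : partial k (fun y : 'cV[R]_n => y j 0) x = (j == k)%:R.
Proof.
have d : differentiable (id : 'cV[R]_n -> 'cV[R]_n) x by [].
rewrite /partial -(diff_col _ _ d) diff_val mxE eqxx andbT.
by rewrite eq_sym.
Qed.

Lemma partial_sum n m (f : 'I_m -> 'cV[R]_n -> R) k x :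
  (forall i, differentiable (f i) x) ->
  partial k (fun y => \sum_i f i y) x = \sum_i partial k (f i) x.
Proof.
move=> df; rewrite -(_ : (\sum_i f i) = fun y => \sum_i f i y); last first.
  by apply/funext => y; rewrite fct_sumE.
by rewrite /partial derive_sum // => i; exact: diff_derivable.
Qed.

Lemma smooth_closure_on n (V : set 'cV[R]_n) f : open V -> smooth_closure V f -> smooth_on V f.
Proof.
move=> oV.
have dS g : smooth_closure V g -> forall x, V x -> differentiable g x.
  elim=> {f g} [f sf|c|k|f g _ df _ dg|f g _ df _ dg|f f0 _ df|m h W phi sh VW _ dphi] x Vx.
  - exact: smooth_diff sf Vx.
  - exact: differentiable_cst.
  - exact: differentiable_coord.
  - exact: (differentiableD (df _ Vx) (dg _ Vx)).
  - exact: (differentiableM (df _ Vx) (dg _ Vx)).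
  - exact: (differentiableV (df _ Vx) (f0 _ Vx)).
  - apply: (@differentiable_comp _ _ _ _ phi h); last exact: smooth_diff sh (VW _ Vx).
    by apply: differentiable_col => j; exact: dphi.
apply: smooth_on_class => // {f} f k; elim=> {f}.
- by move=> f sf; exists (partial k f) => //; apply: Sm_base; exact: smooth_partial.
- by move=> c; exists (cst 0) => [|x _]; [exact: Sm_cst|exact: partial_cst].
- by move=> j; exists (cst (j == k)%:R) => [|x _]; [exact: Sm_cst|exact: partial_coord].
- move=> f g Sf [f' Sf' Ef] Sg [g' Sg' Eg]; exists (fun x => f' x + g' x).
    exact: Sm_add.
  by move=> x Vx; rewrite partialD ?Ef ?Eg //; exact: dS.
- move=> f g Sf [f' Sf' Ef] Sg [g' Sg' Eg].
  exists (fun x => f' x * g x + f x * g' x).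
    by apply: Sm_add; exact: Sm_mul.
  by move=> x Vx; rewrite partialM ?Ef ?Eg //; exact: dS.
- move=> f f0 Sf [f' Sf' Ef]; exists (fun x => (-1) * ((f x)^-1 * (f x)^-1) * f' x).
    apply: Sm_mul => //; apply: Sm_mul; first exact: Sm_cst.
    by apply: Sm_mul; exact: Sm_inv.
  move=> x Vx; rewrite partialV ?Ef ?f0 //; last exact: dS.
  by rewrite mulN1r expr2.
- move=> m h W phi sh VW Sphi IH.
  exists (fun x => \sum_j sval (cid2 (IH j)) x * partial j h (phi x)).
    apply: smooth_closure_sum => j; apply: Sm_mul; first by case: (cid2 _).
    by apply: (@Sm_comp _ _ _ (partial j h) W) => //; exact: smooth_partial.
  move=> x Vx; rewrite (@partial_comp _ _ h phi x k _ _).2 //.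
  + by apply: eq_bigr => j _; case: (cid2 _) => /= ? _ ->.
  + by move=> j; exact: dS.
  + exact: smooth_diff sh (VW _ Vx).
Qed.

Section SmoothOps.
Variables (n : nat) (V : set 'cV[R]_n).
Hypothesis oV : open V.
Implicit Types f g : 'cV[R]_n -> R.

Lemma smooth_cst c : smooth_on V (fun _ => c).
Proof. by apply: smooth_closure_on => //; exact: Sm_cst. Qed.

Lemma smooth_coord k : smooth_on V (fun x => x k 0).
Proof. by apply: smooth_closure_on => //; exact: Sm_coord. Qed.

Lemma smoothD f g : smooth_on V f -> smooth_on V g -> smooth_on V (fun x => f x + g x).
Proof. by move=> sf sg; apply: smooth_closure_on => //; apply: Sm_add; exact: Sm_base. Qed.

Lemma smoothM f g : smooth_on V f -> smooth_on V g -> smooth_on V (fun x => f x * g x).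
Proof. by move=> sf sg; apply: smooth_closure_on => //; apply: Sm_mul; exact: Sm_base. Qed.

Lemma smoothN f : smooth_on V f -> smooth_on V (fun x => - f x).
Proof.
move=> sf; apply: (@smooth_eq _ _ (fun x => -1 * f x)) => //.
  by move=> x _; rewrite mulN1r.
exact: smoothM (smooth_cst _) sf.
Qed.

Lemma smoothB f g : smooth_on V f -> smooth_on V g -> smooth_on V (fun x => f x - g x).
Proof. by move=> sf sg; exact: smoothD sf (smoothN sg). Qed.

Lemma smoothV f : (forall x, V x -> f x != 0) -> smooth_on V f ->
  smooth_on V (fun x => (f x)^-1).
Proof. by move=> f0 sf; apply: smooth_closure_on => //; apply: Sm_inv => //; exact: Sm_base. Qed.

Lemma smooth_sum m (F : 'I_m -> 'cV[R]_n -> R) :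
  (forall k, smooth_on V (F k)) -> smooth_on V (fun x => \sum_k F k x).
Proof.
by move=> sf; apply: smooth_closure_on => //; apply: smooth_closure_sum => k; exact: Sm_base.
Qed.

Lemma smooth_bigsum (I : Type) (r : seq I) (P : pred I) (F : I -> 'cV[R]_n -> R) :
  (forall k, smooth_on V (F k)) -> smooth_on V (fun x => \sum_(k <- r | P k) F k x).
Proof.
move=> sF; elim: r => [|k r IH].
  by apply: (@smooth_eq _ _ (fun _ => 0)) (smooth_cst 0) => // x _; rewrite big_nil.
case: (boolP (P k)) => Pk; last first.
  by apply: smooth_eq IH => // x _; rewrite big_cons (negPf Pk).
by apply: smooth_eq (smoothD (sF k) IH) => // x _; rewrite big_cons Pk.
Qed.

Lemma smooth_bigprod (I : Type) (r : seq I) (P : pred I) (F : I -> 'cV[R]_n -> R) :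
  (forall k, smooth_on V (F k)) -> smooth_on V (fun x => \prod_(k <- r | P k) F k x).
Proof.
move=> sF; elim: r => [|k r IH].
  by apply: (@smooth_eq _ _ (fun _ => 1)) (smooth_cst 1) => // x _; rewrite big_nil.
case: (boolP (P k)) => Pk; last first.
  by apply: smooth_eq IH => // x _; rewrite big_cons (negPf Pk).
by apply: smooth_eq (smoothM (sF k) IH) => // x _; rewrite big_cons Pk.
Qed.

Lemma smooth_comp m (h : 'cV[R]_m -> R) (W : set 'cV[R]_m) (phi : 'cV[R]_n -> 'cV[R]_m) :
  smooth_on W h -> (forall x, V x -> W (phi x)) ->
  (forall k, smooth_on V (fun x => phi x k 0)) -> smooth_on V (fun x => h (phi x)).
Proof.
move=> sh VW sphi; apply: smooth_closure_on => //; apply: (Sm_comp sh) => // k.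
exact: Sm_base.
Qed.

Lemma smooth_det m (A : 'cV[R]_n -> 'M[R]_m) :
  (forall i j, smooth_on V (fun x => A x i j)) -> smooth_on V (fun x => \det (A x)).
Proof.
move=> sA; rewrite /determinant; apply: smooth_bigsum => s.
by apply: smoothM; [exact: smooth_cst | exact: smooth_bigprod].
Qed.

(** Cramer's rule writes the entries of the inverse as quotients of
    determinants. *)
Lemma smooth_invmx m (A : 'cV[R]_n -> 'M[R]_m) i j :
  (forall i j, smooth_on V (fun x => A x i j)) -> (forall x, V x -> A x \in unitmx) ->
  smooth_on V (fun x => invmx (A x) i j).
Proof.
move=> sA uA; apply: (@smooth_eq _ _ (fun x => (\det (A x))^-1 * \adj (A x) i j)) => //.
  by move=> x Vx; rewrite /invmx uA // !mxE.
apply: smoothM.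
  apply: smoothV; last exact: smooth_det.
  by move=> x /uA; rewrite unitmxE unitfE.
apply: (@smooth_eq _ _ (fun x => (-1) ^+ (j + i) * \det (row' j (col' i (A x))))) => //.
  by move=> x _; rewrite mxE.
apply: smoothM; first exact: smooth_cst.
apply: smooth_det => k l.
by apply: smooth_eq (sA (lift j k) (lift i l)) => // x _; rewrite !mxE.
Qed.

Lemma smooth_mulmx p q r (A : 'cV[R]_n -> 'M[R]_(p, q)) (B : 'cV[R]_n -> 'M[R]_(q, r)) :
  (forall i j, smooth_on V (fun x => A x i j)) -> (forall i j, smooth_on V (fun x => B x i j)) ->
  forall i j, smooth_on V (fun x => (A x *m B x) i j).
Proof.
move=> sA sB i j.
apply: (@smooth_eq _ _ (fun x => \sum_k A x i k * B x k j)) => //.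
  by move=> x _; rewrite mxE.
by apply: smooth_sum => k; exact: smoothM.
Qed.

End SmoothOps.

Lemma smooth_continuous n (V : set 'cV[R]_n) f x : smooth_on V f -> V x -> {for x, continuous f}.
Proof. by move=> sf Vx; apply: differentiable_continuous; exact: smooth_diff sf Vx. Qed.

(** * Mean value estimates *)

Lemma is_derive_line n (f : 'cV[R]_n -> R) x v s d :
  is_derive (x + s *: v) v f d -> is_derive s 1 (fun s => f (x + s *: v)) d.
Proof.
have E : (fun h => h^-1 *: (((fun s => f (x + s *: v)) \o shift s) (h *: (1 : R)) - f (x + s *: v))) =
         (fun h => h^-1 *: ((f \o shift (x + s *: v)) (h *: v) - f (x + s *: v))).
  apply/funext => h; congr (_ *: (_ - _)) => /=; congr f.
  by rewrite [h *: 1]mulr1 scalerDl addrCA.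
by case=> ex <-; split; rewrite /derivable /derive E.
Qed.

Lemma segment_MVT n (f : 'cV[R]_n -> R) x v :
  (forall s : R, 0 <= s <= 1 -> differentiable f (x + s *: v)) ->
  exists2 c, 0 <= c <= 1 & f (x + v) - f x = \sum_k v k 0 * partial k f (x + c *: v).
Proof.
move=> df.
have dl (s : R) : 0 <= s <= 1 ->
    is_derive s 1 (fun s => f (x + s *: v)) (\sum_k v k 0 * partial k f (x + s *: v)).
  move=> s01; apply: is_derive_line; apply: DeriveDef.
    by apply: diff_derivable; exact: df.
  by rewrite derive_partial //; exact: df.
have oc (s : R) : s \in `]0, 1[%R -> 0 <= s <= 1.
  by rewrite in_itv /= => /andP[/ltW -> /ltW ->].
have [|c c01 E] := @MVT R (fun s => f (x + s *: v)) _ 0 1 ltr01 (fun s s01 => dl s (oc s s01)).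
  apply: derivable_within_continuous => s; rewrite in_itv /= => s01.
  by have := dl _ s01; case.
exists c; first by move: c01; rewrite in_itv /= => /andP[/ltW -> /ltW ->].
by move: E; rewrite scale1r scale0r addr0 subr0 mulr1.
Qed.

Lemma sum_coord_bound n (v : 'cV[R]_n) (a : 'I_n -> R) (c : R) :
  (forall k, `|a k| <= c) -> `|\sum_k v k 0 * a k| <= n%:R * c * `|v|.
Proof.
move=> ac; apply: le_trans (ler_norm_sum _ _ _) _.
apply: (@le_trans _ _ (\sum_(k < n) `|v| * c)).
  by apply: ler_sum => k _; rewrite normrM ler_pM // norm_coord_le.
by rewrite sumr_const card_ord -[leLHS]mulr_natl; lra.
Qed.

Lemma segment_bound n (f : 'cV[R]_n -> R) x v (c : R) :
  (forall s : R, 0 <= s <= 1 -> differentiable f (x + s *: v)) ->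
  (forall (s : R) k, 0 <= s <= 1 -> `|partial k f (x + s *: v)| <= c) ->
  `|f (x + v) - f x| <= n%:R * c * `|v|.
Proof.
move=> df bf; have [t t01 ->] := segment_MVT df.
by apply: sum_coord_bound => k; exact: bf.
Qed.

(** The mean value theorem is applied twice: the remainder of first order is a
    difference of first derivatives along the segment. *)
Lemma segment_taylor n (V : set 'cV[R]_n) (f : 'cV[R]_n -> R) x v (c : R) :
  smooth_on V f -> (forall s : R, 0 <= s <= 1 -> V (x + s *: v)) ->
  (forall (s : R) j k, 0 <= s <= 1 -> `|partial j (partial k f) (x + s *: v)| <= c) ->
  `|f (x + v) - f x - \sum_k v k 0 * partial k f x| <= n%:R * (n%:R * c) * `|v| ^+ 2.
Proof.
move=> sf Vs bf.
have [|t /andP[t0 t1] ->] := @segment_MVT n f x v.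
  by move=> s s01; apply: smooth_diff sf (Vs _ s01).
rewrite -sumrB.
rewrite (eq_bigr (fun k => v k 0 * (partial k f (x + t *: v) - partial k f x))); last first.
  by move=> k _; rewrite mulrBr.
apply: le_trans (@sum_coord_bound _ _ _ (n%:R * c * `|v|) _) _; last first.
  by rewrite expr2 !mulrA.
have c0 : forall k : 'I_n, 0 <= c.
  by move=> k; apply: le_trans (bf 0 k k _); rewrite ?lexx ?ler01.
move=> k; apply: (@le_trans _ _ (n%:R * c * `|t *: v|)).
  have inS (s : R) : 0 <= s <= 1 -> 0 <= s * t <= 1.
    by move=> /andP[s0 s1]; rewrite mulr_ge0 //= mulr_ile1.
  apply: segment_bound => [s s01|s j s01]; rewrite scalerA.
    by apply: (smooth_diff (smooth_partial k sf)); apply: Vs; exact: inS.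
  by apply: bf; exact: inS.
rewrite normrZ ger0_norm // ler_wpM2l ?mulr_ge0 ?(c0 k) //.
by rewrite ler_piMl.
Qed.

End Basics.

(** * Symmetry of second derivatives and estimates on boxes *)

Section Schwarz.
Variable R : realType.

Lemma open_ball_sub n (V : set 'cV[R]_n) x : open V -> V x ->
  exists2 r, 0 < r & forall h, `|h| < r -> V (x + h).
Proof.
move=> oV Vx; have /nbhs_ballP [r /= r0 Hr] := open_nbhs_nbhs (conj oV Vx).
exists r => // h hr; apply: Hr; rewrite -ball_normE /= opprD addrA subrr sub0r.
by rewrite normrN.
Qed.

Lemma continuous_epsilon n (f : 'cV[R]_n -> R) x (e : R) : {for x, continuous f} -> 0 < e ->
  exists2 d, 0 < d & forall h, `|h| < d -> `|f (x + h) - f x| < e.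
Proof.
move=> /cvgrPdist_lt cf e0; have /nbhs_ballP [d /= d0 Hd] := cf e e0.
exists d => // h hd; rewrite distrC; apply: Hd.
by rewrite -ball_normE /= opprD addrA subrr sub0r normrN.
Qed.

Lemma partial_shift n (f : 'cV[R]_n -> R) c x k : differentiable f (x + c) ->
  differentiable (fun y => f (y + c)) x /\ partial k (fun y => f (y + c)) x = partial k f (x + c).
Proof.
move=> df; split.
  have ds : differentiable (fun y : 'cV[R]_n => y + c) x.
    apply: differentiable_col => j.
    rewrite (_ : (fun y : 'cV[R]_n => (y + c) j 0) = (fun y => y j 0 + c j 0)); last first.
      by apply/funext => y; rewrite mxE.
    by apply: (@differentiableD _ _ _ (fun y : 'cV[R]_n => y j 0) (cst (c j 0))) => //; exact: differentiable_coord.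
  exact: (differentiable_comp ds df).
have E : (fun h : R => h^-1 *: (((fun y => f (y + c)) \o shift x) (h *: delta_mx k 0) - f (x + c))) =
    (fun h : R => h^-1 *: ((f \o shift (x + c)) (h *: delta_mx k 0) - f (x + c))).
  by apply/funext => h /=; rewrite addrA.
by rewrite /partial /derive E.
Qed.

Lemma sum_delta n (a : 'I_n) (h : R) (F : 'I_n -> R) :
  \sum_k (h *: (delta_mx a 0 : 'cV[R]_n)) k 0 * F k = h * F a.
Proof.
rewrite (bigD1 a) //= !mxE !eqxx mulr1 big1 ?addr0 // => j ja.
by rewrite !mxE (negPf ja) mulr0 mul0r.
Qed.

(** The second difference is symmetric in the two directions, while the mean
    value theorem, once in each direction, turns it into a mixed second
    derivative at a nearby point. *)
Lemma second_difference n (V : set 'cV[R]_n) (f : 'cV[R]_n -> R) x a b (h : R) :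
  smooth_on V f ->
  (forall s t : R, 0 <= s <= 1 -> 0 <= t <= 1 ->
    V (x + (s * h) *: delta_mx a 0 + (t * h) *: delta_mx b 0)) ->
  exists s t : R, [/\ 0 <= s <= 1, 0 <= t <= 1 &
   f (x + h *: delta_mx a 0 + h *: delta_mx b 0) - f (x + h *: delta_mx a 0)
     - (f (x + h *: delta_mx b 0) - f x)
   = h * (h * partial b (partial a f) (x + (s * h) *: delta_mx a 0 + (t * h) *: delta_mx b 0))].
Proof.
move=> sf HV; set u := delta_mx a 0; set w := delta_mx b 0.
pose g y := f (y + h *: w) - f y.
have I0 : (0 : R) <= (0 : R) <= 1 by rewrite lexx ler01.
have I1 : (0 : R) <= (1 : R) <= 1 by rewrite lexx ler01.
have HV1 s : 0 <= s <= 1 -> V (x + s *: (h *: u) + h *: w).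
  by move=> s01; rewrite scalerA -[h in h *: w]mul1r; exact: HV.
have HV0 s : 0 <= s <= 1 -> V (x + s *: (h *: u)).
  by move=> s01; have := HV s 0 s01 I0; rewrite mul0r scale0r addr0 scalerA.
have d1 y : V (y + h *: w) -> differentiable (fun y => f (y + h *: w)) y.
  by move=> Vy; apply: (partial_shift a _).1; exact: smooth_diff sf Vy.
have [|s s01 E] := @segment_MVT R n g x (h *: u).
  move=> s s01; apply: (differentiableB (d1 _ (HV1 _ s01))).
  exact: (smooth_diff sf (HV0 _ s01)).
have [|t t01 E2] := @segment_MVT R n (partial a f) (x + s *: (h *: u)) (h *: w).
  move=> t t01; apply: (smooth_diff (smooth_partial a sf)).
  by rewrite !scalerA; exact: HV.
exists s, t; split=> //.
move: E; rewrite sum_delta /g => ->; congr (_ * _).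
rewrite partialB; [|exact: d1 (HV1 _ s01)|exact: smooth_diff sf (HV0 _ s01)].
rewrite (partial_shift a _).2; last exact: smooth_diff sf (HV1 _ s01).
by rewrite E2 sum_delta !scalerA.
Qed.

Lemma second_difference_aux (h X1 X2 A B C D : R) : h * h != 0 ->
  A - B - (C - D) = h * (h * X1) -> A - C - (B - D) = h * (h * X2) -> X1 = X2.
Proof. by move=> hh E1 E2; apply: (mulfI hh); rewrite -!mulrA -E1 -E2; ring. Qed.

Lemma continuous_eq_near n (D1 D2 : 'cV[R]_n -> R) x :
  {for x, continuous D1} -> {for x, continuous D2} ->
  (forall d : R, 0 < d -> exists h1 h2, [/\ `|h1| < d, `|h2| < d & D1 (x + h1) = D2 (x + h2)]) ->
  D1 x = D2 x.
Proof.
move=> c1 c2 H.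
have key (e : R) : 0 < e -> `|D1 x - D2 x| < e + e.
  move=> e0; have [d1 d10 H1] := continuous_epsilon c1 e0.
  have [d2 d20 H2] := continuous_epsilon c2 e0.
  have [|h1 [h2 [h1d h2d E]]] := H (Num.min d1 d2); first by rewrite lt_min d10.
  move: h1d h2d; rewrite !lt_min => /andP[/H1 B1 _] /andP[_ /H2 B2].
  rewrite (le_lt_trans (ler_distD (D1 (x + h1)) _ _)) // ltrD //.
    by rewrite distrC.
  by rewrite E.
apply/eqP; rewrite -subr_eq0 -normr_le0 leNgt; apply/negP => p.
have := key (`|D1 x - D2 x| / 2); rewrite divr_gt0 // => /(_ isT).
by rewrite -splitr ltxx.
Qed.

(** Both mixed derivatives take a common value at points arbitrarily close to x,
    by second_difference, and both are continuous. *)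
Lemma partialC n (V : set 'cV[R]_n) (f : 'cV[R]_n -> R) x a b :
  open V -> smooth_on V f -> V x ->
  partial a (partial b f) x = partial b (partial a f) x.
Proof.
move=> oV sf Vx.
apply: continuous_eq_near.
- exact: smooth_continuous (smooth_partial a (smooth_partial b sf)) Vx.
- exact: smooth_continuous (smooth_partial b (smooth_partial a sf)) Vx.
move=> d d0; have [r r0 Hr] := open_ball_sub oV Vx.
pose h := Num.min r d / 3.
have m0 : 0 < Num.min r d by rewrite lt_min r0 d0.
have h0 : 0 < h by rewrite divr_gt0.
have nb (i j : 'I_n) (s t : R) : 0 <= s <= 1 -> 0 <= t <= 1 ->
    `|(s * h) *: delta_mx i 0 + (t * h) *: delta_mx j 0 : 'cV[R]_n| < Num.min r d.
  move=> /andP[s0 s1] /andP[t0 t1]; apply: le_lt_trans (ler_normD _ _) _.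
  have nd (k : 'I_n) (p : R) : 0 <= p -> `|(p * h) *: delta_mx k 0 : 'cV[R]_n| = p * h.
    by move=> p0; rewrite normrZ norm_delta mulr1 ger0_norm // mulr_ge0 // ltW.
  rewrite !nd //.
  have -> : Num.min r d = 3 * h by rewrite /h mulrC divfK.
  nra.
have inV i j (s t : R) : 0 <= s <= 1 -> 0 <= t <= 1 ->
    V (x + (s * h) *: delta_mx i 0 + (t * h) *: delta_mx j 0).
  move=> s01 t01; rewrite -addrA; apply: Hr.
  by have := nb i j s t s01 t01; rewrite lt_min => /andP[].
have [s1 [t1 [s101 t101 E1]]] := second_difference sf (inV a b).
have [s2 [t2 [s201 t201 E2]]] := second_difference sf (inV b a).
exists ((s2 * h) *: delta_mx b 0 + (t2 * h) *: delta_mx a 0).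
exists ((s1 * h) *: delta_mx a 0 + (t1 * h) *: delta_mx b 0); split.
- by have := nb b a s2 t2 s201 t201; rewrite lt_min => /andP[].
- by have := nb a b s1 t1 s101 t101; rewrite lt_min => /andP[].
have hh : h * h != 0 by rewrite mulf_neq0 // gt_eqF.
have EX : x + h *: delta_mx b 0 + h *: delta_mx a 0 = x + h *: delta_mx a 0 + h *: delta_mx b 0 :> 'cV[R]_n.
  by rewrite addrAC.
rewrite !addrA; move: E1 E2; rewrite EX => E1 E2.
exact: (second_difference_aux hh E2 E1).
Qed.

Lemma jac_comp n m p (h : 'cV[R]_m -> 'cV[R]_p) (f : 'cV[R]_n -> 'cV[R]_m) x :
  (forall j, differentiable (fun y => f y j 0) x) ->
  (forall j, differentiable (fun y => h y j 0) (f x)) ->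
  jac (h \o f) x = jac h (f x) *m jac f x.
Proof.
move=> df dh; apply/matrixP => k a; rewrite !mxE.
rewrite -[(fun _ => _)]/((fun y => h y k 0) \o f) (partial_comp a df (dh k)).2.
by apply: eq_bigr => j _; rewrite !mxE mulrC.
Qed.

Lemma jac_id n (x : 'cV[R]_n) : jac id x = 1%:M.
Proof. by apply/matrixP => k a; rewrite !mxE partial_coord. Qed.

Lemma jac_eq n m (V : set 'cV[R]_n) (f g : 'cV[R]_n -> 'cV[R]_m) x :
  open V -> V x -> (forall y, V y -> f y = g y) -> jac f x = jac g x.
Proof.
move=> oV Vx fg; apply/matrixP => k a; rewrite !mxE.
by apply: partial_eq oV Vx _ => y Vy; rewrite fg.
Qed.

Definition box n (a b : 'I_n -> R) : set 'cV[R]_n := [set x | forall k, a k <= x k 0 <= b k].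

Lemma trmx_continuous m n : continuous (trmx : 'M[R]_(m, n) -> 'M[R]_(n, m)).
Proof.
move=> A P /= [Q nQ QP]; exists (fun j i => Q i j).
  by move=> j i; have := nQ i j; rewrite mxE.
by move=> B HB; apply: QP => i j; rewrite mxE; exact: HB.
Qed.

(** Transposition identifies a box of columns with a product of compact
    intervals. *)
Lemma compact_box n (a b : 'I_n -> R) : compact (box a b).
Proof.
have -> : box a b = trmx @` [set v : 'rV[R]_n | forall i, `[a i, b i]%classic (v ord0 i)].
  apply/seteqP; split=> [x xab|x [v vab <-] k].
    by exists x^T; [move=> i; rewrite /= mxE in_itv; exact: xab|rewrite trmxK].
  by have := vab k; rewrite /= in_itv mxE.
apply: continuous_compact.
  by apply: continuous_subspaceT; exact: trmx_continuous.
apply: (@rV_compact R n (fun i => `[a i, b i]%classic)) => i.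
exact: segment_compact.
Qed.

Lemma smooth_bounded n (V : set 'cV[R]_n) (a b : 'I_n -> R) f :
  box a b `<=` V -> smooth_on V f ->
  exists2 c : R, 0 <= c & forall x, box a b x -> `|f x| <= c.
Proof.
move=> KV sf.
have [->|/set0P K0] := eqVneq (box a b) set0; first by exists 0.
have [|c cK' Hc] := @compact_EVT_max _ R (fun x => `|f x|) _ K0 (compact_box (a:=a) (b:=b)).
  apply: continuous_in_subspaceT => x /set_mem xK.
  apply: (@continuous_comp _ _ _ f (fun y : R => `|y|)).
    exact: smooth_continuous sf (KV _ xK).
  exact: norm_continuous.
by exists `|f c| => // x xK; apply: Hc; exact: mem_set.
Qed.

Lemma smooth_family_bounded (I : finType) n (V : set 'cV[R]_n) (a b : 'I_n -> R)
    (F : I -> 'cV[R]_n -> R) : box a b `<=` V -> (forall i, smooth_on V (F i)) ->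
  exists2 c : R, 0 <= c & forall i x, box a b x -> `|F i x| <= c.
Proof.
move=> KV sF; have /choice[c Hc] : forall i, exists c : R, 0 <= c /\ forall x, box a b x -> `|F i x| <= c.
  by move=> i; have [c c0 Hc] := smooth_bounded KV (sF i); exists c.
exists (\sum_i c i) => [|i x Kx]; first by apply: sumr_ge0 => i _; exact: (Hc i).1.
apply: le_trans ((Hc i).2 x Kx) _; rewrite (bigD1 i) //= lerDl.
by apply: sumr_ge0 => j _; exact: (Hc j).1.
Qed.

Lemma box_segment n (a b : 'I_n -> R) x y s : box a b x -> box a b y -> 0 <= s <= 1 ->
  box a b (x + s *: (y - x)).
Proof.
move=> xK yK /andP[s0 s1] k; have := xK k; have := yK k; rewrite !mxE.
by move=> /andP[? ?] /andP[? ?]; apply/andP; split; nra.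
Qed.

(** A box is compact and convex, so that its bounds on first derivatives can be
    integrated along segments. *)
Lemma box_lipschitz n (V : set 'cV[R]_n) (a b : 'I_n -> R) m (F : 'cV[R]_n -> 'cV[R]_m) :
  box a b `<=` V -> (forall k, smooth_on V (fun x => F x k 0)) ->
  exists2 c : R, 0 <= c & forall x y, box a b x -> box a b y -> `|F y - F x| <= c * `|y - x|.
Proof.
move=> KV sF.
have [C C0 HC] := smooth_family_bounded KV (fun kj : 'I_m * 'I_n => smooth_partial kj.2 (sF kj.1)).
exists (n%:R * C) => [|x y Kx Ky]; first exact: mulr_ge0.
apply: norm_le_coord => [|k]; first by rewrite !mulr_ge0.
rewrite mxE [(- F x) k 0]mxE (_ : F y k 0 = F (x + (y - x)) k 0); last by rewrite addrC subrK.
apply: (@segment_bound _ _ (fun x => F x k 0)) => [s s01|s j s01].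
  by apply: smooth_diff (sF k) _; apply: KV; exact: box_segment.
by apply: (HC (k, j)); exact: box_segment.
Qed.

Lemma box_taylor n (V : set 'cV[R]_n) (a b : 'I_n -> R) m (F : 'cV[R]_n -> 'cV[R]_m) :
  box a b `<=` V -> (forall k, smooth_on V (fun x => F x k 0)) ->
  exists2 c : R, 0 <= c & forall x y, box a b x -> box a b y ->
    `|F y - F x - jac F x *m (y - x)| <= c * `|y - x| ^+ 2.
Proof.
move=> KV sF.
have [C C0 HC] := smooth_family_bounded KV (fun kj : 'I_m * ('I_n * 'I_n) =>
  smooth_partial kj.2.1 (smooth_partial kj.2.2 (sF kj.1))).
exists (n%:R * (n%:R * C)) => [|x y Kx Ky]; first by rewrite !mulr_ge0.
apply: norm_le_coord => [|k]; first by rewrite !mulr_ge0 ?exprn_ge0.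
have E : (jac F x *m (y - x)) k 0 = \sum_j (y - x) j 0 * partial j (fun x => F x k 0) x.
  by rewrite mxE; apply: eq_bigr => j _; rewrite !mxE mulrC.
rewrite mxE mxE [(- (_ *m _)) _ _]mxE E [(- F x) _ _]mxE.
rewrite (_ : F y k 0 = F (x + (y - x)) k 0); last by rewrite addrC subrK.
apply: (@segment_taylor _ _ V (fun x => F x k 0)) => [//|s s01|s j l s01].
  by apply: KV; exact: box_segment.
by apply: (HC (k, (j, l))); exact: box_segment.
Qed.

End Schwarz.

(** * Functions of one real variable *)

Section LineCalculus.
Variable R : realType.
Implicit Types (f g h : R -> R) (s t T : R).

Lemma is_derive_add f g s a b : is_derive s 1 f a -> is_derive s 1 g b ->
  is_derive s 1 (fun t => f t + g t) (a + b).
Proof. by move=> df dg; exact: is_deriveD. Qed.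

Lemma is_derive_sub f g s a b : is_derive s 1 f a -> is_derive s 1 g b ->
  is_derive s 1 (fun t => f t - g t) (a - b).
Proof. by move=> df dg; exact: is_deriveB. Qed.

Lemma is_derive_mul f g s a b : is_derive s 1 f a -> is_derive s 1 g b ->
  is_derive s 1 (fun t => f t * g t) (a * g s + f s * b).
Proof.
move=> df dg; apply: is_derive_eq (is_deriveM df dg) _.
by rewrite /GRing.scale /= addrC [g s * a]mulrC.
Qed.

Lemma is_derive_sum_fun n (F : 'I_n -> R -> R) (d : 'I_n -> R) s :
  (forall i, is_derive s 1 (F i) (d i)) -> is_derive s 1 (fun t => \sum_i F i t) (\sum_i d i).
Proof.
move=> dF; rewrite -(_ : (\sum_i F i) = fun t => \sum_i F i t); last first.
  by apply/funext => t; rewrite fct_sumE.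
exact: is_derive_sum.
Qed.

Lemma is_derive_opp_arg f s a : is_derive (- s) 1 f a -> is_derive s 1 (fun t => f (- t)) (- a).
Proof.
move=> df; have dN : is_derive s 1 (-%R : R -> R) (-1).
  exact: is_deriveNid.
by apply: is_derive_eq (is_derive1_comp df dN) _; rewrite mulrN1.
Qed.

Lemma is_derive_expM K s : is_derive s 1 (fun t => expR (K * t)) (K * expR (K * s)).
Proof.
have dK : is_derive s 1 (fun t : R => K * t) K.
  apply: is_derive_eq (is_deriveZ K (is_derive_id s (1 : R))) _.
  by rewrite /GRing.scale /= mulr1.
by apply: is_derive_eq (is_derive1_comp (is_derive_expR (K * s)) dK) _; rewrite mulrC.
Qed.

Lemma is_derive_continuous f s a : is_derive s 1 f a -> {for s, continuous f}.
Proof.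
by case=> + _; move=> /derivable1_diffP; exact: differentiable_continuous.
Qed.

Lemma ge0_derive_le f (d : R -> R) T : 0 <= T ->
  (forall s, 0 <= s <= T -> is_derive s 1 f (d s)) ->
  (forall s, 0 <= s <= T -> 0 <= d s) -> f 0 <= f T.
Proof.
move=> T0 df d0; have [s|s|c] := @MVT_segment R f d 0 T T0.
- by rewrite in_itv /= => /andP[/ltW s0 /ltW sT]; apply: df; rewrite s0.
- apply: derivable_within_continuous => t; rewrite in_itv /= => t0T.
  by have := df t t0T; case.
rewrite in_itv /= subr0 => c0T E; rewrite -subr_ge0 E.
by rewrite mulr_ge0 // d0.
Qed.

Lemma derive_eq0_cst f T : 0 <= T -> (forall s, `|s| <= T -> is_derive s 1 f 0) ->
  forall s, `|s| <= T -> f s = f 0.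
Proof.
move=> T0 df.
have pos g s : 0 <= s <= T -> (forall s, 0 <= s <= T -> is_derive s 1 g 0) -> g s = g 0.
  move=> /andP[s0 sT] dg; have sub t : 0 <= t <= s -> 0 <= t <= T.
    by move=> /andP[-> /le_trans]; apply.
  apply/eqP; rewrite eq_le; apply/andP; split; last first.
    by apply: (@ge0_derive_le g (fun=> 0) s) => // t /sub /dg.
  have dN t : 0 <= t <= s -> is_derive t 1 (fun t => - g t) 0.
    by move=> /sub /dg dgt; apply: is_derive_eq (is_deriveN dgt) _; rewrite oppr0.
  by rewrite -lerN2; apply: (@ge0_derive_le (fun t => - g t) (fun=> 0) s).
move=> s; rewrite ler_norml => /andP[s1 s2]; have [s0|s0] := lerP 0 s.
  apply: pos => [|t /andP[t0 tT]]; first by rewrite s0.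
  by apply: df; rewrite ger0_norm.
rewrite -(opprK s) -[0 in RHS]oppr0.
apply: (pos (fun t => f (- t))); first by rewrite oppr_ge0 ltW //= lerNl.
move=> t /andP[t0 tT]; apply: is_derive_eq (is_derive_opp_arg (df (- t) _)) _.
  by rewrite normrN ger0_norm.
by rewrite oppr0.
Qed.

(** The difference between f and a primitive of the bound is monotone; the
    weight K in the exponent is what gains the factor K^-1. *)
Lemma exp_comparison f (d : R -> R) A K T : 0 <= A -> 0 < K ->
  f 0 = 0 -> (forall s, `|s| <= T -> is_derive s 1 f (d s)) ->
  (forall s, `|s| <= T -> `|d s| <= A * expR (K * `|s|)) ->
  forall s, `|s| <= T -> `|f s| <= A / K * expR (K * `|s|).
Proof.
move=> A0 K0 f0 df bd.
have pos g (e : R -> R) s : g 0 = 0 -> 0 <= s -> (forall t, 0 <= t <= s -> is_derive t 1 g (e t)) ->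
    (forall t, 0 <= t <= s -> e t <= A * expR (K * t)) -> g s <= A / K * expR (K * s).
  move=> g0 s0 dg be.
  have := @ge0_derive_le (fun t => A / K * expR (K * t) - g t)
    (fun t => A * expR (K * t) - e t) s s0.
  rewrite g0 subr0 mulr0 expR0 mulr1 => H.
  rewrite -subr_ge0; apply: (le_trans _ (H _ _)).
  - by rewrite divr_ge0 // ltW.
  - move=> t t0s; apply: is_derive_sub; last exact: dg.
    apply: is_derive_eq (is_derive_mul (is_derive_cst (A / K) t (1 : R)) (is_derive_expM K t)) _.
    by rewrite mul0r add0r mulrA divfK // gt_eqF.
  - by move=> t t0s; rewrite subr_ge0; exact: be.
move=> s sT; rewrite ler_norml; have [s0|s0] := lerP 0 s.
  rewrite ger0_norm // in sT *.
  have sub t : 0 <= t <= s -> `|t| <= T /\ `|t| = t.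
    by move=> /andP[t0 ts]; rewrite ger0_norm // (le_trans ts).
  apply/andP; split.
    rewrite lerNl; apply: (pos (fun t => - f t) (fun t => - d t)) => // [|t|t].
    + by rewrite f0 oppr0.
    + by move=> /sub [tT _]; apply: is_deriveN; exact: df.
    + move=> /sub [tT tE]; have := bd _ tT; rewrite tE; apply: le_trans.
      by rewrite -normrN ler_norm.
  apply: (pos f d) => // [t|t].
  + by move=> /sub [tT _]; exact: df.
  + move=> /sub [tT tE]; have := bd _ tT; rewrite tE; apply: le_trans.
    by rewrite ler_norm.
rewrite ltr0_norm // in sT *; have s0' : 0 <= - s by rewrite oppr_ge0 ltW.
have sub t : 0 <= t <= - s -> `|- t| <= T /\ `|- t| = t.
  by move=> /andP[t0 ts]; rewrite normrN ger0_norm // (le_trans ts).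
apply/andP; split.
  rewrite lerNl -{1}(opprK s); apply: (pos (fun t => - f (- t)) (fun t => d (- t))) => // [|t|t].
  + by rewrite !oppr0 f0 oppr0.
  + move=> /sub [tT _]; rewrite -[d _]opprK; apply: is_deriveN.
    by apply: is_derive_opp_arg; exact: df.
  + move=> /sub [tT tE]; have := bd _ tT; rewrite tE; apply: le_trans.
    by rewrite ler_norm.
rewrite -{1}(opprK s); apply: (pos (fun t => f (- t)) (fun t => - d (- t))) => // [|t|t].
+ by rewrite oppr0 f0.
+ by move=> /sub [tT _]; apply: is_derive_opp_arg; exact: df.
+ move=> /sub [tT tE]; have := bd _ tT; rewrite tE; apply: le_trans.
  by rewrite -normrN ler_norm.
Qed.

(** The fundamental theorem of calculus gives a primitive on each interval [- m,
    m]; normalized at 0 they agree on overlaps and glue to a primitive on the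
    line. *)
Lemma antiderivative h : continuous h ->
  exists P : R -> R, P 0 = 0 /\ forall s, is_derive s 1 P (h s).
Proof.
move=> ch.
pose PM (M : nat) (x : R) : R := (\int[@lebesgue_measure R]_(t in `[- (M.+1%:R), x]%classic) h t)%R.
have dPM (M : nat) (x : R) : `|x| < M.+1%:R -> is_derive x 1 (PM M) (h x).
  rewrite ltr_norml => /andP[x1 x2].
  have [||dP EP] := @continuous_FTC1_closed R h (- (M.+1%:R)) x M.+1%:R x2 _ x1.
  - apply: continuous_compact_integrable; first exact: segment_compact.
    exact: continuous_subspaceT.
  - exact: ch.
  by apply: DeriveDef => //; rewrite -derive1E.
pose Q (M : nat) (x : R) := PM M x - PM M 0.
have dQ (M : nat) (x : R) : `|x| < M.+1%:R -> is_derive x 1 (Q M) (h x).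
  move=> xM; apply: is_derive_eq (is_derive_sub (dPM _ _ xM) (is_derive_cst (PM M 0) x (1:R))) _.
  by rewrite subr0.
have Q0 M : Q M 0 = 0 by rewrite /Q subrr.
have QQ (M N : nat) (x : R) : `|x| < M.+1%:R -> `|x| < N.+1%:R -> Q M x = Q N x.
  move=> xM xN; apply/eqP; rewrite -subr_eq0; apply/eqP.
  have := @derive_eq0_cst (fun t => Q M t - Q N t) `|x| (normr_ge0 _) _ x (lexx _).
  rewrite !Q0 subrr; apply=> s sx.
  apply: is_derive_eq (is_derive_sub (dQ M s (le_lt_trans sx xM)) (dQ N s (le_lt_trans sx xN))) _.
  by rewrite subrr.
exists (fun x => Q (Num.truncn `|x|) x); split; first by rewrite Q0.
move=> s; apply: (@near_eq_is_derive _ _ _ (Q (Num.truncn `|s|))); last first.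
  by apply: dQ; exact: truncnS_gt.
near=> y; apply: QQ; last exact: truncnS_gt.
near: y; apply: (cvgr_lt `|s|); last exact: truncnS_gt.
exact: norm_continuous.
Unshelve. all: by end_near. Qed.

(** Geometrically small steps confine the tail of the sequence to nested
    intervals, which yields both the limit and the rate of convergence. *)
Lemma geometric_limit (a : nat -> R) (c : R) : 0 <= c ->
  (forall k, `|a k.+1 - a k| <= c / 2 ^+ k) ->
  exists l, forall k, `|a k - l| <= 2 * c / 2 ^+ k.
Proof.
move=> c0 Ha; pose b k := a k - 2 * c / 2 ^+ k; pose d k := a k + 2 * c / 2 ^+ k.
have e0 k : 0 <= c / 2 ^+ k by rewrite divr_ge0 // exprn_ge0.
have eS k : 2 * c / 2 ^+ k.+1 = c / 2 ^+ k.
  by rewrite exprS invfM mulrACA divff // mul1r.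
have e2 k : 2 * c / 2 ^+ k = 2 * (c / 2 ^+ k) by rewrite mulrA.
have ib : {homo b : m n / (m <= n)%N >-> m <= n}.
  apply: homo_leq => //; first exact: le_trans.
  move=> k; rewrite /b eS e2; have := Ha k; have := e0 k.
  by rewrite ler_norml; move: (c / _) => e ? /andP[? ?]; lra.
have dd : {homo d : m n / (m <= n)%N >-> n <= m}.
  apply: homo_leq => //; first by move=> x y z xy yz; exact: le_trans yz xy.
  move=> k; rewrite /d eS e2; have := Ha k; have := e0 k.
  by rewrite ler_norml; move: (c / _) => e ? /andP[? ?]; lra.
have bd j k : b j <= d k.
  apply: (@le_trans _ _ (b (maxn j k))); first by apply: ib; exact: leq_maxl.
  apply: (@le_trans _ _ (d (maxn j k))); last by apply: dd; exact: leq_maxr.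
  by rewrite /b /d e2; have := e0 (maxn j k); move: (c / _) => e ?; lra.
exists (sup (range b)) => k.
have bl : b k <= sup (range b).
  apply: ub_le_sup; last by exists k.
  by exists (d 0%N) => _ [j _ <-].
have ld : sup (range b) <= d k.
  apply: ge_sup; first by exists (b 0%N), 0%N.
  by move=> _ [j _ <-].
move: bl ld; rewrite /b /d ler_norml; move: (sup _) (2 * c / _) => x y ? ?.
by apply/andP; split; lra.
Qed.

End LineCalculus.

(** * The Gronwall inequality and Picard iteration *)

Section ODE.
Variable R : realType.
Implicit Types (s t K c T : R).

(** Multiplication by exp (- K s) makes the left-hand side a nonincreasing
    function. *)
Lemma gronwall_scalar (phi dphi : R -> R) K c T : 0 <= T ->
  (forall s, 0 <= s <= T -> is_derive s 1 phi (dphi s)) ->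
  (forall s, 0 <= s <= T -> dphi s <= K * (phi s + c)) ->
  phi T + c <= (phi 0 + c) * expR (K * T).
Proof.
move=> T0 dp bp.
have := @ge0_derive_le R (fun s => - ((phi s + c) * expR (- K * s)))
  (fun s => - ((dphi s - K * (phi s + c)) * expR (- K * s))) T T0.
rewrite mulr0 expR0 mulr1 lerN2 => H.
have {H} := H _ _; rewrite -ler_pdivrMr ?expR_gt0 // -expRN -mulNr; apply.
- move=> s sT; apply: is_deriveN.
  apply: is_derive_eq (is_derive_mul (is_derive_add (dp s sT) (is_derive_cst c s (1:R))) (is_derive_expM (- K) s)) _.
  by rewrite addr0 /cst /=; ring.
- by move=> s sT; rewrite -mulNr mulr_ge0 ?expR_ge0 // oppr_ge0 subr_le0 bp.
Qed.

(** The factor n + 1 comes from comparing the maximum norm with the sum of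
    squares of the coordinates. *)
Definition gronwall_const n (L T : R) := (n.+1)%:R * expR ((2 * n%:R * L + n%:R + 1) * T).

Lemma gronwall_const_ge0 n L T : 0 <= gronwall_const n L T.
Proof. by rewrite mulr_ge0 // expR_ge0. Qed.

(** The maximum norm is not differentiable, so the scalar inequality is applied
    to the sum of squares of the coordinates; negative times follow by reversing
    time. *)
Lemma gronwall n (D d : R -> 'cV[R]_n) (L eps T : R) : 0 <= L -> 0 <= eps ->
  (forall s i, `|s| <= T -> is_derive s 1 (fun t => D t i 0) (d s i 0)) ->
  (forall s i, `|s| <= T -> `|d s i 0| <= L * `|D s| + eps) ->
  forall s, `|s| <= T -> `|D s| <= gronwall_const n L T * (`|D 0| + eps).
Proof.
move=> L0 eps0.
pose K := 2 * n%:R * L + n%:R + 1.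
have K0 : 0 <= K by rewrite !addr_ge0 // !mulr_ge0.
have pos (E e : R -> 'cV[R]_n) : 
    (forall s i, 0 <= s <= T -> is_derive s 1 (fun t => E t i 0) (e s i 0)) ->
    (forall s i, 0 <= s <= T -> `|e s i 0| <= L * `|E s| + eps) ->
    forall s, 0 <= s <= T -> `|E s| <= gronwall_const n L T * (`|E 0| + eps).
  move=> dE be s /andP[s0 sT].
  pose phi t := \sum_i E t i 0 ^+ 2.
  have phiE t i : `|E t i 0| ^+ 2 <= phi t.
    rewrite real_normK ?num_real // /phi (bigD1 i) //= lerDl.
    by apply: sumr_ge0 => j _; exact: sqr_ge0.
  have nE t : `|E t| ^+ 2 <= phi t.
    have p0 : 0 <= phi t by apply: sumr_ge0 => j _; exact: sqr_ge0.
    rewrite -(sqr_sqrtr p0) ler_pXn2r ?nnegrE ?sqrtr_ge0 //.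
    apply: norm_le_coord => [|k]; first exact: sqrtr_ge0.
    by rewrite -(@ler_pXn2r _ 2) ?nnegrE ?sqrtr_ge0 // sqr_sqrtr.
  have sub t : 0 <= t <= s -> 0 <= t <= T by move=> /andP[-> ts]; exact: le_trans ts sT.
  have := @gronwall_scalar phi (fun t => \sum_i (e t i 0 * E t i 0 + E t i 0 * e t i 0)) K (eps ^+ 2) s s0.
  have -> : phi = fun t => \sum_i E t i 0 * E t i 0.
    by apply/funext => t; apply: eq_bigr => i _; rewrite expr2.
  move=> H; have {H} := H _ _.
  rewrite (_ : (\sum_i E s i 0 * E s i 0) = phi s); last by apply: eq_bigr => i _; rewrite expr2.
  rewrite (_ : (\sum_i E 0 i 0 * E 0 i 0) = phi 0); last by apply: eq_bigr => i _; rewrite expr2.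
  move=> H; have {}H := H _ _.
  have p0n : phi 0 <= n%:R * `|E 0| ^+ 2.
    apply: (@le_trans _ _ (\sum_(i < n) `|E 0| ^+ 2)).
      apply: ler_sum => i _; rewrite -[leLHS]real_normK ?num_real //.
      by rewrite ler_pXn2r ?nnegrE // norm_coord_le.
    by rewrite sumr_const card_ord mulr_natl.
  have key : `|E s| ^+ 2 <= (gronwall_const n L T * (`|E 0| + eps)) ^+ 2.
    apply: (le_trans (nE s)).
    apply: (@le_trans _ _ (phi s + eps ^+ 2)); first by rewrite lerDl sqr_ge0.
    apply: (le_trans (H _ _)).
    - move=> t ts; apply: is_derive_sum_fun => i.
      by apply: is_derive_mul; apply: dE; exact: sub.
    - move=> t ts.
      rewrite (_ : (\sum_i E t i 0 * E t i 0) = phi t); last by apply: eq_bigr => i _; rewrite expr2.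
      apply: (@le_trans _ _ (\sum_(i < n) 2 * (`|E t| * (L * `|E t| + eps)))).
        apply: ler_sum => i _; rewrite [E t i 0 * _]mulrC -mulr2n -[leLHS]mulr_natl ler_wpM2l //.
        apply: le_trans (ler_norm _) _; rewrite normrM mulrC ler_pM //.
          exact: norm_coord_le.
        by apply: be; exact: sub.
      rewrite sumr_const card_ord -[leLHS]mulr_natl /K.
      have := nE t; have : 0 <= n%:R :> R by [].
      have : 0 <= phi t by apply: sumr_ge0 => j _; exact: sqr_ge0.
      move: (`|E t|) (phi t) (n%:R : R) => y p m p0 m0 yp.
      have a1 : m * L * y ^+ 2 <= m * L * p by rewrite ler_wpM2l // mulr_ge0.
      have a2 : m * (2 * y * eps) <= m * (p + eps ^+ 2).
        by rewrite ler_wpM2l //; have := sqr_ge0 (y - eps); nra.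
      have a3 : 0 <= (2 * m * L + 1) * eps ^+ 2 + p.
        by rewrite addr_ge0 // mulr_ge0 ?sqr_ge0 // addr_ge0 // !mulr_ge0.
      nra.
    have e1 : expR (K * s) <= expR (K * T) by rewrite ler_expR ler_wpM2l.
    have e2 : 1 <= expR (K * T).
      by rewrite -expR0 ler_expR mulr_ge0 // (le_trans s0).
    have q1 : phi 0 + eps ^+ 2 <= (n.+1%:R * (`|E 0| + eps)) ^+ 2.
      move: p0n; rewrite -natr1; have : 0 <= n%:R :> R by [].
      have := normr_ge0 (E 0); move: (`|E 0|) (phi 0) (n%:R : R) => y p m y0 m0 p0n.
      have b1 : 0 <= m * y ^+ 2 by rewrite mulr_ge0 ?sqr_ge0.
      have b2 : 0 <= m ^+ 2 * y ^+ 2 by rewrite mulr_ge0 ?sqr_ge0.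
      have b3 : 0 <= m * eps ^+ 2 by rewrite mulr_ge0 ?sqr_ge0.
      have b4 : 0 <= m ^+ 2 * eps ^+ 2 by rewrite mulr_ge0 ?sqr_ge0.
      have b5 : 0 <= (m + 1) ^+ 2 * (y * eps) by rewrite mulr_ge0 ?sqr_ge0 // mulr_ge0.
      have b6 : 0 <= y ^+ 2 by rewrite sqr_ge0.
      nra.
    apply: (@le_trans _ _ ((n.+1%:R * (`|E 0| + eps)) ^+ 2 * expR (K * T))).
      apply: ler_pM => //.
      by rewrite addr_ge0 ?sqr_ge0 //; apply: sumr_ge0 => j _; exact: sqr_ge0.
    have -> : (gronwall_const n L T * (`|E 0| + eps)) ^+ 2 =
        (n.+1%:R * (`|E 0| + eps)) ^+ 2 * (expR (K * T) * expR (K * T)).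
      by rewrite /gronwall_const -/K; ring.
    by rewrite ler_wpM2l ?sqr_ge0 // ler_peMr // expR_ge0.
  by move: key; rewrite ler_pXn2r ?nnegrE // mulr_ge0 ?gronwall_const_ge0 // addr_ge0.
move=> dD bD s; rewrite ler_norml => /andP[s1 s2]; have [s0|s0] := lerP 0 s.
  apply: (pos D d) => [t i /andP[t0 tT]|t i /andP[t0 tT]|]; last by rewrite s0.
    by apply: dD; rewrite ger0_norm.
  by apply: bD; rewrite ger0_norm.
rewrite -(opprK s) (_ : D 0 = D (- 0)); last by rewrite oppr0.
apply: (pos (fun t => D (- t)) (fun t => - d (- t))) => [t i /andP[t0 tT]|t i /andP[t0 tT]|].
- rewrite mxE; apply: (@is_derive_opp_arg R (fun t => D t i 0)).
  by apply: dD; rewrite normrN ger0_norm.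
- by rewrite mxE normrN; apply: bD; rewrite normrN ger0_norm.
- by rewrite oppr_ge0 ltW //= lerNl.
Qed.

Section Picard.
Variables (n : nat) (F : R -> 'cV[R]_n -> 'cV[R]_n) (x0 : 'cV[R]_n) (L M : R).
Hypothesis L0 : 0 < L.
Hypothesis FL : forall s x y, `|F s x - F s y| <= L * `|x - y|.
Hypothesis FM : forall s, `|F s x0| <= M.
Let ccont (u : R -> 'cV[R]_n) := forall i, continuous (fun s => u s i 0).
Hypothesis Fc : forall u, ccont u -> ccont (fun s => F s (u s)).

Let step (u v : R -> 'cV[R]_n) :=
  v 0 = x0 /\ forall s i, is_derive s 1 (fun s => v s i 0) (F s (u s) i 0).

Lemma step_ex u : ccont u -> exists v, step u v.
Proof.
move=> cu; have /choice[P HP] := fun i => antiderivative (Fc cu (i := i)).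
exists (fun s => \col_i (x0 i 0 + P i s)); split.
  by apply/matrixP => i j; rewrite ord1 mxE (HP i).1 addr0.
move=> s i; rewrite (_ : (fun _ => _) = fun s => x0 i 0 + P i s); last first.
  by apply/funext => t; rewrite mxE.
apply: is_derive_eq (is_derive_add (is_derive_cst (x0 i 0) s (1:R)) ((HP i).2 s)) _.
by rewrite add0r.
Qed.

Lemma step_cont u v : step u v -> ccont v.
Proof. by move=> [_ dv] i s; exact: is_derive_continuous (dv s i). Qed.

(** With the weight exp (2 L |s|), one integration step halves distances on the
    whole line, so that Picard iteration converges for all times at once. *)
Lemma step_contract u v u' v' c : 0 <= c -> step u v -> step u' v' ->
  (forall s, `|u s - u' s| <= c * expR (2 * L * `|s|)) ->
  forall s, `|v s - v' s| <= c / 2 * expR (2 * L * `|s|).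
Proof.
move=> c0 [v0 dv] [v0' dv'] Hu s.
apply: norm_le_coord => [|i]; first by rewrite mulr_ge0 ?expR_ge0 ?divr_ge0.
have -> : c / 2 = c * L / (2 * L) by field; rewrite gt_eqF.
rewrite !mxE.
apply: (@exp_comparison R (fun s => v s i 0 - v' s i 0) (fun s => F s (u s) i 0 - F s (u' s) i 0) _ _ `|s|) => //.
- by rewrite mulr_ge0 // ltW.
- by rewrite mulr_gt0.
- by rewrite v0 v0' subrr.
move=> t _; have := norm_coord_le (F t (u t) - F t (u' t)) i; rewrite !mxE => /le_trans; apply.
apply: (le_trans (FL _ _ _)); rewrite [c * L]mulrC -mulrA ler_wpM2l //.
exact: ltW.
Qed.

Lemma picard : exists u : R -> 'cV[R]_n, u 0 = x0 /\
  forall s i, is_derive s 1 (fun s => u s i 0) (F s (u s) i 0).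
Proof.
have /choice[st Hst] : forall u, exists v, ccont u -> step u v.
  move=> u; have [cu|ncu] := pselect (ccont u); last by exists u.
  by have [v Hv] := step_ex cu; exists v.
pose U k := iter k st (fun=> x0).
have cU k : ccont (U k).
  by elim: k => [i s|k IH]; [exact: cst_continuous | exact: step_cont (Hst _ IH)].
have sU k : step (U k) (U k.+1) by exact: Hst.
have M0 : 0 <= M by exact: le_trans (normr_ge0 _) (FM 0).
pose E s := expR (2 * L * `|s|).
have E0 s : 0 <= E s by exact: expR_ge0.
pose c := M / (2 * L).
have c0 : 0 <= c by rewrite divr_ge0 // mulr_ge0 // ltW.
have dU k s : `|U k.+1 s - U k s| <= c / 2 ^+ k * E s.
  elim: k s => [|k IH] s.
    rewrite expr0 divr1; apply: norm_le_coord => [|i]; first by rewrite mulr_ge0.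
    rewrite !mxE; apply: (@exp_comparison R (fun s => U 1%N s i 0 - x0 i 0) (fun s => F s x0 i 0) _ _ `|s|) => //.
    - by rewrite mulr_gt0.
    - by rewrite (sU 0%N).1 subrr.
    - move=> t _; apply: is_derive_eq (is_derive_sub ((sU 0%N).2 t i) (is_derive_cst (x0 i 0) t (1:R))) _.
      by rewrite subr0.
    - move=> t _; apply: (le_trans (norm_coord_le _ _)); apply: (le_trans (FM t)).
      rewrite ler_peMr // -expR0 ler_expR !mulr_ge0 //; exact: ltW.
  rewrite exprSr invfM mulrA.
  apply: step_contract (sU k.+1) (sU k) _ s => [|t].
    by rewrite divr_ge0 // exprn_ge0.
  exact: IH.
have /choice[u0 Hu0] : forall si : R * 'I_n, exists l, forall k, `|U k si.1 si.2 0 - l| <= 2 * (c * E si.1) / 2 ^+ k.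
  move=> [s i] /=; apply: geometric_limit => [|k]; first by rewrite mulr_ge0.
  have := le_trans (norm_coord_le _ i) (dU k s); rewrite !mxE => /le_trans; apply.
  by rewrite mulrAC.
pose u s : 'cV[R]_n := \col_i u0 (s, i).
have Uu k s : `|U k s - u s| <= 2 * c / 2 ^+ k * E s.
  apply: norm_le_coord => [|i].
    by rewrite mulr_ge0 // divr_ge0 ?exprn_ge0 // mulr_ge0.
  by rewrite !mxE; have := Hu0 (s, i) k; rewrite /= mulrA mulrAC.
have small (a e : R) : 0 <= a -> 0 < e -> exists k : nat, a / 2 ^+ k < e.
  move=> a0 e0; exists (Num.truncn (a / e)); rewrite ltr_pdivrMr ?exprn_gt0 //.
  rewrite mulrC -ltr_pdivrMr //; apply: (lt_le_trans (truncnS_gt _)).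
  by rewrite -natrX ler_nat ltn_expl.
have cu : ccont u.
  move=> i s; apply/cvgrPdist_lt => e e0.
  pose B := expR (2 * L * (`|s| + 1)).
  have B0 : 0 <= B by exact: expR_ge0.
  have EB t : `|t| <= `|s| + 1 -> E t <= B.
    by move=> ts; rewrite /E ler_expR ler_wpM2l // mulr_ge0 // ltW.
  have [k Hk] := small (2 * c * B) (e / 3) (mulr_ge0 (mulr_ge0 (ler0n _ _) c0) B0) (divr_gt0 e0 (ltr0Sn _ _)).
  have near_s t : `|t| <= `|s| + 1 -> `|U k t i 0 - u t i 0| < e / 3.
    move=> ts; apply: le_lt_trans Hk.
    have := norm_coord_le (U k t - u t) i; rewrite !mxE => /le_trans; apply.
    apply: (le_trans (Uu k t)); rewrite mulrAC ler_wpM2r ?invr_ge0 ?exprn_ge0 //.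
    by apply: ler_wpM2l (EB t ts); rewrite mulr_ge0.
  have /cvgrPdist_lt /(_ (e / 3)) := cU k i s; rewrite divr_gt0 // => /(_ isT) cUk.
  near=> t.
  have ts : `|t| <= `|s| + 1.
    have : `|s - t| < 1 by near: t; apply: cvgr_dist_lt; [exact: cvg_id|exact: ltr01].
    have := ler_normD s (t - s); rewrite addrCA subrr addr0 distrC; lra.
  have h1 := near_s t ts; have h2 : `|U k s i 0 - u s i 0| < e / 3 by apply: near_s; rewrite lerDl.
  have h3 : `|U k s i 0 - U k t i 0| < e / 3 by near: t.
  move: h1 h2 h3; move: (U k t i 0) (u t i 0) (U k s i 0) (u s i 0) => p1 p2 p3 p4.
  rewrite !ltr_norml => /andP[? ?] /andP[? ?] /andP[? ?]; apply/andP; split; lra.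
have [w [w0 dw]] := step_ex cu.
suff uw : u = w by exists u; split; [rewrite uw|move=> s i; rewrite {1}uw].
apply/funext => s; apply/eqP; rewrite -subr_eq0 -normr_le0 leNgt; apply/negP => p.
have [k Hk] := small (2 * c * E s) (`|u s - w s| / 2) (mulr_ge0 (mulr_ge0 (ler0n _ _) c0) (E0 s)) (divr_gt0 p (ltr0Sn _ _)).
have h1 : `|U k.+1 s - w s| <= 2 * c / 2 ^+ k * E s.
  apply: (le_trans (step_contract (c := 2 * c / 2 ^+ k) _ (sU k) (conj w0 dw) (Uu k) s)).
    by rewrite divr_ge0 ?exprn_ge0 // mulr_ge0.
  rewrite ler_wpM2r // ler_piMr //; last by rewrite invf_le1 // ler1n.
  by rewrite divr_ge0 ?exprn_ge0 // mulr_ge0.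
have h2 : `|u s - U k.+1 s| <= c / 2 ^+ k * E s.
  rewrite distrC (le_trans (Uu k.+1 s)) // ler_wpM2r //.
  by rewrite exprS invfM mulrACA divff // mul1r.
have h3 := ler_distD (U k.+1 s) (u s) (w s).
pose X := c / 2 ^+ k * E s.
have e1 : 2 * c * E s / 2 ^+ k = 2 * X by rewrite /X; ring.
have e2 : 2 * c / 2 ^+ k * E s = 2 * X by rewrite /X; ring.
move: p Hk h1 h2 h3; rewrite e1 e2 -/X.
by clear e1 e2; move: (`|_ - _|) (`|_ - _|) (`|_ - _|) X => a1 a2 a3 a4; lra.
Unshelve. all: by end_near. Qed.

End Picard.

End ODE.

(** * Local solutions of autonomous systems *)

Section Paths.
Variable R : realType.
Implicit Types (s t r T : R).

Lemma line_MVT (f d : R -> R) s t :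
  (forall z, Num.min s t <= z <= Num.max s t -> is_derive z 1 f (d z)) ->
  exists2 z, Num.min s t <= z <= Num.max s t & f t - f s = d z * (t - s).
Proof.
have H (p q : R) : p <= q -> (forall z, p <= z <= q -> is_derive z 1 f (d z)) ->
    exists2 z, p <= z <= q & f q - f p = d z * (q - p).
  move=> pq df; have [z zs|z|z zs E] := @MVT_segment R f d p q pq.
  - by apply: df; move: zs; rewrite in_itv /= => /andP[/ltW -> /ltW ->].
  - apply: derivable_within_continuous => {}z; rewrite in_itv /= => zs.
    by have := df z zs; case.
  - by exists z; [move: zs; rewrite in_itv|].
have [st|/ltW ts] := leP s t; first exact: H.
move=> df; have [z zz E] := H t s ts df; exists z => //.
by rewrite -opprB E -mulrN opprB.
Qed.

(** This retraction onto [a, b] extends a field given on a box to a globally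
    Lipschitz field. *)
Definition clamp (a b x : R) := Num.max a (Num.min b x).

Lemma clamp_itv a b x : a <= b -> a <= clamp a b x <= b.
Proof. by move=> ab; rewrite /clamp le_max lexx /= ge_max ab ge_min lexx. Qed.

Lemma clamp_id a b x : a <= x <= b -> clamp a b x = x.
Proof. by move=> /andP[ax xb]; rewrite /clamp min_r // max_r. Qed.

Lemma clamp_lipschitz a b x y : `|clamp a b x - clamp a b y| <= `|x - y|.
Proof.
rewrite /clamp; have m2 p q (c : R) : `|Num.max c p - Num.max c q| <= `|p - q|.
  rewrite ler_norml; have := ler_norm (p - q); have := ler_norm (- (p - q)); rewrite normrN.
  by case: (ltP c p) => ?; case: (ltP c q) => ? ? ?; apply/andP; split; lra.
have m1 p q (c : R) : `|Num.min c p - Num.min c q| <= `|p - q|.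
  rewrite ler_norml; have := ler_norm (p - q); have := ler_norm (- (p - q)); rewrite normrN.
  by case: (ltP c p) => ?; case: (ltP c q) => ? ? ?; apply/andP; split; lra.
exact: le_trans (m2 _ _ _) (m1 _ _ _).
Qed.

Lemma clamp_continuous a b : continuous (clamp a b).
Proof.
move=> x; apply/cvgrPdist_lt => e e0; near=> y.
apply: le_lt_trans (clamp_lipschitz _ _ _ _) _.
by near: y; apply: (@cvgr_dist_lt _ _ _ _ _ id).
Unshelve. all: by end_near. Qed.

Lemma comp_path_continuous n (f : 'cV[R]_n -> R) (u : R -> 'cV[R]_n) s :
  {for u s, continuous f} -> (forall i, {for s, continuous (fun t => u t i 0)}) ->
  {for s, continuous (fun t => f (u t))}.
Proof.
move=> cf cu; apply/cvgrPdist_lt => e e0.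
have [d d0 Hd] := continuous_epsilon cf e0.
have H i : \forall t \near s, `|u s i 0 - u t i 0| < d.
  by have /cvgrPdist_lt /(_ d d0) := cu i.
apply: filterS (filter_forall _ H) => t Ht.
have -> : u t = u s + (u t - u s) by rewrite addrC subrK.
rewrite distrC; apply: Hd; apply: norm_lt_coord => // k.
by rewrite !mxE distrC.
Qed.

Lemma is_derive_of_line n (f : 'cV[R]_n -> R) x v s d :
  is_derive s 1 (fun s => f (x + s *: v)) d -> is_derive (x + s *: v) v f d.
Proof.
have E : (fun h => h^-1 *: (((fun s => f (x + s *: v)) \o shift s) (h *: (1 : R)) - f (x + s *: v))) =
         (fun h => h^-1 *: ((f \o shift (x + s *: v)) (h *: v) - f (x + s *: v))).
  apply/funext => h; congr (_ *: (_ - _)) => /=; congr f.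
  by rewrite [h *: 1]mulr1 scalerDl addrCA.
by case=> ex <-; split; move: ex; rewrite /derivable /derive E.
Qed.

Lemma mulmx_norm_le m n (A : 'M[R]_(m, n)) (v : 'cV[R]_n) (c : R) : 0 <= c ->
  (forall i j, `|A i j| <= c) -> `|A *m v| <= n%:R * c * `|v|.
Proof.
move=> c0 Ac; apply: norm_le_coord => [|i]; first by rewrite !mulr_ge0.
rewrite mxE (eq_bigr (fun j => v j 0 * A i j)); last by move=> j _; rewrite mulrC.
exact: sum_coord_bound.
Qed.

Lemma box_jac_bound n m (V : set 'cV[R]_n) (a b : 'I_n -> R) (F : 'cV[R]_n -> 'cV[R]_m) :
  box a b `<=` V -> (forall k, smooth_on V (fun x => F x k 0)) ->
  exists2 c : R, 0 <= c & forall x (v : 'cV[R]_n), box a b x -> `|jac F x *m v| <= c * `|v|.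
Proof.
move=> KV sF.
have [C C0 HC] := smooth_family_bounded KV (fun kj : 'I_m * 'I_n => smooth_partial kj.2 (sF kj.1)).
exists (n%:R * C) => [|x v Kx]; first exact: mulr_ge0.
apply: mulmx_norm_le => // i j; rewrite mxE.
by exact: (HC (i, j)).
Qed.

Lemma box_bound n m (V : set 'cV[R]_n) (a b : 'I_n -> R) (F : 'cV[R]_n -> 'cV[R]_m) :
  box a b `<=` V -> (forall k, smooth_on V (fun x => F x k 0)) ->
  exists2 c : R, 0 <= c & forall x, box a b x -> `|F x| <= c.
Proof.
move=> KV sF.
have [C C0 HC] := smooth_family_bounded KV sF.
exists C => // x Kx; by apply: norm_le_coord => // k; exact: HC.
Qed.

Lemma open_ball_norm n (c : 'cV[R]_n) r : open [set x | `|x - c| < r].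
Proof.
rewrite openE => x xr; apply/nbhs_ballP; exists (r - `|x - c|); first by rewrite /= subr_gt0.
move=> y; rewrite -ball_normE /= ltrBrDr distrC => H.
by apply: le_lt_trans (ler_distD x _ _) _.
Qed.

Lemma ball_box n (c : 'cV[R]_n) r : 0 <= r ->
  [set x | `|x - c| <= r] = box (fun k => c k 0 - r) (fun k => c k 0 + r).
Proof.
move=> r0; apply/seteqP; split=> x xr.
  move=> k; have := le_trans (norm_coord_le (x - c) k) xr.
  by rewrite !mxE ler_distl => /andP[-> ->].
apply: norm_le_coord => // k; rewrite !mxE ler_distl.
by have /andP[-> ->] := xr k.
Qed.

(** A bounded path of matrices defines a globally Lipschitz field, so the
    solution exists for all times. *)
Lemma linear_ode n (A : R -> 'M[R]_n) (c : R) (v0 : 'cV[R]_n) : 0 <= c ->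
  (forall i j, continuous (fun s => A s i j)) ->
  (forall s (v : 'cV[R]_n), `|A s *m v| <= c * `|v|) ->
  exists u : R -> 'cV[R]_n, u 0 = v0 /\
  forall s i, is_derive s 1 (fun s => u s i 0) ((A s *m u s) i 0).
Proof.
move=> c0 cA bA.
apply: (@picard R n (fun s v => A s *m v) v0 (c + 1) (c * `|v0|)) => //.
- by rewrite ltr_wpDl.
- move=> s x y; rewrite -mulmxBr (le_trans (bA _ _)) // ler_wpM2r //.
  by rewrite lerDl.
move=> u cu i s; rewrite (_ : (fun _ => _) = \sum_j (fun s => A s i j * u s j 0)); last first.
  by apply/funext => t; rewrite mxE fct_sumE.
elim/big_rec: _ => [|j f _ cf]; first exact: cst_continuous.
by apply: (continuousD _ cf); apply: continuousM; [exact: cA|exact: cu].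
Qed.

(** Clamping the coordinates makes the field globally Lipschitz and bounded by
    B. Before time r / B a solution stays in the ball of radius r, where the
    clamp is the identity. *)
Lemma local_ode n (V : set 'cV[R]_n) (a b : 'I_n -> R) (F : 'cV[R]_n -> 'cV[R]_n) :
  box a b `<=` V -> (forall k, smooth_on V (fun x => F x k 0)) ->
  exists2 B : R, 0 < B & forall x r, 0 < r ->
   (forall y, `|y - x| <= r -> box a b y) ->
   exists u : R -> 'cV[R]_n, [/\ u 0 = x,
     forall s, `|s| * B <= r -> `|u s - x| <= r &
     forall s i, `|s| * B <= r -> is_derive s 1 (fun s => u s i 0) (F (u s) i 0)].
Proof.
move=> KV sF; have [L L0 HL] := box_lipschitz KV sF.
have [M M0 HM] := box_bound KV sF.
exists (M + 1) => [|x r r0 Hx]; first by rewrite ltr_wpDl.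
have Kx : box a b x by apply: Hx; rewrite subrr normr0 ltW.
have ab k : a k <= b k by have /andP[] := Kx k; exact: le_trans.
pose cl (y : 'cV[R]_n) : 'cV[R]_n := \col_k clamp (a k) (b k) (y k 0).
have Kcl y : box a b (cl y) by move=> k; rewrite mxE; exact: clamp_itv.
have cl_lip y z : `|cl y - cl z| <= `|y - z|.
  apply: norm_le_coord => // k; rewrite !mxE (le_trans (clamp_lipschitz _ _ _ _)) //.
  by have := norm_coord_le (y - z) k; rewrite !mxE.
have clE y : box a b y -> cl y = y.
  by move=> Ky; apply/matrixP => i j; rewrite ord1 mxE clamp_id.
have [u [u0 du]] : exists u : R -> 'cV[R]_n, u 0 = x /\
    forall s i, is_derive s 1 (fun s => u s i 0) (F (cl (u s)) i 0).
  apply: (@picard R n (fun s y => F (cl y)) x (L + 1) M) => //.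
  - by rewrite ltr_wpDl.
  - move=> s y z; apply: (le_trans (HL _ _ (Kcl z) (Kcl y))).
    apply: (@le_trans _ _ (L * `|y - z|)); first by rewrite ler_wpM2l.
    by rewrite ler_wpM2r // lerDl.
  - by move=> s; exact: HM.
  move=> v cv i s; apply: (@comp_path_continuous n (fun y => F y i 0) (fun s => cl (v s))).
    exact: smooth_continuous (sF i) (KV _ (Kcl _)).
  move=> j; rewrite (_ : (fun _ => _) = clamp (a j) (b j) \o (fun t => v t j 0)); last first.
    by apply/funext => t; rewrite /= mxE.
  by apply: continuous_comp; [exact: cv | exact: clamp_continuous].
have uM s : `|u s - x| <= `|s| * (M + 1).
  apply: norm_le_coord => [|k]; first by rewrite mulr_ge0 // addr_ge0.
  have [z _ E] := @line_MVT (fun s => u s k 0) _ 0 s (fun t _ => du t k).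
  move: E; rewrite u0 !mxE => ->; rewrite subr0 normrM mulrC ler_wpM2l //.
  apply: (@le_trans _ _ M); last by rewrite lerDl.
  by apply: le_trans (norm_coord_le _ _) _; exact: HM.
exists u; split=> // s.
  by move=> sr; exact: le_trans (uM s) sr.
move=> i sr; have := du s i; rewrite clE //; apply: Hx.
exact: le_trans (uM s) sr.
Qed.

End Paths.

(** * Smooth dependence of solutions on parameters *)

Section Flow.
Variables (R : realType) (N : nat) (k0 : 'I_N).
Implicit Types (s t r T : R) (c z h : 'cV[R]_N).

Let e0 : 'cV[R]_N := delta_mx k0 0.

(** Coordinate k0 plays the role of time; the slice retains the parameters. *)
Definition slice z : 'cV[R]_N := z - z k0 0 *: e0.

Lemma sliceE z j : slice z j 0 = if j == k0 then 0 else z j 0.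
Proof.
rewrite !mxE eqxx andbT; case: eqVneq => [->|_]; last by rewrite mulr0 subr0.
by rewrite mulr1 subrr.
Qed.

Lemma slice0 z : slice z k0 0 = 0.
Proof. by rewrite sliceE eqxx. Qed.

Lemma slice_id z : slice (slice z) = slice z.
Proof. by rewrite {1}/slice slice0 scale0r subr0. Qed.

Lemma sliceD z h : slice (z + h) = slice z + slice h.
Proof. by rewrite /slice mxE scalerDl opprD addrACA. Qed.

Lemma slice_time z s : slice (z + s *: e0) = slice z.
Proof.
by rewrite sliceD {2}/slice !mxE !eqxx mulr1 subrr addr0.
Qed.

Lemma slice_line z : z = slice z + z k0 0 *: e0.
Proof. by rewrite subrK. Qed.

Lemma slice_norm z : `|slice z| <= `|z|.
Proof.
apply: norm_le_coord => // j; rewrite sliceE; case: eqP => _; rewrite ?normr0 //.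
exact: norm_coord_le.
Qed.

Lemma line_ball c z s r : c k0 0 = 0 -> `|slice z - c| < r -> `|s| < r ->
  `|slice z + s *: e0 - c| < r.
Proof.
move=> c0 zr sr; have r0 : 0 < r by exact: le_lt_trans (normr_ge0 _) zr.
apply: norm_lt_coord => // j; have := le_lt_trans (norm_coord_le _ j) zr.
rewrite !mxE eqxx andbT; case: eqVneq => [->|_]; rewrite ?mulr1 ?mulr0 ?addr0 //.
by move=> _; rewrite c0 subrr add0r subr0.
Qed.

Lemma slice_ball c z r : c k0 0 = 0 -> `|z - c| < r -> `|slice z - c| < r.
Proof.
move=> c0 zr; have r0 : 0 < r by exact: le_lt_trans (normr_ge0 _) zr.
have -> : slice z - c = slice (z - c).
  apply/matrixP => j k; rewrite ord1 [RHS]sliceE mxE sliceE !mxE.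
  by case: eqVneq => [->|//]; rewrite c0 subr0.
exact: le_lt_trans (slice_norm _) zr.
Qed.

Lemma time_ball c z r : c k0 0 = 0 -> `|z - c| < r -> `|z k0 0| < r.
Proof.
by move=> c0; apply: le_lt_trans; have := norm_coord_le (z - c) k0; rewrite !mxE c0 subr0.
Qed.

(** A family of solutions of u' = F u, where coordinate k0 is the time and the
    initial values depend smoothly on the other coordinates. The point of the
    definition is its stability under passing to the first variation, proved in
    variation_sol. *)
Record sol n (F : 'cV[R]_n -> 'cV[R]_n) (Om : set 'cV[R]_n) (a b : 'I_n -> R)
    (u : 'cV[R]_N -> 'cV[R]_n) c r : Prop := Sol {
  sol_open : open Om;
  sol_smooth : forall i, smooth_on Om (fun y => F y i 0);
  sol_box : box a b `<=` Om;
  sol_in : forall z, `|z - c| < r -> box a b (u z);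
  sol_ode : forall z i, `|z - c| < r -> is_derive z e0 (fun z => u z i 0) (F (u z) i 0);
  sol_init : forall i, smooth_on [set z | `|z - c| < r] (fun z => u (slice z) i 0)
}.

(** The system satisfied by a solution together with one of its parameter
    derivatives. *)
Definition variation n (F : 'cV[R]_n -> 'cV[R]_n) (y : 'cV[R]_(n + n)) : 'cV[R]_(n + n) :=
  col_mx (F (usubmx y)) (jac F (usubmx y) *m dsubmx y).

Lemma sol_line n F Om a b (u : 'cV[R]_N -> 'cV[R]_n) c r z s i :
  sol F Om a b u c r -> c k0 0 = 0 -> `|slice z - c| < r -> `|s| < r ->
  is_derive s 1 (fun s => u (slice z + s *: e0) i 0) (F (u (slice z + s *: e0)) i 0).
Proof.
move=> S c0 zr sr; apply: (@is_derive_line R N (fun z => u z i 0)); apply: (sol_ode S).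
exact: line_ball.
Qed.

Section Variation.
Variables (n : nat) (F : 'cV[R]_n -> 'cV[R]_n) (Om : set 'cV[R]_n) (a b : 'I_n -> R).
Variables (u : 'cV[R]_N -> 'cV[R]_n) (c : 'cV[R]_N) (r r' : R).
Hypothesis c0 : c k0 0 = 0.
Hypothesis S : sol F Om a b u c r.
Hypotheses (r'0 : 0 < r') (r'r : r' < r).

Let T := (r + r') / 2.
Let r'T : r' < T. Proof. by rewrite /T ltr_pdivlMr // mulr_natr mulr2n ltrD2r. Qed.
Let Tr : T < r. Proof. by rewrite /T ltr_pdivrMr // mulr_natr mulr2n ltrD2l. Qed.
Let T0 : 0 < T. Proof. exact: lt_trans r'0 r'T. Qed.
Let w z := u (slice z).
Let V := [set z : 'cV[R]_N | `|z - c| < r].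
Let oV : open V. Proof. exact: open_ball_norm. Qed.
Let a' k := c k 0 - T.
Let b' k := c k 0 + T.
Let KV : box a' b' `<=` V.
Proof. by rewrite -ball_box ?ltW // => z /= zT; exact: le_lt_trans zT Tr. Qed.

(** Two applications of Gronwall's inequality: solutions with nearby initial
    data differ to first order, and their difference deviates from the solutions
    v of the linearized equation to second order. *)
Lemma variation_bounds : exists C1 C3 : R, exists v : 'I_N -> 'cV[R]_N -> R -> 'cV[R]_n,
 [/\ 0 <= C1, 0 <= C3,
  (forall j z, `|slice z - c| <= T -> v j (slice z) 0 = \col_i partial j (fun z => w z i 0) (slice z) /\
     forall s i, `|s| <= T -> is_derive s 1 (fun s => v j (slice z) s i 0)
         ((jac F (u (slice z + s *: e0)) *m v j (slice z) s) i 0)) ,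
  (forall j z s, `|slice z - c| <= T -> `|s| <= T -> `|v j (slice z) s| <= C3) &
  forall z h s, `|slice z - c| <= T -> `|slice (z + h) - c| <= T -> `|s| <= T ->
   `|u (slice (z + h) + s *: e0) - u (slice z + s *: e0)| <= C1 * `|slice h| /\
   `|u (slice (z + h) + s *: e0) - u (slice z + s *: e0) - \sum_j slice h j 0 *: v j (slice z) s|
     <= C3 * `|slice h| ^+ 2].
Proof.
have sF := sol_smooth S; have KO := sol_box S.
have [L L0 HL] := box_lipschitz KO sF.
have [C2 C20 HC2] := box_taylor KO sF.
have [LJ LJ0 HLJ] := box_jac_bound KO sF.
have sw : forall k, smooth_on V (fun z => w z k 0) := sol_init S.
have [Lw Lw0 HLw] := box_lipschitz KV sw.
have [Cw Cw0 HCw] := box_taylor KV sw.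
have [Jw Jw0 HJw] := box_jac_bound KV sw.
have inV z s : `|slice z - c| <= T -> `|s| <= T -> `|slice z + s *: e0 - c| < r.
  by move=> zT sT; apply: line_ball => //; exact: le_lt_trans Tr.
have inB z : `|slice z - c| <= T -> box a' b' (slice z) by rewrite -ball_box // ltW.
have inK z s : `|slice z - c| <= T -> `|s| <= T -> box a b (u (slice z + s *: e0)).
  by move=> zT sT; apply: (sol_in S); exact: inV.
have /choice[v Hv] : forall jz : 'I_N * 'cV[R]_N, exists v : R -> 'cV[R]_n,
    `|slice jz.2 - c| <= T ->
    v 0 = \col_i partial jz.1 (fun z => w z i 0) (slice jz.2) /\
    forall s i, `|s| <= T -> is_derive s 1 (fun s => v s i 0)
         ((jac F (u (slice jz.2 + s *: e0)) *m v s) i 0).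
  move=> [j z] /=; have [zT|nzT] := pselect (`|slice z - c| <= T); last by exists (fun=> 0).
  pose cl s := clamp (- T) T s.
  have clT s : `|cl s| <= T by rewrite ler_norml; apply: clamp_itv; rewrite -subr_ge0 opprK addr_ge0 // ltW.
  have [|v [v0 dv]] := @linear_ode R n (fun s => jac F (u (slice z + cl s *: e0))) LJ
     (\col_i partial j (fun z => w z i 0) (slice z)) LJ0
     _ (fun s x => HLJ _ x (inK z (cl s) zT (clT s))).
    move=> i k s; rewrite (_ : (fun _ => _) = fun s => partial k (fun y => F y i 0) (u (slice z + cl s *: e0))); last first.
      by apply/funext => t; rewrite mxE.
    apply: (@comp_path_continuous R n _ (fun s => u (slice z + cl s *: e0))).
      apply: (smooth_continuous (smooth_partial k (sF i))); apply: KO; exact: inK.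
    move=> l; apply: (@continuous_comp _ _ _ cl (fun s => u (slice z + s *: e0) l 0)).
      exact: clamp_continuous.
    apply: is_derive_continuous; apply: (sol_line _ S) => //; apply: le_lt_trans Tr => //.
  exists v => _; split=> // s i sT; have := dv s i.
  by rewrite [cl s]clamp_id // -ler_norml.
pose gF := gronwall_const n L T; pose gJ := gronwall_const n LJ T.
have gF0 : 0 <= gF by exact: gronwall_const_ge0.
have gJ0 : 0 <= gJ by exact: gronwall_const_ge0.
exists (gF * Lw), (gJ * Jw + gJ * (Cw + C2 * (gF * Lw) ^+ 2)), (fun j z => v (j, z)).
have A0 : 0 <= gJ * Jw by rewrite mulr_ge0.
have B0 : 0 <= gJ * (Cw + C2 * (gF * Lw) ^+ 2).
  by rewrite mulr_ge0 // addr_ge0 // mulr_ge0 // sqr_ge0.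
have vP j z : `|slice z - c| <= T -> v (j, slice z) 0 = \col_i partial j (fun z => w z i 0) (slice z) /\
     forall s i, `|s| <= T -> is_derive s 1 (fun s => v (j, slice z) s i 0)
         ((jac F (u (slice z + s *: e0)) *m v (j, slice z) s) i 0).
  by move=> zT; have := Hv (j, slice z); rewrite /= slice_id; apply.
split.
- by rewrite mulr_ge0.
- by rewrite addr_ge0.
- exact: vP.
- move=> j z s zT sT; have [v0 dv] := vP j z zT.
  have := @gronwall R n (v (j, slice z)) (fun s => jac F (u (slice z + s *: e0)) *m v (j, slice z) s)
     LJ 0 T LJ0 (lexx _) (fun s i sT => dv s i sT) _ s sT.
  rewrite -/gJ addr0 => H; apply: le_trans (H _) _.
    move=> t i tT; rewrite addr0; apply: le_trans (norm_coord_le _ _) _.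
    by apply: HLJ; exact: inK.
  apply: (@le_trans _ _ (gJ * Jw)); last by rewrite lerDl.
  rewrite ler_wpM2l //; have -> : v (j, slice z) 0 = jac w (slice z) *m delta_mx j 0.
    by rewrite v0 -colE; apply/matrixP => i k; rewrite !mxE.
  by apply: le_trans (HJw _ _ (inB _ zT)) _; rewrite norm_delta mulr1.
move=> z h s zT zhT sT.
pose D s := u (slice (z + h) + s *: e0) - u (slice z + s *: e0).
have HD t : `|t| <= T -> `|D t| <= gF * Lw * `|slice h|.
  move=> tT.
  have := @gronwall R n D (fun s => F (u (slice (z + h) + s *: e0)) - F (u (slice z + s *: e0)))
     L 0 T L0 (lexx _) _ _ t tT.
  rewrite -/gF addr0 => H; apply: le_trans (H _ _) _.
  - move=> {}s i {}sT; rewrite !mxE (_ : (fun _ => _) = fun s => u (slice (z + h) + s *: e0) i 0 - u (slice z + s *: e0) i 0).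
      by apply: is_derive_sub; apply: (sol_line _ S) => //; apply: le_lt_trans Tr.
    by apply/funext => p; rewrite /D !mxE.
  - move=> {}s i {}sT; rewrite addr0; apply: le_trans (norm_coord_le _ _) _.
    by apply: HL; exact: inK.
  rewrite -mulrA ler_wpM2l // /D !scale0r !addr0.
  have := HLw _ _ (inB _ zT) (inB _ zhT); rewrite /w !slice_id.
  by rewrite [in leRHS]sliceD [in leRHS]addrAC subrr add0r.
split; first exact: HD.
pose Es s := D s - \sum_j slice h j 0 *: v (j, slice z) s.
have := @gronwall R n Es (fun s => F (u (slice (z + h) + s *: e0)) - F (u (slice z + s *: e0))
   - \sum_j slice h j 0 *: (jac F (u (slice z + s *: e0)) *m v (j, slice z) s))
   LJ (C2 * (gF * Lw * `|slice h|) ^+ 2) T LJ0 _ _ _ s sT.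
rewrite -/gJ => H; apply: le_trans (H _ _ _) _.
- by rewrite mulr_ge0 ?sqr_ge0.
- move=> p i pT; rewrite !mxE.
  rewrite (_ : (fun _ => _) = fun s => (u (slice (z + h) + s *: e0) i 0 - u (slice z + s *: e0) i 0)
      - \sum_j slice h j 0 * v (j, slice z) s i 0); last first.
    by apply/funext => t; rewrite /Es /D !mxE summxE; congr (_ - _); apply: eq_bigr => j _; rewrite mxE.
  rewrite summxE (eq_bigr (fun j => slice h j 0 * (jac F (u (slice z + p *: e0)) *m v (j, slice z) p) i 0)); last first.
    by move=> j _; rewrite mxE.
  apply: is_derive_sub.
    by apply: is_derive_sub; apply: (sol_line _ S) => //; apply: le_lt_trans Tr.
  apply: is_derive_sum_fun => j.
  apply: is_derive_eq (is_derive_mul (is_derive_cst (slice h j 0) p (1:R)) ((vP j z zT).2 p i pT)) _.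
  by rewrite mul0r add0r.
- move=> p i pT; apply: le_trans (norm_coord_le _ _) _.
  have -> : F (u (slice (z + h) + p *: e0)) - F (u (slice z + p *: e0))
      - \sum_j slice h j 0 *: (jac F (u (slice z + p *: e0)) *m v (j, slice z) p)
     = (F (u (slice (z + h) + p *: e0)) - F (u (slice z + p *: e0)) - jac F (u (slice z + p *: e0)) *m D p)
       + jac F (u (slice z + p *: e0)) *m Es p.
    rewrite /Es; move: (D p) => Dp; rewrite mulmxBr addrA subrK; congr (_ - _).
    by rewrite mulmx_sumr; apply: eq_bigr => j _; rewrite -scalemxAr.
  rewrite addrC; apply: le_trans (ler_normD _ _) _; apply: lerD.
    by apply: HLJ; exact: inK.
  apply: le_trans (HC2 _ _ (inK _ _ zT pT) (inK _ _ zhT pT)) _.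
  by rewrite ler_wpM2l // ler_pXn2r ?nnegrE ?HD // mulr_ge0 // mulr_ge0.
have E0 : `|Es 0| <= Cw * `|slice h| ^+ 2.
  have := HCw _ _ (inB _ zT) (inB _ zhT); rewrite /w !slice_id.
  rewrite [in leRHS]sliceD [in leRHS]addrAC subrr add0r; apply: le_trans.
  rewrite /Es /D !scale0r !addr0 sliceD [_ + _ - slice z]addrAC subrr add0r.
  rewrite (_ : \sum_j _ = jac w (slice z) *m slice h) // {2}(col_sum_delta (slice h)) mulmx_sumr.
  apply: eq_bigr => j _; rewrite (vP j z zT).1 -scalemxAr; congr (_ *: _).
  by rewrite -colE; apply/matrixP => i k; rewrite !mxE.
apply: (@le_trans _ _ (gJ * (Cw + C2 * (gF * Lw) ^+ 2) * `|slice h| ^+ 2)).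
  rewrite -[leRHS]mulrA ler_wpM2l //; apply: le_trans (lerD E0 (lexx _)) _.
  by rewrite le_eqVlt; apply/orP; left; apply/eqP; ring.
by rewrite ler_wpM2r ?sqr_ge0 // lerDr.
Qed.

(** In the parameters the remainder is quadratic by variation_bounds, and in the
    time direction the equation itself gives the derivative F u; both combine
    into the hypothesis of diff_quad. The ball shrinks from r to r' to leave
    room for increments. *)
Lemma sol_differentiable : exists v : 'I_N -> 'cV[R]_N -> 'cV[R]_n,
  exists B : R,
  [/\ 0 <= B,
   forall z i, `|z - c| < r' -> differentiable (fun z => u z i 0) z /\
      forall j, partial j (fun z => u z i 0) z = v j z i 0,
   forall j z, `|z - c| < r' -> `|v j z| <= B,
   forall j z i, `|z - c| < r' ->
     is_derive z e0 (fun z => v j z i 0) ((jac F (u z) *m v j z) i 0) &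
   forall j i, smooth_on [set z | `|z - c| < r'] (fun z => v j (slice z) i 0)].
Proof.
have sF := sol_smooth S; have KO := sol_box S.
have [L L0 HL] := box_lipschitz KO sF.
have [M M0 HM] := box_bound KO sF.
have [C1 [C3 [v0 [C10 C30 v0P v0B v0D]]]] := variation_bounds.
have sw : forall k, smooth_on V (fun z => w z k 0) := sol_init S.
(* The time derivative is given by the equation, the others by the first
   variation. *)
pose v j z := if j == k0 then F (u z) else v0 j (slice z) (z k0 0).
have inT z : `|z - c| < r' -> `|slice z - c| <= T /\ `|z k0 0| <= T.
  move=> zr; split; apply: ltW; apply: lt_trans r'T.
    exact: slice_ball.
  exact: time_ball c0 zr.
have inV z : `|z - c| < r' -> V z by move=> zr; exact: lt_trans zr r'r.
have D1 z i : `|z - c| < r' -> differentiable (fun z => u z i 0) z /\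
      forall j, partial j (fun z => u z i 0) z = v j z i 0.
  move=> zr; have [zT sT] := inT z zr.
  apply: (@diff_quad R N (fun z => u z i 0) z (fun j => v j z i 0) (C3 + L * (C1 + M)) (T - r')).
    by rewrite subr_gt0.
  move=> h hr.
  have zhT : `|z + h - c| < T.
    rewrite addrAC (le_lt_trans (ler_normD _ _)) //.
    by have := ltrD zr hr; rewrite addrCA subrr addr0.
  have szhT : `|slice (z + h) - c| <= T by apply: ltW; exact: slice_ball.
  have thT : `|(z + h) k0 0| <= T by apply: ltW; exact: time_ball c0 zhT.
  have [_ B2] := v0D z h (z k0 0) zT szhT sT.
  pose f s := u (slice (z + h) + s *: e0) i 0.
  have btw t : Num.min (z k0 0) ((z + h) k0 0) <= t <= Num.max (z k0 0) ((z + h) k0 0) -> `|t| <= T.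
    move: sT thT; rewrite !ler_norml => /andP[p1 p2] /andP[p3 p4].
    rewrite ge_min le_max => /andP[/orP[q|q] /orP[q'|q']]; apply/andP; split; lra.
  have df t : `|t| <= T -> is_derive t 1 f (F (u (slice (z + h) + t *: e0)) i 0).
    move=> tT; apply: (sol_line _ S) => //; apply: le_lt_trans Tr => //.
  have [t tI Et] := line_MVT (fun t tI => df t (btw t tI)).
  have tT := btw t tI.
  have tz : `|t - z k0 0| <= `|h|.
    have := norm_coord_le h k0; move: tI; rewrite mxE !ler_norml.
    rewrite ge_min le_max => /andP[/orP[q|q] /orP[q'|q']] /andP[p1 p2]; apply/andP; split; lra.
  have inK z' s : `|slice z' - c| <= T -> `|s| <= T -> box a b (u (slice z' + s *: e0)).
    move=> z'T s'T; apply: (sol_in S); apply: line_ball => //; exact: le_lt_trans Tr.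
  have lipt : `|u (slice (z + h) + t *: e0) - u (slice (z + h) + z k0 0 *: e0)| <= M * `|h|.
    apply: norm_le_coord => [|k]; first by rewrite mulr_ge0.
    have btw' y : Num.min (z k0 0) t <= y <= Num.max (z k0 0) t -> `|y| <= T.
      move: sT tT; rewrite !ler_norml => /andP[p1 p2] /andP[p3 p4].
      rewrite ge_min le_max => /andP[/orP[q|q] /orP[q'|q']]; apply/andP; split; lra.
    have [y yI Ey] := @line_MVT R (fun s => u (slice (z + h) + s *: e0) k 0) _ (z k0 0) t
       (fun y yI => sol_line k S c0 (le_lt_trans szhT Tr) (le_lt_trans (btw' y yI) Tr)).
    rewrite !mxE Ey normrM ler_pM //.
    apply: le_trans (norm_coord_le _ _) _; apply: HM; apply: inK => //; exact: btw'.
  have [lips _] := v0D z h (z k0 0) zT szhT sT.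
  have E1 : u (z + h) i 0 = f ((z + h) k0 0) by rewrite /f -slice_line.
  have E2 : u z i 0 = u (slice z + z k0 0 *: e0) i 0 by rewrite -slice_line.
  have E3 : \sum_j h j 0 * v j z i 0 = h k0 0 * F (u z) i 0
      + \sum_j slice h j 0 * v0 j (slice z) (z k0 0) i 0.
    rewrite (bigD1 k0) //= [in RHS](bigD1 k0) //= sliceE eqxx mul0r add0r.
    rewrite {1}/v eqxx; congr (_ + _); apply: eq_bigr => j jk.
    by rewrite sliceE (negPf jk) /v (negPf jk).
  have E4 : u (z + h) i 0 - u z i 0 - \sum_j h j 0 * v j z i 0 =
     (u (slice (z + h) + z k0 0 *: e0) - u (slice z + z k0 0 *: e0) - \sum_j slice h j 0 *: v0 j (slice z) (z k0 0)) i 0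
     + h k0 0 * (F (u (slice (z + h) + t *: e0)) - F (u z)) i 0.
    have E5 : (\sum_j slice h j 0 *: v0 j (slice z) (z k0 0)) i 0 = \sum_j slice h j 0 * v0 j (slice z) (z k0 0) i 0.
      by rewrite summxE; apply: eq_bigr => j _; rewrite mxE.
    have Et' : u (z + h) i 0 = u (slice (z + h) + z k0 0 *: e0) i 0 + F (u (slice (z + h) + t *: e0)) i 0 * h k0 0.
      rewrite E1 -[LHS](subrK (f (z k0 0))) Et mxE [z k0 0 + _ - _]addrAC subrr add0r addrC //.
    rewrite E3 Et' E2 !mxE E5; ring.
  rewrite E4 (le_trans (ler_normD _ _)) // mulrDl lerD //.
    apply: le_trans (norm_coord_le _ _) (le_trans B2 _).
    by rewrite ler_wpM2l // ler_pXn2r ?nnegrE // slice_norm.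
  rewrite normrM expr2 mulrCA ler_pM // ?norm_coord_le //.
  apply: le_trans (norm_coord_le _ _) _; rewrite [in F (u z)](slice_line z).
  apply: (le_trans (HL _ _ (inK _ _ zT sT) (inK _ _ szhT tT))).
  rewrite -mulrA ler_wpM2l //.
  apply: le_trans (ler_distD (u (slice (z + h) + z k0 0 *: e0)) _ _) _.
  rewrite mulrDl addrC lerD //; apply: le_trans lips _.
  by rewrite ler_wpM2l // slice_norm.
exists v, (C3 + M); split.
- by rewrite addr_ge0.
- exact: D1.
- move=> j z zr; have [zT sT] := inT z zr; rewrite /v; case: eqP => _.
    by apply: le_trans (HM _ _) _; [apply: (sol_in S); exact: inV|rewrite lerDr].
  by apply: le_trans (v0B _ _ _ zT sT) _; rewrite lerDl.
- move=> j z i zr; have [zT sT] := inT z zr; rewrite /v; case: eqVneq => jk.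
    have oR : open [set z | `|z - c| < r'] by exact: open_ball_norm.
    have [dc pc] := @partial_comp R N n (fun y => F y i 0) u z k0 (fun k => (D1 z k zr).1)
      (smooth_diff (sF i) (KO _ (sol_in S (inV _ zr)))).
    apply: DeriveDef; first exact: diff_derivable.
    rewrite [LHS]pc mxE; apply: eq_bigr => k _.
    by rewrite (D1 z k zr).2 /v eqxx mxE mulrC.
  have H := (v0P j z zT).2 (z k0 0) i sT.
  suff H2 : is_derive (slice z + z k0 0 *: e0) e0 (fun z => v0 j (slice z) (z k0 0) i 0)
      ((jac F (u (slice z + z k0 0 *: e0)) *m v0 j (slice z) (z k0 0)) i 0).
    by move: H2; rewrite -slice_line.
  apply: is_derive_of_line; rewrite (_ : (fun _ => _) = fun s => v0 j (slice z) s i 0) //.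
  apply/funext => s; rewrite slice_time slice_id.
  by rewrite !mxE !eqxx !mulr1 subrr add0r.
- move=> j i.
  have oR : open [set z | `|z - c| < r'] by exact: open_ball_norm.
  have ss k : smooth_on [set z | `|z - c| < r'] (fun z => slice z k 0).
    apply: (@smooth_eq _ _ _ (fun z => if k == k0 then 0 else z k 0)) => //.
      by move=> z _; rewrite sliceE.
    by case: eqP => _; [exact: smooth_cst|exact: smooth_coord].
  have sV z : `|z - c| < r' -> V (slice z).
    by move=> zr; apply: slice_ball => //; exact: lt_trans zr r'r.
  case: (eqVneq j k0) => jk; rewrite /v ?jk.
    rewrite eqxx; apply: (@smooth_comp R N _ oR n (fun y => F y i 0) Om (fun z => u (slice z))) => //.
      by move=> z zr; apply: KO; apply: (sol_in S); exact: sV.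
    by move=> k; apply: smooth_onS (sw k) => z zr; exact: lt_trans zr r'r.
  rewrite (negPf jk).
  apply: (@smooth_eq _ _ _ (fun z => partial j (fun z => w z i 0) (slice z))) => //.
    move=> z zr; have [zT _] := inT z zr.
    by rewrite slice_id slice0 (v0P j z zT).1 mxE.
  apply: (@smooth_comp R N _ oR N (partial j (fun z => w z i 0)) V slice) => //.
  exact: smooth_partial.
Qed.

End Variation.

Lemma open_usubmx n m (Om : set 'cV[R]_n) : open Om -> open [set y : 'cV[R]_(n + m) | Om (usubmx y)].
Proof.
move=> oO; rewrite openE => y Oy; have [d d0 Hd] := open_ball_sub oO Oy.
apply/nbhs_ballP; exists d => // x; rewrite -ball_normE /= => xy.
have -> : usubmx x = usubmx y + usubmx (x - y) by rewrite linearB addrC subrK.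
apply: Hd; apply: norm_lt_coord => // k; rewrite mxE.
by apply: le_lt_trans (norm_coord_le _ _) _; rewrite distrC.
Qed.

(** A solution together with one of its partial derivatives is again a family of
    solutions, on a slightly smaller ball. This is the induction step for
    smoothness. *)
Lemma variation_sol n F Om a b (u : 'cV[R]_N -> 'cV[R]_n) c r r' :
  c k0 0 = 0 -> sol F Om a b u c r -> 0 < r' -> r' < r ->
  exists v : 'I_N -> 'cV[R]_N -> 'cV[R]_n, exists a' b',
   (forall z i, `|z - c| < r' -> differentiable (fun z => u z i 0) z /\
      forall j, partial j (fun z => u z i 0) z = v j z i 0) /\
   forall j, sol (variation F) [set y | Om (usubmx y)] a' b' (fun z => col_mx (u z) (v j z)) c r'.
Proof.
move=> c0 S r'0 r'r; have [v [B [B0 vD vB vT vI]]] := sol_differentiable c0 S r'0 r'r.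
exists v, (fun k => col_mx (\col_i a i) (const_mx (- B)) k (0 : 'I_1)).
exists (fun k => col_mx (\col_i b i) (const_mx B) k (0 : 'I_1)).
split=> // j.
have sub z : `|z - c| < r' -> `|z - c| < r by move=> zr; exact: lt_trans zr r'r.
have oO := open_usubmx (m := n) (sol_open S).
have oR : open [set z | `|z - c| < r'] by exact: open_ball_norm.
have smF (f : 'cV[R]_n -> R) : smooth_on Om f ->
    smooth_on [set y : 'cV[R]_(n + n) | Om (usubmx y)] (fun y => f (usubmx y)).
  move=> sf; apply: (smooth_comp oO sf) => // k.
  apply: smooth_eq (smooth_coord oO (lshift n k)) => // y _; first by rewrite mxE.
split=> //.
- move=> i; case: (split_ordP i) => k ->; rewrite /variation.
    apply: smooth_eq (smF _ (sol_smooth S k)) => // y _.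
    by rewrite col_mxEu.
  apply: (@smooth_eq _ _ _ (fun y => \sum_l partial l (fun y => F y k 0) (usubmx y) * y (rshift n l) 0)) => //.
    by move=> y _; rewrite col_mxEd mxE; apply: eq_bigr => l _; rewrite !mxE.
  apply: smooth_sum => // l; apply: smoothM => //; last exact: smooth_coord.
  by apply: smF; apply: smooth_partial; exact: sol_smooth S k.
- move=> y Hy; apply: (sol_box S) => k; have := Hy (lshift n k).
  by rewrite !col_mxEu !mxE.
- move=> z zr i; case: (split_ordP i) => k ->; rewrite ?col_mxEu ?col_mxEd ?mxE.
    by apply: (sol_in S); exact: sub.
  by rewrite -ler_norml; apply: le_trans (norm_coord_le _ _) _; exact: vB.
- move=> z i zr; case: (split_ordP i) => k ->; rewrite /variation ?col_mxEu ?col_mxEd col_mxKu ?col_mxKd.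
    rewrite (_ : (fun _ => _) = fun z => u z k 0); first by apply: (sol_ode S); exact: sub.
    by apply/funext => y; rewrite col_mxEu.
  rewrite (_ : (fun _ => _) = fun z => v j z k 0); first exact: vT.
  by apply/funext => y; rewrite col_mxEd.
- move=> i; case: (split_ordP i) => k ->.
    rewrite (_ : (fun _ => _) = fun z => u (slice z) k 0).
      by apply: smooth_onS (sol_init S k) => z; exact: sub.
    by apply/funext => y; rewrite col_mxEu.
  rewrite (_ : (fun _ => _) = fun z => v j (slice z) k 0) //.
  by apply/funext => y; rewrite col_mxEd.
Qed.

Lemma iter_partial_eq n (V : set 'cV[R]_n) (f g : 'cV[R]_n -> R) (s : seq 'I_n) : open V ->
  (forall x, V x -> f x = g x) -> forall x, V x -> iter_partial s f x = iter_partial s g x.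
Proof.
move=> oV fg; elim: s => [//|k s IH] x Vx /=.
exact: partial_eq oV Vx IH.
Qed.

(** Each further derivative costs one passage to the first variation, hence the
    dimension and the radius are generalized in the induction on the
    multi-index. *)
Theorem sol_smooth_on n F Om a b (u : 'cV[R]_N -> 'cV[R]_n) c r i :
  c k0 0 = 0 -> sol F Om a b u c r -> smooth_on [set z | `|z - c| < r] (fun z => u z i 0).
Proof.
move=> c0 S s; elim/last_ind: s => [|s j IH] in n F Om a b u r i S * => z /= zr.
  have [r' /andP[zr' r'r]] : exists r', `|z - c| < r' < r.
    by exists ((`|z - c| + r) / 2); have := midf_lt zr => -[-> ->].
  have r'0 : 0 < r' by exact: le_lt_trans zr'.
  have [v [_ [_ [H _]]]] := variation_sol c0 S r'0 r'r.
  exact: (H z i zr').1.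
have [r' /andP[zr' r'r]] : exists r', `|z - c| < r' < r.
  by exists ((`|z - c| + r) / 2); have := midf_lt zr => -[-> ->].
have r'0 : 0 < r' by exact: le_lt_trans zr'.
have [v [a' [b' [H Sv]]]] := variation_sol c0 S r'0 r'r.
have oR : open [set z | `|z - c| < r'] by exact: open_ball_norm.
rewrite iter_partial_rcons.
apply: (differentiable_eq (f := iter_partial s (fun z => col_mx (u z) (v j z) (rshift n i) 0)) oR zr').
  move=> y yr; apply: (iter_partial_eq s oR _ yr) => {}y {}yr.
  by rewrite col_mxEd (H y i yr).2.
exact: (IH _ _ _ _ _ _ _ (rshift n i) (Sv j)).
Qed.

End Flow.

(** * The inverse function theorem *)

Section InverseFunction.
Variable R : realType.

Lemma mx_entry_le m n (A : 'M[R]_(m, n)) i j : `|A i j| <= `|A|.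
Proof.
rewrite [leRHS]mx_normrE.
exact: (le_bigmax _ (fun ij : 'I_m * 'I_n => `|A ij.1 ij.2|) (i, j)).
Qed.

Lemma mulmx_normM m n (A : 'M[R]_(m, n)) (v : 'cV[R]_n) : `|A *m v| <= n%:R * `|A| * `|v|.
Proof. by apply: mulmx_norm_le => // i j; exact: mx_entry_le. Qed.

Lemma col_continuous n m (f : 'cV[R]_n -> 'cV[R]_m) x :
  (forall k, differentiable (fun y => f y k 0) x) -> {for x, continuous f}.
Proof. by move=> df; apply: differentiable_continuous; exact: differentiable_col. Qed.

Lemma ball_segment n (c x y : 'cV[R]_n) (r s : R) : `|x - c| <= r -> `|y - c| <= r ->
  0 <= s <= 1 -> `|y + s *: (x - y) - c| <= r.
Proof.
move=> xr yr /andP[s0 s1].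
have -> : y + s *: (x - y) - c = (1 - s) *: (y - c) + s *: (x - c).
  by apply/matrixP => i j; rewrite !mxE; ring.
apply: le_trans (ler_normD _ _) _.
have s1' : 0 <= 1 - s by rewrite subr_ge0.
rewrite !normrZ (ger0_norm s0) (ger0_norm s1').
have a1 : (1 - s) * `|y - c| <= (1 - s) * r by rewrite ler_wpM2l.
have a2 : s * `|x - c| <= s * r by rewrite ler_wpM2l.
lra.
Qed.

(** The inverse of 1 plus the sum of the inverses is smaller than each of
    finitely many positive numbers. *)
Lemma finite_epsilon (I : finType) (T : Type) (N : T -> R) (Q : I -> T -> Prop) :
  (forall i, exists2 d : R, 0 < d & forall h, N h < d -> Q i h) ->
  exists2 d : R, 0 < d & forall h, N h < d -> forall i, Q i h.
Proof.
move=> H; have /choice[d Hd] : forall i, exists d : R, 0 < d /\ forall h, N h < d -> Q i h.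
  by move=> i; have [d d0 Qd] := H i; exists d.
have S0 : 0 <= \sum_i (d i)^-1.
  by apply: sumr_ge0 => i _; rewrite invr_ge0 ltW //; exact: (Hd i).1.
exists (1 + \sum_i (d i)^-1)^-1; first by rewrite invr_gt0 ltr_wpDr.
move=> h Nh i; apply: (Hd i).2; apply: lt_le_trans Nh _.
have d0 := (Hd i).1; rewrite -[leRHS]invrK lef_pV2 ?posrE ?invr_gt0 ?ltr_wpDr //.
rewrite (bigD1 i) //= addrCA lerDl addr_ge0 //.
by apply: sumr_ge0 => j _; rewrite invr_ge0 ltW //; exact: (Hd j).1.
Qed.

Lemma open_preimage n m (V : set 'cV[R]_n) (U : set 'cV[R]_m) (f : 'cV[R]_n -> 'cV[R]_m) :
  open V -> open U -> (forall x, V x -> {for x, continuous f}) ->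
  open [set x | V x /\ U (f x)].
Proof.
move=> oV oU cf; rewrite openE => x [Vx Ux].
have n1 := open_nbhs_nbhs (conj oV Vx).
have n2 := cf x Vx _ (open_nbhs_nbhs (conj oU Ux)).
exact: filterI n1 n2.
Qed.

(** On a compact ball the displacement |P x - x| attains its minimum, and a
    contraction of ratio one half would decrease a positive minimum. *)
Lemma contraction_fixed n (P : 'cV[R]_n -> 'cV[R]_n) x0 (r : R) : 0 <= r ->
  (forall x, `|x - x0| <= r -> {for x, continuous P}) ->
  (forall x, `|x - x0| <= r -> `|P x - x0| <= r) ->
  (forall x y, `|x - x0| <= r -> `|y - x0| <= r -> `|P x - P y| <= 2^-1 * `|x - y|) ->
  exists2 x, `|x - x0| <= r & P x = x.
Proof.
move=> r0 cP sP lP; pose K := [set x : 'cV[R]_n | `|x - x0| <= r].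
have cK : compact K by rewrite /K ball_box //; exact: compact_box.
have K0 : K !=set0 by exists x0; rewrite /K /= subrr normr0.
have [|x /set_mem xK Hx] := @compact_EVT_min _ R (fun x => `|P x - x|) K K0 cK.
  apply: continuous_in_subspaceT => x /set_mem xK.
  apply: (@continuous_comp _ _ _ (fun x => P x - x) (fun y => `|y|)); last exact: norm_continuous.
  by apply: continuousB; [exact: cP|exact: cvg_id].
exists x => //; apply/eqP; rewrite -subr_eq0 -normr_le0 leNgt; apply/negP => p.
have := Hx (P x) (mem_set (sP _ xK)); rewrite leNgt => /negP; apply.
apply: le_lt_trans (lP _ _ (sP _ xK) xK) _.
by rewrite ltr_pdivrMl // ltr_pMl // ltr1n.
Qed.

(** With A the inverse of the derivative at x0, the map x - A H(x) is a
    contraction near x0 and its fixed points, after translation by A y, solve H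
    x = y. The inverse G is smooth because the functions h o G, with h smooth,
    are stable under partial derivatives. *)
Theorem local_inverse n (V : set 'cV[R]_n) (H : 'cV[R]_n -> 'cV[R]_n) x0 :
  open V -> V x0 -> (forall k, smooth_on V (fun x => H x k 0)) ->
  (forall x, V x -> jac H x \in unitmx) ->
  exists (W U : set 'cV[R]_n) (G : 'cV[R]_n -> 'cV[R]_n),
  [/\ [/\ open W, W x0, W `<=` V & open U],
     (forall x, W x -> U (H x) /\ G (H x) = x),
     (forall y, U y -> W (G y) /\ H (G y) = y) &
     forall k, smooth_on U (fun y => G y k 0)].
Proof.
move=> oV Vx0 sH uH; pose A := invmx (jac H x0).
pose P x := x - A *m H x.
have AHE x k : (A *m H x) k 0 = \sum_j A k j * H x j 0 by rewrite mxE.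
have sP k : smooth_on V (fun x => P x k 0).
  apply: (@smooth_eq _ _ _ (fun x => x k 0 - \sum_j A k j * H x j 0)) => //.
    by move=> x _; rewrite !mxE.
  apply: smoothB => //; first exact: smooth_coord.
  by apply: smooth_sum => // j; apply: smoothM => //; exact: smooth_cst.
have jP : jac P x0 = 0.
  have -> : jac P x0 = 1%:M - A *m jac H x0; last by rewrite mulVmx ?uH // subrr.
  apply/matrixP => k a; rewrite !mxE.
  rewrite (partial_eq a (g := fun x => x k 0 - \sum_j A k j * H x j 0) oV Vx0); last first.
    by move=> x _; rewrite !mxE.
  have dj j : differentiable (fun x => A k j * H x j 0) x0.
    by apply: smooth_diff (smoothM oV (smooth_cst oV _) (sH j)) Vx0.
  rewrite partialB; first last.
  - exact: smooth_diff (smooth_sum oV (fun j => smoothM oV (smooth_cst oV _) (sH j))) Vx0.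
  - exact: differentiable_coord.
  rewrite partial_coord partial_sum //; congr (_ - _); apply: eq_bigr => j _.
  rewrite partialM; [|exact: differentiable_cst|exact: smooth_diff (sH j) Vx0].
  by rewrite partial_cst mul0r add0r !mxE.
have n0 : 0 < (2 * n.+1%:R)^-1 :> R by rewrite invr_gt0 mulr_gt0.
have [r r0 Hr] : exists2 r : R, 0 < r & forall h, `|h| <= r -> V (x0 + h) /\
    forall j k, `|partial j (fun x => P x k 0) (x0 + h)| <= (2 * n.+1%:R)^-1.
  have [d d0 Hd] := open_ball_sub oV Vx0.
  have [e e0 He] : exists2 d : R, 0 < d & forall h : 'cV[R]_n, `|h| < d ->
      forall jk : 'I_n * 'I_n, `|partial jk.1 (fun x => P x jk.2 0) (x0 + h)| < (2 * n.+1%:R)^-1.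
    apply: finite_epsilon => jk.
    have [d' d'0 Hd'] := continuous_epsilon (smooth_continuous (smooth_partial jk.1 (sP jk.2)) Vx0) n0.
    exists d' => // h /Hd'; have := congr1 (fun M : 'M[R]_n => M jk.2 jk.1) jP; rewrite !mxE => ->.
    by rewrite subr0.
  have m0 : 0 < Num.min d e by rewrite lt_min d0.
  exists (Num.min d e / 2) => [|h hr]; first by rewrite divr_gt0.
  have : `|h| < Num.min d e.
    by rewrite (le_lt_trans hr) // ltr_pdivrMr // ltr_pMr // ltr1n.
  rewrite lt_min => /andP[/Hd Vh /He Ph].
  by split=> // j k; exact: ltW (Ph (j, k)).
have BV x : `|x - x0| <= r -> V x by move=> /Hr[]; rewrite addrC subrK.
have lP x y : `|x - x0| <= r -> `|y - x0| <= r -> `|P x - P y| <= 2^-1 * `|x - y|.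
  move=> xr yr; apply: norm_le_coord => [|k]; first by rewrite mulr_ge0 // invr_ge0.
  have inS (s : R) : 0 <= s <= 1 -> `|y + s *: (x - y) - x0| <= r.
    exact: ball_segment.
  rewrite mxE [(- P y) k 0]mxE (_ : P x k 0 = P (y + (x - y)) k 0); last by rewrite addrC subrK.
  apply: le_trans (@segment_bound R n (fun x => P x k 0) y (x - y) (2 * n.+1%:R)^-1 _ _) _.
  - by move=> s s01; apply: smooth_diff (sP k) (BV _ (inS s s01)).
  - move=> s j s01; have [_ /(_ j k)] := Hr _ (inS s s01).
    by rewrite [x0 + _]addrC subrK.
  rewrite ler_wpM2r // invfM mulrCA ler_piMr // ?invr_ge0 //.
  by rewrite ler_pdivrMr // mul1r ler_nat.
have lA x y : `|x - x0| <= r -> `|y - x0| <= r -> `|x - y| <= 2 * `|A *m (H x - H y)|.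
  move=> xr yr; have := lP x y xr yr.
  have -> : x - y = (P x - P y) + A *m (H x - H y).
    rewrite /P mulmxBr; move: (A *m H x) (A *m H y) => p q.
    by apply/matrixP => i j; rewrite !mxE; ring.
  move=> lxy; have := ler_normD (P x - P y) (A *m (H x - H y)); lra.
pose U := [set y : 'cV[R]_n | `|A *m (y - H x0)| < r / 4].
pose W := [set x : 'cV[R]_n | `|x - x0| < r / 2 /\ U (H x)].
have oU : open U.
  have -> : U = [set y : 'cV[R]_n | setT y /\ [set z : 'cV[R]_n | `|z - 0| < r / 4] (A *m (y - H x0))].
    by apply/seteqP; split=> y /=; rewrite subr0 => // -[].
  apply: open_preimage; [exact: openT|exact: open_ball_norm|move=> y _].
  apply: col_continuous => k.
  apply: (@smooth_diff R n setT) => //.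
  apply: (@smooth_eq _ _ _ (fun y => \sum_j A k j * (y j 0 - H x0 j 0))); first exact: openT.
    by move=> z _; rewrite mxE; apply: eq_bigr => j _; rewrite !mxE.
  apply: smooth_sum => [|j]; first exact: openT.
  apply: smoothM; [exact: openT|exact: smooth_cst openT _|].
  apply: smoothB; [exact: openT|exact: smooth_coord openT _|exact: smooth_cst openT _].
have r2 : r / 2 < r by rewrite ltr_pdivrMr // ltr_pMr // ltr1n.
have WB x : W x -> `|x - x0| <= r by move=> [xr _]; apply: ltW; exact: lt_trans xr r2.
have cH x : V x -> {for x, continuous H}.
  by move=> Vx; apply: col_continuous => k; exact: smooth_diff (sH k) Vx.
have oW : open W.
  have cH' x : [set x | `|x - x0| < r / 2] x -> {for x, continuous H}.
    by move=> xr; apply/cH/BV/ltW; exact: lt_trans xr r2.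
  exact: (open_preimage (@open_ball_norm R n x0 (r / 2)) oU cH').
have ex y : U y -> exists x, W x /\ H x = y.
  move=> Uy.
  have [||||x xr Px] := @contraction_fixed n (fun x => P x + A *m y) x0 (r / 2).
  - by rewrite divr_ge0 // ltW.
  - move=> x xr; apply: continuousD; last exact: cst_continuous.
    apply: col_continuous => k; apply: smooth_diff (sP k) (BV _ _).
    by apply: le_trans xr _; exact: ltW.
  - move=> x xr; have xr' : `|x - x0| <= r by apply: le_trans xr _; exact: ltW.
    have -> : P x + A *m y - x0 = (P x - P x0) + A *m (y - H x0).
      rewrite /P mulmxBr; move: (A *m y) (A *m H x) (A *m H x0) => p q s.
      by apply/matrixP => i j; rewrite !mxE; ring.
    apply: le_trans (ler_normD _ _) _.
    have := lP x x0 xr'; rewrite subrr normr0 => /(_ (ltW r0)).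
    by move: Uy xr; rewrite /U /=; lra.
  - move=> x z xr zr; rewrite opprD addrACA subrr addr0; apply: lP.
      by apply: le_trans xr _; exact: ltW.
    by apply: le_trans zr _; exact: ltW.
  have E : H x = y.
    have : A *m (y - H x) = 0.
      by apply/eqP; rewrite mulmxBr subr_eq0 -(inj_eq (addrI (P x))) Px /P subrK.
    move=> /(congr1 (mulmx (jac H x0))); rewrite mulmxA mulmxV ?uH // mul1mx mulmx0.
    by move/eqP; rewrite subr_eq0 => /eqP.
  exists x; split=> //; split; last by rewrite E.
  have := lA x x0 (le_trans xr (ltW r2)); rewrite subrr normr0 => /(_ (ltW r0)).
  by rewrite E; move: Uy; rewrite /U /=; lra.
have /choice[G HG] : forall y, exists x, U y -> W x /\ H x = y.
  by move=> y; have [/ex [x Hx]|] := pselect (U y); [exists x|exists 0].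
exists W, U, G; split=> //.
- split=> //; first split.
  + by rewrite subrr normr0 divr_gt0.
  + by rewrite /U /= subrr mulmx0 normr0 divr_gt0.
  + by move=> x /WB /BV.
- move=> x Wx; have UH : U (H x) by case: Wx.
  split=> //; have [WG HGE] := HG _ UH.
  apply/eqP; rewrite -subr_eq0 -normr_le0.
  by apply: le_trans (lA _ _ (WB _ WG) (WB _ Wx)) _; rewrite HGE subrr mulmx0 normr0 mulr0.
have KV : box (fun k => x0 k 0 - r) (fun k => x0 k 0 + r) `<=` V.
  by rewrite -ball_box ?ltW // => x /BV.
have [C C0 HC] := box_taylor KV sH.
have inK x : W x -> box (fun k => x0 k 0 - r) (fun k => x0 k 0 + r) x.
  by move=> /WB; rewrite -ball_box // ltW.
have dG y k : U y -> differentiable (fun y => G y k 0) y /\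
    forall b, partial b (fun y => G y k 0) y = invmx (jac H (G y)) k b.
  move=> Uy; have [Wx HE] := HG y Uy; set x := G y in Wx HE *.
  have [d d0 Hd] := open_ball_sub oU Uy.
  set J := jac H x; have uJ : J \in unitmx by apply: uH; exact: BV (WB _ Wx).
  apply: (@diff_quad R n (fun y => G y k 0) y _ (n%:R * `|invmx J| * (C * (2 * (n%:R * `|A|)) ^+ 2)) d) => // h hd.
  have [Wx' HE'] := HG (y + h) (Hd h hd); set x' := G (y + h) in Wx' HE' *.
  have lx : `|x' - x| <= 2 * (n%:R * `|A|) * `|h|.
    apply: le_trans (lA _ _ (WB _ Wx') (WB _ Wx)) _.
    rewrite HE HE' [y + h]addrC addrK -mulrA ler_wpM2l //.
    exact: mulmx_normM.
  have T := HC x x' (inK _ Wx) (inK _ Wx').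
  have E : x' - x - invmx J *m h = - (invmx J *m (H x' - H x - J *m (x' - x))).
    by rewrite HE HE' [y + h]addrC addrK mulmxBr mulmxA mulVmx // mul1mx opprB.
  have -> : G (y + h) k 0 - G y k 0 - \sum_b h b 0 * invmx J k b = (x' - x - invmx J *m h) k 0.
    rewrite !mxE; congr (_ - _); apply: eq_bigr => b _; exact: mulrC.
  apply: le_trans (norm_coord_le _ _) _; rewrite E normrN.
  apply: le_trans (mulmx_normM _ _) _; rewrite -[leRHS]mulrA ler_wpM2l ?mulr_ge0 //.
  by apply: le_trans T _; rewrite -mulrA ler_wpM2l // -exprMn ler_pXn2r ?nnegrE // !mulr_ge0.
move=> k; apply: (@smooth_on_class R n U (fun f => exists2 h, smooth_on W h & f = h \o G)) => //.
- move=> f [h sh ->] y Uy; apply: (@differentiable_comp _ _ _ _ G h).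
    by apply: differentiable_col => j; exact: (dG y j Uy).1.
  exact: smooth_diff sh (HG y Uy).1.
- move=> f b [h sh ->].
  exists ((fun x => \sum_j invmx (jac H x) j b * partial j h x) \o G).
    exists (fun x => \sum_j invmx (jac H x) j b * partial j h x) => //.
    apply: smooth_sum => // j; apply: smoothM => //; last exact: smooth_partial.
    apply: smooth_invmx => //.
      move=> i l; apply: (@smooth_eq _ _ _ (partial l (fun x => H x i 0))) => //.
        by move=> x _; rewrite mxE.
      by apply: smooth_partial; apply: smooth_onS (sH i) => x /WB /BV.
    by move=> x Wx; apply: uH; exact: BV (WB _ Wx).
  move=> y Uy; rewrite (partial_comp b (fun j => (dG y j Uy).1) (smooth_diff sh (HG y Uy).1)).2 /=.
  by apply: eq_bigr => j _; rewrite (dG y j Uy).2.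
- by exists (fun x => x k 0) => //; exact: smooth_coord.
Qed.

End InverseFunction.

(** * Primitives of closed one-forms *)

Section Poincare.
Variable R : realType.

Definition dot n (u v : 'cV[R]_n) := \sum_a u a 0 * v a 0.

Lemma dot_bound n (u v : 'cV[R]_n) : `|dot u v| <= n%:R * `|v| * `|u|.
Proof. by apply: sum_coord_bound => k; exact: norm_coord_le. Qed.

(** The primitive at x is the integral of t along the ray from the centre c to
    x. Its increments are compared with t directly: the mean value theorem is
    applied to w, where the symmetry of the derivatives of t cancels the
    first-order terms. *)
Lemma poincare n (t : 'I_n -> 'cV[R]_n -> R) (c : 'cV[R]_n) (r : R) :
  (forall k, smooth_on [set x | `|x - c| < r] (t k)) ->
  (forall x a b, `|x - c| < r -> partial a (t b) x = partial b (t a) x) ->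
  exists f : 'cV[R]_n -> R, smooth_on [set x | `|x - c| < r] f /\
    forall k x, `|x - c| < r -> partial k f x = t k x.
Proof.
move=> st cl; set V := [set x | `|x - c| < r].
have oV : open V by exact: open_ball_norm.
pose T x : 'cV[R]_n := \col_a t a x.
have sT k : smooth_on V (fun x => T x k 0).
  by apply: smooth_eq (st k) => // x _; rewrite mxE.
pose gam x (s : R) : 'cV[R]_n := c + s *: (x - c).
have gamV x s : V x -> `|s| <= 1 -> V (gam x s).
  move=> Vx s1; rewrite /V /gam /= [c + _]addrC addrK normrZ.
  by apply: le_lt_trans Vx; rewrite ler_piMl.
pose rho x s := dot (x - c) (T (gam x s)).
have drho x (s : R) k : V x -> `|s| <= 1 -> is_derive s 1 (fun s => t k (gam x s)) (\sum_a (x - c) a 0 * partial a (t k) (gam x s)).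
  move=> Vx s1; apply: is_derive_line; apply: DeriveDef.
    by apply: diff_derivable; exact: smooth_diff (st k) (gamV x s Vx s1).
  by rewrite derive_partial //; exact: smooth_diff (st k) (gamV x s Vx s1).
have clamp1 s : `|clamp (-1) 1 s| <= (1 : R).
  by rewrite ler_norml; apply: clamp_itv; lra.
have /choice[q Hq] : forall x, exists q : R -> R, V x ->
    q 0 = 0 /\ forall s : R, `|s| <= 1 -> is_derive s 1 q (rho x s).
  move=> x; have [Vx|] := pselect (V x); last by exists (fun=> 0).
  have [|q [q0 dq]] := @antiderivative R (fun s => rho x (clamp (-1) 1 s)).
    move=> s; rewrite /rho /dot (_ : (fun _ => _) = \sum_a (fun s => (x - c) a 0 * t a (gam x (clamp (-1) 1 s)))); last first.
      by apply/funext => z; rewrite fct_sumE; apply: eq_bigr => a _; rewrite !mxE.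
    elim/big_rec: _ => [|a f _ cf]; first exact: cst_continuous.
    apply: (continuousD _ cf); apply: continuousM; first exact: cst_continuous.
    apply: (@continuous_comp _ _ _ (clamp (-1) 1) (fun s => t a (gam x s))); first exact: clamp_continuous.
    exact: is_derive_continuous (drho x _ a Vx (clamp1 s)).
  exists q => _; split=> // s s1; have := dq s.
  by rewrite clamp_id // -ler_norml.
pose f x := q x 1.
have df x : V x -> differentiable f x /\ forall k, partial k f x = t k x.
  move=> Vx.
  have [r' /andP[xr' r'r]] : exists r', `|x - c| < r' < r.
    by exists ((`|x - c| + r) / 2); have := midf_lt Vx => -[-> ->].
  have r'0 : 0 < r' by exact: le_lt_trans xr'.
  have KV : box (fun k => c k 0 - r') (fun k => c k 0 + r') `<=` V.
    by rewrite -ball_box ?ltW // => z /= zr; exact: le_lt_trans zr r'r.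
  have [L L0 HL] := box_lipschitz KV sT.
  have [C C0 HC] := box_taylor KV sT.
  have n0 : 0 <= n%:R :> R by [].
  apply: (@diff_quad R n f x _ (n%:R * C * r' + n%:R * L) (r' - `|x - c|)); first by rewrite subr_gt0.
  move=> h hr.
  have Kh z (s : R) : `|z - c| <= r' -> 0 <= s <= 1 -> box (fun k => c k 0 - r') (fun k => c k 0 + r') (gam z s).
    move=> zr s01; rewrite -ball_box ?ltW //= /gam.
    by apply: ball_segment => //; rewrite subrr normr0 ltW.
  have xhr : `|x + h - c| <= r'.
    by rewrite addrAC (le_trans (ler_normD _ _)) //; move: hr; rewrite ltrBrDl => /ltW.
  have Vxh : V (x + h) by exact: le_lt_trans xhr r'r.
  have xr : `|x - c| <= r' by exact: ltW.
  (* The increment of the primitive minus its linear part, as a function of the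
     upper bound s of integration. *)
  pose w (s : R) := q (x + h) s - q x s - s * \sum_k h k 0 * t k (gam x s).
  pose dw (s : R) := rho (x + h) s - rho x s - (1 * (\sum_k h k 0 * t k (gam x s)) + s * \sum_k h k 0 * \sum_a (x - c) a 0 * partial a (t k) (gam x s)).
  have abs1 (s : R) : 0 <= s <= 1 -> `|s| <= 1 by move=> /andP[s0 s1]; rewrite ger0_norm.
  have dwP (s : R) : Num.min 0 1 <= s <= Num.max 0 1 -> is_derive s 1 w (dw s).
    rewrite min_l ?max_r // => /abs1 s1.
    apply: is_derive_sub; first by apply: is_derive_sub; [exact: (Hq _ Vxh).2|exact: (Hq _ Vx).2].
    apply: is_derive_mul; apply: is_derive_sum_fun => k.
    apply: is_derive_eq (is_derive_mul (is_derive_cst (h k 0) s (1:R)) (drho x s k Vx s1)) _.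
    by rewrite mul0r add0r.
  have [s] := line_MVT dwP; rewrite min_l ?max_r // => s01 Ew.
  have gamh : gam (x + h) s = gam x s + s *: h by rewrite /gam addrAC scalerDr addrA.
  have gE : T (gam x s + s *: h) - T (gam x s) = T (gam (x + h) s) - T (gam x s) by rewrite gamh.
  have -> : f (x + h) - f x - \sum_k h k 0 * t k x = dw s.
    move: Ew; rewrite /w /f (Hq _ Vx).1 (Hq _ Vxh).1 mul0r !subr0 mulr1 mul1r => <-.
    by rewrite /gam scale1r addrC [c + _]addrC subrK addrC.
  have cls a b : partial a (t b) (gam x s) = partial b (t a) (gam x s).
    by apply: cl; apply: gamV => //; exact: abs1.
  have -> : dw s = dot (x - c) (T (gam (x + h) s) - T (gam x s) - jac T (gam x s) *m (gam (x + h) s - gam x s))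
       + dot h (T (gam (x + h) s) - T (gam x s)).
    have E1 : dot (x - c) (jac T (gam x s) *m (gam (x + h) s - gam x s))
        = s * \sum_k h k 0 * \sum_a (x - c) a 0 * partial a (t k) (gam x s).
      rewrite gamh [gam x s + _]addrC addrK /dot mulr_sumr.
      under eq_bigr => a _ do rewrite [(_ *m _) a 0]mxE mulr_sumr.
      rewrite exchange_big /=; apply: eq_bigr => k _; rewrite !mulr_sumr.
      apply: eq_bigr => a _; rewrite !mxE.
      rewrite (partial_eq k (g := t a) oV (gamV x s Vx (abs1 s s01))); last by move=> y _; rewrite mxE.
      by rewrite (cls a k); ring.
    have E2 u v1 v2 : dot u (v1 - v2) = dot u v1 - dot u v2 :> R.
      by rewrite /dot -sumrB; apply: eq_bigr => a _; rewrite !mxE mulrBr.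
    have E3 u1 u2 v : dot (u1 + u2) v = dot u1 v + dot u2 v :> R.
      by rewrite /dot -big_split; apply: eq_bigr => a _; rewrite !mxE mulrDl.
    have E4 : \sum_k h k 0 * t k (gam x s) = dot h (T (gam x s)).
      by apply: eq_bigr => k _; rewrite mxE.
    rewrite /dw /rho !E2 E1 -E4 [x + h - c]addrAC E3.
    ring.
  have g1 := Kh x s xr s01; have g2 := Kh (x + h) s xhr s01.
  have gn : `|gam (x + h) s - gam x s| <= `|h|.
    by rewrite gamh [gam x s + _]addrC addrK normrZ ler_piMl //; exact: abs1.
  apply: le_trans (ler_normD _ _) _; rewrite mulrDl lerD //.
    apply: le_trans (dot_bound _ _) _.
    have T1 : `|T (gam (x + h) s) - T (gam x s) - jac T (gam x s) *m (gam (x + h) s - gam x s)| <= C * `|h| ^+ 2.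
      by apply: le_trans (HC _ _ g1 g2) _; rewrite ler_wpM2l // ler_pXn2r ?nnegrE.
    rewrite -[leLHS]mulrA -!mulrA ler_wpM2l // [r' * _]mulrC mulrA.
    by apply: ler_pM.
  apply: le_trans (dot_bound _ _) _; rewrite expr2 !mulrA ler_wpM2r // -mulrA ler_wpM2l //.
  apply: le_trans (HL _ _ g1 g2) _; rewrite ler_wpM2l //.
exists f; split; last by move=> k x Vx; exact: (df x Vx).2.
apply: (@smooth_intro R n V f t) => // [x Vx|k x Vx].
  exact: (df x Vx).1.
exact: (df x Vx).2.
Qed.

End Poincare.

(** * Parallel one-forms and local flows *)

Section LinearAlgebra.
Variable R : realType.

Lemma unitmx_inj n (A : 'M[R]_n) : (forall v : 'cV[R]_n, A *m v = 0 -> v = 0) -> A \in unitmx.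
Proof.
move=> inj; rewrite -unitmx_tr -row_free_unit -kermx_eq0.
apply/eqP; apply/row_matrixP => i; rewrite row0.
have : row i (kermx A^T) *m A^T = 0 by rewrite -row_mul mulmx_ker row0.
move=> /(congr1 trmx); rewrite trmx_mul trmxK trmx0 => /inj /(congr1 trmx).
by rewrite trmxK trmx0.
Qed.

Definition posdef n (A : 'M[R]_n) := forall v : 'cV[R]_n, v != 0 -> 0 < (v^T *m A *m v) 0 0.

Lemma posdef_unit n (A : 'M[R]_n) : posdef A -> A \in unitmx.
Proof.
move=> pA; apply: unitmx_inj => v Av; apply/eqP; apply: contraT => /pA.
by rewrite -mulmxA Av mulmx0 mxE ltxx.
Qed.

End LinearAlgebra.

Section ParallelForm.
Variables (R : realType) (n : nat) (Om : set 'cV[R]_n).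
Variables (g : 'cV[R]_n -> 'M[R]_n) (t : 'cV[R]_n -> 'I_n -> R).
Hypothesis oO : open Om.
Hypothesis sg : forall a b, smooth_on Om (fun x => g x a b).
Hypothesis gT : forall x, Om x -> (g x)^T = g x.
Hypothesis gP : forall x, Om x -> posdef (g x).
Hypothesis st : forall a, smooth_on Om (fun x => t x a).
Hypothesis lct : forall x, Om x -> forall k a, nabla_form1 (levi_civita g) t x k a = 0.

Definition sharp x : 'cV[R]_n := invmx (g x) *m \col_a t x a.

Lemma sharp_smooth k : smooth_on Om (fun x => sharp x k 0).
Proof.
apply: smooth_mulmx => // [i j|i j].
  by apply: smooth_invmx => // x Ox; apply: posdef_unit; exact: gP.
by apply: smooth_eq (st i) => // x _; rewrite mxE.
Qed.

Lemma metric_symE x a b : Om x -> g x a b = g x b a.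
Proof. by move=> Ox; rewrite -[in LHS](gT Ox) mxE. Qed.

Lemma partial_metric_sym x k a b : Om x ->
  partial k (fun y => g y a b) x = partial k (fun y => g y b a) x.
Proof. by move=> Ox; apply: partial_eq oO Ox _ => y Oy; exact: metric_symE. Qed.

Lemma flat_sharp x a : Om x -> t x a = \sum_m g x a m * sharp x m 0.
Proof.
move=> Ox; have ug := posdef_unit (gP Ox).
have : g x *m sharp x = \col_a t x a by rewrite /sharp mulmxA mulmxV // mul1mx.
by move=> /(congr1 (fun M : 'cV[R]_n => M a 0)); rewrite !mxE => <-.
Qed.

Lemma partial_parallel x k a : Om x -> partial k (fun y => t y a) x =
  2^-1 * \sum_l sharp x l 0 * (partial k (fun y => g y a l) x + partial a (fun y => g y k l) x
     - partial l (fun y => g y k a) x).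
Proof.
move=> Ox; have := lct Ox k a; rewrite /nabla_form1 => /eqP; rewrite subr_eq0 => /eqP ->.
rewrite /levi_civita.
under eq_bigr => m _ do rewrite -mulrA mulr_suml.
rewrite -mulr_sumr exchange_big /=; congr (_ * _); apply: eq_bigr => l _.
rewrite /sharp mxE mulr_suml; apply: eq_bigr => m _; rewrite mxE.
have -> : invmx (g x) m l = invmx (g x) l m.
  by rewrite -[in LHS](gT Ox) -trmx_inv mxE.
by rewrite mulrAC.
Qed.

(** The Levi-Civita connection is torsion free, so the exterior derivative is
    the skew part of the covariant derivative. *)
Lemma parallel_closed x a b : Om x -> partial a (fun y => t y b) x = partial b (fun y => t y a) x.
Proof.
move=> Ox; rewrite !partial_parallel //; congr (_ * _); apply: eq_bigr => l _.
by rewrite (partial_metric_sym l b a Ox) [partial a _ x + _]addrC.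
Qed.

Lemma partial_flat x a b : Om x -> partial a (fun y => t y b) x =
  \sum_m (partial a (fun y => g y b m) x * sharp x m 0 + g x b m * partial a (fun y => sharp y m 0) x).
Proof.
move=> Ox; rewrite (partial_eq a (g := fun y => \sum_m g y b m * sharp y m 0) oO Ox); last first.
  by move=> y Oy; exact: flat_sharp.
rewrite partial_sum.
  apply: eq_bigr => m _; rewrite partialM //; [exact: smooth_diff (sg b m) Ox|exact: smooth_diff (sharp_smooth m) Ox].
by move=> m; exact: smooth_diff (smoothM oO (sg b m) (sharp_smooth m)) Ox.
Qed.

(** The Killing equation for the dual field: the Lie derivative of the metric is
    twice the symmetric part of the covariant derivative of the dual form. *)
Lemma parallel_killing x a b : Om x ->
  \sum_l sharp x l 0 * partial l (fun y => g y a b) x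
  + \sum_m g x b m * partial a (fun y => sharp y m 0) x
  + \sum_m g x a m * partial b (fun y => sharp y m 0) x = 0.
Proof.
move=> Ox; have E1 := partial_flat a b Ox; have E2 := partial_flat b a Ox.
rewrite partial_parallel // big_split /= in E1; rewrite partial_parallel // big_split /= in E2.
move: E1 E2.
under [in X in X -> _]eq_bigr => l _ do rewrite mulrBr mulrDr.
under [in X in _ -> X -> _]eq_bigr => l _ do rewrite mulrBr mulrDr.
rewrite !sumrB !big_split /=.
have -> : \sum_l sharp x l 0 * partial l (fun y => g y b a) x = \sum_l sharp x l 0 * partial l (fun y => g y a b) x.
  by apply: eq_bigr => l _; rewrite partial_metric_sym.
under [\sum_i partial a _ x * _]eq_bigr => l _ do rewrite mulrC.
under [\sum_i partial b _ x * _]eq_bigr => l _ do rewrite mulrC.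
move: (\sum_i sharp x i 0 * partial a _ x) (\sum_i sharp x i 0 * partial b _ x) (\sum_l sharp x l 0 * partial l _ x) => A B C.
by move: (\sum_m _) (\sum_m _) => D E; lra.
Qed.

Definition norm2 x := \sum_a t x a * sharp x a 0.

(** Differentiating the square of the length by the product rule and by the
    parallel equation gives two multiples of the same sum. *)
Lemma partial_norm2 x k : Om x -> partial k norm2 x = 0.
Proof.
move=> Ox.
have dt a : differentiable (fun x => t x a) x by exact: smooth_diff (st a) Ox.
have ds a : differentiable (fun x => sharp x a 0) x by exact: smooth_diff (sharp_smooth a) Ox.
rewrite /norm2 partial_sum; last first.
  by move=> a; exact: smooth_diff (smoothM oO (st a) (sharp_smooth a)) Ox.
under eq_bigr => a _ do rewrite partialM //.
rewrite big_split /=.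
pose A := \sum_a \sum_m partial k (fun y => g y a m) x * sharp x m 0 * sharp x a 0.
have E1 : \sum_a partial k (fun y => t y a) x * sharp x a 0 = A + \sum_a t x a * partial k (fun y => sharp y a 0) x.
  under eq_bigr => a _ do rewrite partial_flat // mulr_suml.
  under eq_bigr => a _ do (under eq_bigr => m _ do rewrite mulrDl; rewrite big_split /=).
  rewrite big_split /=; congr (_ + _).
  rewrite exchange_big /=; apply: eq_bigr => m _; rewrite flat_sharp // mulr_suml.
  by apply: eq_bigr => a _; rewrite (metric_symE a m Ox); ring.
have E2 : \sum_a partial k (fun y => t y a) x * sharp x a 0 = 2^-1 * A.
  under eq_bigr => a _ do rewrite partial_parallel // -mulrA mulr_suml.
  rewrite -mulr_sumr; congr (_ * _).
  under eq_bigr => a _ do (under eq_bigr => l _ do rewrite mulrBr mulrDr mulrBl mulrDl; rewrite sumrB big_split /=).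
  rewrite sumrB big_split /= -addrA [X in _ + X](_ : _ = 0) ?addr0.
    by apply: eq_bigr => a _; apply: eq_bigr => m _; ring.
  apply/eqP; rewrite subr_eq0; apply/eqP; rewrite exchange_big /=.
  by apply: eq_bigr => a _; apply: eq_bigr => m _; ring.
lra.
Qed.

End ParallelForm.

Section LocalFlow.
Variable R : realType.

Lemma ball_col_mx n m (x x0 : 'cV[R]_n) (y y0 : 'cV[R]_m) (r : R) : 0 < r ->
  `|x - x0| < r -> `|y - y0| < r -> `|col_mx x y - col_mx x0 y0| < r.
Proof.
move=> r0 xr yr; apply: norm_lt_coord => // i; rewrite opp_col_mx add_col_mx.
case: (split_ordP i) => k ->; rewrite ?col_mxEu ?col_mxEd.
  exact: le_lt_trans (norm_coord_le _ k) xr.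
exact: le_lt_trans (norm_coord_le _ k) yr.
Qed.

Lemma ball_usubmx n m (z : 'cV[R]_(n + m)) (x0 : 'cV[R]_n) (y0 : 'cV[R]_m) (r : R) :
  `|z - col_mx x0 y0| < r -> `|usubmx z - x0| < r /\ `|dsubmx z - y0| < r.
Proof.
move=> zr; have r0 : 0 < r by exact: le_lt_trans (normr_ge0 _) zr.
split; apply: norm_lt_coord => // k.
  have := le_lt_trans (norm_coord_le _ (lshift m k)) zr.
  by rewrite !mxE (unsplitK (inl _)) => //.
have := le_lt_trans (norm_coord_le _ (rshift n k)) zr.
by rewrite !mxE (unsplitK (inr _)) => //.
Qed.

(** Solutions through all points of a ball are assembled with the time as last
    coordinate; smoothness in the initial point is sol_smooth_on. *)
Lemma local_flow n (Om : set 'cV[R]_n) (X : 'cV[R]_n -> 'cV[R]_n) x0 :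
  open Om -> Om x0 -> (forall i, smooth_on Om (fun x => X x i 0)) ->
  exists r : R, exists u : 'cV[R]_(n + 1) -> 'cV[R]_n,
  let B := [set z : 'cV[R]_(n + 1) | `|z - col_mx x0 0| < r] in
  [/\ 0 < r, forall i, smooth_on B (fun z => u z i 0),
     forall z, B z -> Om (u z),
     forall x, `|x - x0| < r -> u (col_mx x 0) = x &
     forall z i, B z -> partial (rshift n 0) (fun z => u z i 0) z = X (u z) i 0].
Proof.
move=> oO Ox0 sX; have [d d0 Hd] := open_ball_sub oO Ox0.
pose rho := d / 3; have rho0 : 0 < rho by rewrite divr_gt0.
pose a k := x0 k 0 - 2 * rho; pose b k := x0 k 0 + 2 * rho.
have bE x : `|x - x0| <= 2 * rho -> box a b x.
  by rewrite -ball_box // mulr_ge0 // ltW.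
have KO : box a b `<=` Om.
  rewrite -ball_box; last by rewrite mulr_ge0 // ltW.
  move=> x /= xr; rewrite -(subrK x0 x) addrC; apply: Hd; apply: le_lt_trans xr _.
  by rewrite /rho mulrCA gtr_pMr // ltr_pdivrMr // mul1r ltr_nat.
have [B B0 HB] := local_ode KO sX.
pose r := rho / (1 + B); have B1 : 0 < 1 + B by rewrite addr_gt0.
have r0 : 0 < r by rewrite divr_gt0.
have rrho : r <= rho by rewrite ler_pdivrMr // mulrDr mulr1 lerDl mulr_ge0 // ltW.
have rB : r * B <= rho.
  by rewrite /r mulrAC ler_pdivrMr // ler_wpM2l ?ltW // ltrDr.
have /choice[U HU] : forall x, exists U : R -> 'cV[R]_n, `|x - x0| < r ->
   [/\ U 0 = x, forall s, `|s| * B <= rho -> `|U s - x| <= rho &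
     forall s i, `|s| * B <= rho -> is_derive s (1 : R) (fun s => U s i 0) (X (U s) i 0)].
  move=> x; have [xr|] := pselect (`|x - x0| < r); last by exists (fun=> 0).
  have [|U HU] := HB x rho rho0; last by exists U.
  move=> y yr; apply: bE; rewrite mulr_natl mulr2n.
  apply: le_trans (ler_distD x _ _) _; apply: lerD => //.
  by apply: le_trans rrho; exact: ltW.
pose u (z : 'cV[R]_(n + 1)) := U (usubmx z) (dsubmx z 0 0).
pose k0 : 'I_(n + 1) := rshift n 0; pose c := col_mx x0 (0 : 'cV[R]_1).
have ck : c k0 0 = 0 by rewrite col_mxEd mxE.
have zE (z : 'cV[R]_(n + 1)) : slice k0 z = col_mx (usubmx z) 0.
  apply/matrixP => i j; rewrite ord1 sliceE; case: (split_ordP i) => k ->.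
    by rewrite col_mxEu mxE; case: eqP => // /(congr1 val) /= E; have := ltn_ord k; rewrite E addn0 ltnn.
  by rewrite col_mxEd !ord1 eqxx mxE.
have zs (z : 'cV[R]_(n + 1)) : `|z - c| < r -> `|usubmx z - x0| < r /\ `|dsubmx z 0 0| < r.
  move=> /ball_usubmx [? H2]; split=> //.
  by apply: le_lt_trans H2; have := norm_coord_le (dsubmx z - 0) 0; rewrite subr0.
have sB (s : R) : `|s| < r -> `|s| * B <= rho.
  by move=> sr; apply: le_trans rB; rewrite ler_wpM2r // ltW.
have S : sol k0 X Om a b u c r.
  split=> //.
  - move=> z /zs [xr sr]; have [_ H _] := HU _ xr.
    apply: bE; rewrite mulr_natl mulr2n; apply: le_trans (ler_distD (usubmx z) _ _) _.
    apply: lerD; first by apply: H; exact: sB.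
    by apply: le_trans rrho; exact: ltW.
  - move=> z i /zs [xr sr]; have [_ _ H] := HU _ xr.
    suff : is_derive (slice k0 z + dsubmx z 0 0 *: delta_mx k0 0) (delta_mx k0 0) (fun z => u z i 0) (X (u z) i 0).
      have -> : dsubmx z 0 0 = z k0 0 by rewrite mxE.
      by rewrite -slice_line.
    apply: is_derive_of_line; rewrite (_ : (fun _ => _) = fun s => U (usubmx z) s i 0); last first.
      apply/funext => s; rewrite /u zE linearD linearZ /= col_mxKu.
      rewrite (_ : usubmx (delta_mx k0 0) = 0 :> 'cV[R]_n) ?scaler0 ?addr0.
        by rewrite linearD linearZ /= col_mxKd add0r !mxE !eqxx mulr1.
      apply/matrixP => p q; rewrite !mxE; case: eqP => // /(congr1 val) /= E.
      by have := ltn_ord p; rewrite E addn0 ltnn.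
    by apply: H; exact: sB.
  - move=> i; apply: (@smooth_eq _ _ _ (fun z => z (lshift 1 i) 0)); first exact: open_ball_norm.
      move=> z /zs [xr _]; have [H _ _] := HU _ xr.
      by rewrite /u zE col_mxKu col_mxKd mxE H mxE.
    by apply: smooth_coord; exact: open_ball_norm.
exists r, u; split=> //.
- by move=> i; exact: sol_smooth_on ck S.
- by move=> z zr; apply: KO; exact: (sol_in S zr).
- move=> x xr; have [H _ _] := HU _ xr.
  by rewrite /u col_mxKu col_mxKd mxE.
- by move=> z i zr; have := sol_ode S i zr => -[_].
Qed.

End LocalFlow.

(** * Product coordinates for a unit Killing field with closed dual *)

Section Splitting.
Variables (R : realType) (n : nat) (x0 : 'cV[R]_(n + 1)) (d : R).
Variables (g : 'cV[R]_(n + 1) -> 'M[R]_(n + 1)) (xi : 'cV[R]_(n + 1) -> 'cV[R]_(n + 1)).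
Variables (tau : 'cV[R]_(n + 1) -> 'cV[R]_(n + 1)).
Hypothesis d0 : 0 < d.
Let D := [set x : 'cV[R]_(n + 1) | `|x - x0| < d].
Hypothesis sg : forall a b, smooth_on D (fun x => g x a b).
Hypothesis gT : forall x, D x -> (g x)^T = g x.
Hypothesis gP : forall x, D x -> posdef (g x).
Hypothesis sxi : forall a, smooth_on D (fun x => xi x a 0).
Hypothesis stau : forall a, smooth_on D (fun x => tau x a 0).
Hypothesis tau_closed : forall x a b, D x ->
  partial a (fun y => tau y b 0) x = partial b (fun y => tau y a 0) x.
Hypothesis tau_xi : forall x, D x -> dot (xi x) (tau x) = 1.
Hypothesis g_xi : forall x, D x -> g x *m xi x = tau x.
Hypothesis killing : forall x a b, D x ->
  \sum_l xi x l 0 * partial l (fun y => g y a b) x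
  + \sum_m g x b m * partial a (fun y => xi y m 0) x
  + \sum_m g x a m * partial b (fun y => xi y m 0) x = 0.

Let oD : open D. Proof. exact: open_ball_norm. Qed.
Let Dx0 : D x0. Proof. by rewrite /D /= subrr normr0. Qed.
Let last : 'I_(n + 1) := rshift n 0.

Lemma partial_atan m (y : 'cV[R]_m) j a :
  differentiable (fun y : 'cV[R]_m => atan (y j 0)) y /\
  partial a (fun y : 'cV[R]_m => atan (y j 0)) y = (j == a)%:R * (1 + y j 0 ^+ 2)^-1.
Proof.
split.
  apply: (@differentiable_comp _ _ _ _ (fun y : 'cV[R]_m => y j 0) atan).
    exact: differentiable_coord.
  by apply/derivable1_diffP; case: (is_derive1_atan (y j 0)).
suff : is_derive (y + 0 *: delta_mx a 0) (delta_mx a 0) (fun y : 'cV[R]_m => atan (y j 0)) ((j == a)%:R * (1 + y j 0 ^+ 2)^-1).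
  by rewrite scale0r addr0 => -[].
apply: is_derive_of_line.
rewrite (_ : (fun _ => _) = atan \o (fun s : R => y j 0 + s * (j == a)%:R)); last first.
  by apply/funext => s; rewrite /= !mxE eqxx andbT.
have da : is_derive (0 : R) 1 (fun s : R => y j 0 + s * (j == a)%:R) (j == a)%:R.
  have H1 := @is_derive_mul R id (cst (j == a)%:R) 0 1 0 (is_derive_id _ _) (is_derive_cst _ _ _).
  have H2 := @is_derive_add R (cst (y j 0)) _ 0 0 _ (is_derive_cst _ _ _) H1.
  by apply: is_derive_eq H2 _; rewrite /= mulr0 addr0 add0r mul1r.
have := @is_derive1_comp R atan (fun s : R => y j 0 + s * (j == a)%:R) 0 _ _ (is_derive1_atan _) da.
by rewrite /= mul0r addr0 mulrC.
Qed.

Lemma smooth_atan m j : smooth_on setT (fun y : 'cV[R]_m => atan (y j 0)).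
Proof.
apply: (@smooth_intro R m setT _ (fun a y => (j == a)%:R * (1 + y j 0 ^+ 2)^-1)).
- exact: openT.
- by move=> y _; exact: (partial_atan y j j).1.
- by move=> a y _; exact: (partial_atan y j a).2.
move=> a; apply: smoothM; [exact: openT|exact: smooth_cst openT _|].
apply: smoothV; first exact: openT.
  by move=> y _; rewrite gt_eqF // ltr_wpDr // sqr_ge0.
apply: (@smooth_eq _ _ _ (fun y : 'cV[R]_m => 1 + y j 0 * y j 0)); first exact: openT.
  by move=> y _; rewrite expr2.
apply: smoothD; [exact: openT|exact: smooth_cst openT _|].
by apply: smoothM; [exact: openT| |]; exact: smooth_coord openT _.
Qed.

Lemma atan_bound (x : R) : `|atan x| <= pi.
Proof.
rewrite ler_norml; have := atan_gtNpi2 x; have := atan_ltpi2 x; have := pi_gt0 R.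
by move=> ? ? ?; apply/andP; split; lra.
Qed.

Section Chart.
Variable B : 'M[R]_(n + 1, n).
Hypothesis uB : row_mx B (xi x0) \in unitmx.

Lemma transversal : exists2 d1, 0 < d1 <= d &
  forall x, `|x - x0| < d1 -> row_mx B (xi x) \in unitmx.
Proof.
have sdet : smooth_on D (fun x => \det (row_mx B (xi x))).
  apply: smooth_det => // i j; case: (split_ordP j) => k ->.
    apply: (@smooth_eq _ _ _ (fun _ => B i k)) => //; last exact: smooth_cst.
    by move=> x _; rewrite row_mxEl.
  by apply: smooth_eq (sxi i) => // x _; rewrite row_mxEr ord1.
have nz : 0 < `|\det (row_mx B (xi x0))|.
  by rewrite normr_gt0; move: uB; rewrite unitmxE unitfE.
have [e e0 He] := continuous_epsilon (smooth_continuous sdet Dx0) nz.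
exists (Num.min d e); first by rewrite lt_min d0 e0 /= ge_min lexx.
move=> x; rewrite lt_min => /andP[_ xe]; have := He _ xe; rewrite [x0 + _]addrC subrK => H.
rewrite unitmxE unitfE; apply: contraTneq H => ->.
by rewrite sub0r normrN ltxx.
Qed.

(** The arc tangent compresses R^n into a bounded set, so that a small slice
    transverse to xi is parametrized by the whole of R^n. *)
Lemma slice_param (rho : R) : 0 < rho -> exists2 eps : R, 0 < eps &
  forall y : 'cV[R]_n, `|eps *: (B *m \col_j atan (y j 0))| < rho.
Proof.
(* The term 1 only keeps C positive when B = 0. *)
move=> rho0; pose C := n%:R * `|B| * pi + 1.
have C0 : 0 < C by rewrite ltr_wpDl // !mulr_ge0 // pi_ge0.
exists (rho / C) => [|y]; first by rewrite divr_gt0.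
rewrite normrZ gtr0_norm ?divr_gt0 // mulrAC ltr_pdivrMr // ltr_pM2l //.
rewrite /C ltr_pwDr //; apply: le_trans (mulmx_normM _ _) _.
rewrite ler_wpM2l ?mulr_ge0 //; apply: norm_le_coord => [|k]; first exact: pi_ge0.
by rewrite mxE atan_bound.
Qed.

(** The map H (y, s) follows the flow of xi from the point beta y of the slice
    until the primitive f of tau takes the value s. The pulled back metric M has
    last column (0, 1) since f (H (y, s)) = s and tau is dual to xi; it does not
    depend on s since xi is Killing. Hence it is h (y) + ds^2 with h the value
    of g - tau^2 on the slice, which is positive because xi is transverse to the
    slice. *)
Theorem splitting :
  exists (h : 'cV[R]_n -> 'M[R]_n) (W U : set 'cV[R]_(n + 1)) (H G : 'cV[R]_(n + 1) -> 'cV[R]_(n + 1)),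
  [/\ (forall a b, smooth_on setT (fun y => h y a b)), (forall y, (h y)^T = h y) & (forall y, posdef (h y))] /\
  [/\ open W, open U, U `<=` D & U x0] /\
  [/\ (forall z, W z -> U (H z) /\ G (H z) = z), (forall x, U x -> W (G x) /\ H (G x) = x),
      (forall k, smooth_on W (fun z => H z k 0)), (forall k, smooth_on U (fun x => G x k 0)) &
      (forall x, U x -> g x = (jac G x)^T *m block_mx (h (usubmx (G x))) 0 0 1%:M *m jac G x)].
Proof.
have [d1 /andP[d10 d1d] tr] := transversal.
have [r [u [r0 su uD u0 uode]]] := local_flow oD Dx0 sxi.
set Bu := [set z : 'cV[R]_(n + 1 + 1) | `|z - col_mx x0 0| < r] in su uD uode.
have [f0 [sf0 df0]] := @poincare R (n + 1) (fun a x => tau x a 0) x0 d stau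
  (fun x a b Dx => tau_closed a b Dx).
pose f x := f0 x - f0 x0.
have sf : smooth_on D f by apply: smoothB => //; exact: smooth_cst.
have df k x : D x -> partial k f x = tau x k 0.
  move=> Dx; rewrite /f partialB ?(partial_cst (f0 x0)) ?subr0 ?df0 //.
  exact: smooth_diff sf0 Dx.
pose rho := Num.min d1 r; have rho0 : 0 < rho by rewrite lt_min d10.
have [eps eps0 Heps] := slice_param rho0.
pose beta (y : 'cV[R]_n) : 'cV[R]_(n + 1) := x0 + eps *: (B *m \col_j atan (y j 0)).
have betaB y : `|beta y - x0| < rho by rewrite /beta addrAC subrr add0r.
have betad1 y : `|beta y - x0| < d1 by have := betaB y; rewrite lt_min => /andP[].
have betar y : `|beta y - x0| < r by have := betaB y; rewrite lt_min => /andP[].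
have betaD y : D (beta y) by exact: lt_le_trans (betad1 y) d1d.
have betaE y i : beta y i 0 = x0 i 0 + \sum_j (eps * B i j) * atan (y j 0).
  by rewrite !mxE mulr_sumr; congr (_ + _); apply: eq_bigr => j _; rewrite mxE mulrA.
have oT : open [set: 'cV[R]_n] := openT.
have sb i : smooth_on setT (fun y => beta y i 0).
  apply: (@smooth_eq _ _ _ (fun y => x0 i 0 + \sum_j (eps * B i j) * atan (y j 0))) => //.
  apply: smoothD => //; first exact: smooth_cst.
  by apply: smooth_sum => // j; apply: smoothM => //; [exact: smooth_cst|exact: smooth_atan].
have jb y : jac beta y = eps *: (B *m diag_mx (\row_j (1 + y j 0 ^+ 2)^-1)).
  apply/matrixP => i a; rewrite mul_mx_diag !mxE.
  rewrite (partial_eq a (g := fun y => x0 i 0 + \sum_j (eps * B i j) * atan (y j 0)) oT I) => [|z _]; last exact: betaE.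
  have da j : differentiable (fun y : 'cV[R]_n => (eps * B i j) * atan (y j 0)) y.
    by apply: (@smooth_diff _ _ setT) => //; apply: smoothM => //; [exact: smooth_cst|exact: smooth_atan].
  rewrite partialD ?(partial_cst (x0 i 0)) ?add0r; first last.
  - by apply: (@smooth_diff _ _ setT) => //; apply: smooth_sum => // j; apply: smoothM => //; [exact: smooth_cst|exact: smooth_atan].
  - exact: differentiable_cst.
  rewrite partial_sum // (bigD1 a) //= big1 ?addr0.
    rewrite partialM ?(partial_cst (eps * B i a)) ?mul0r ?add0r ?(partial_atan y a a).2 ?eqxx ?mul1r ?mulrA //.
    exact: (partial_atan y a a).1.
  move=> j ja; rewrite partialM ?(partial_cst (eps * B i j)) ?mul0r ?add0r ?(partial_atan y j a).2 //.
    by rewrite (negPf ja) mul0r mulr0.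
  exact: (partial_atan y j j).1.
pose fb (y : 'cV[R]_n) := f (beta y).
have sfb : smooth_on setT fb by apply: (smooth_comp oT sf) => // y _; exact: betaD.
(* The flow time s - f (beta y) brings f from f (beta y) to s. *)
pose theta (z : 'cV[R]_(n + 1)) : 'cV[R]_(n + 1 + 1) :=
  col_mx (beta (usubmx z)) (dsubmx z - (fb (usubmx z))%:M).
have oTz : open [set: 'cV[R]_(n + 1)] := openT.
have sus (q : 'cV[R]_n -> R) : smooth_on setT q -> smooth_on setT (fun z : 'cV[R]_(n + 1) => q (usubmx z)).
  move=> sq; apply: (smooth_comp oTz sq) => // k.
  by apply: smooth_eq (smooth_coord oTz (lshift 1 k)) => // z _; rewrite mxE.
have sth k : smooth_on setT (fun z => theta z k 0).
  case: (split_ordP k) => j ->.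
    by apply: smooth_eq (sus _ (sb j)) => // z _; rewrite col_mxEu.
  apply: (@smooth_eq _ _ _ (fun z => z last 0 - fb (usubmx z))) => //.
    by move=> z _; rewrite col_mxEd !ord1 !mxE eqxx mulr1n.
  by apply: smoothB => //; [exact: smooth_coord|exact: sus].
pose V := [set z | setT z /\ Bu (theta z)].
have oV : open V.
  apply: open_preimage => //; first exact: open_ball_norm.
  by move=> z _; apply: col_continuous => k; exact: smooth_diff (sth k) I.
have Vth z : V z -> Bu (theta z) by case.
pose H z := u (theta z).
have sH k : smooth_on V (fun z => H z k 0).
  by apply: (smooth_comp oV (su k)) => // j; exact: smooth_onS (sth j).
have HD z : V z -> D (H z) by move=> /Vth; exact: uD.
have thl z (s : R) : theta (s *: delta_mx last 0 + z) = s *: delta_mx (rshift (n + 1) 0) 0 + theta z.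
  have e1 : usubmx (s *: delta_mx last 0 + z) = usubmx z.
    apply/matrixP => i j; rewrite !mxE; case: eqP => [/(congr1 val) /= E|]; last by rewrite mulr0 add0r.
    by have := ltn_ord i; rewrite E addn0 ltnn.
  rewrite /theta e1; apply/matrixP => i j; rewrite ord1 [RHS]mxE; case: (split_ordP i) => k ->.
    rewrite !col_mxEu !mxE; case: eqP => [/(congr1 val) /= E|]; last by rewrite mulr0 add0r.
    by have := ltn_ord k; rewrite E addn0 ltnn.
  by rewrite !col_mxEd !ord1 !mxE !eqxx addrA.
have Hl z i : V z -> partial last (fun z => H z i 0) z = xi (H z) i 0.
  move=> Vz; rewrite -(uode (theta z) i (Vth _ Vz)).
  have E : (fun t : R => t^-1 *: (((fun z => H z i 0) \o shift z) (t *: delta_mx last 0) - H z i 0)) =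
      (fun t : R => t^-1 *: (((fun w => u w i 0) \o shift (theta z)) (t *: delta_mx (rshift (n + 1) 0) 0) - u (theta z) i 0)).
    by apply/funext => t /=; rewrite /H thl.
  by rewrite /partial /derive E.
have oBu : open Bu by exact: open_ball_norm.
have line_in (y : 'cV[R]_(n + 1)) (t : R) : `|y - x0| < r -> `|t| < r ->
    Bu (col_mx y 0 + t *: delta_mx (rshift (n + 1) 0) 0).
  move=> yr tr'; have -> : col_mx y 0 + t *: delta_mx (rshift (n + 1) 0) 0 = col_mx y (t%:M : 'cV[R]_1) :> 'cV[R]_(n + 1 + 1).
    apply/matrixP => p q; rewrite ord1 mxE; case: (split_ordP p) => k ->.
      rewrite !col_mxEu !mxE; case: eqP => [/(congr1 val) /= E|]; last by rewrite mulr0 addr0.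
      by have := ltn_ord k; rewrite E addn0 ltnn.
    by rewrite !col_mxEd !ord1 !mxE !eqxx mulr1 add0r mulr1n.
  apply: ball_col_mx => //; rewrite subr0; apply: norm_lt_coord => // k.
  by rewrite ord1 mxE eqxx mulr1n.
have fu w : Bu w -> f (u w) = f (usubmx w) + dsubmx w 0 0.
  move=> /ball_usubmx [xr]; rewrite subr0 => sr0.
  have sr : `|dsubmx w 0 0| < r by exact: le_lt_trans (norm_coord_le _ 0) sr0.
  set x := usubmx w in xr *; set s := dsubmx w 0 0 in sr *.
  pose e : 'cV[R]_(n + 1 + 1) := delta_mx (rshift (n + 1) 0) 0.
  have wE : w = col_mx x 0 + s *: e.
    apply/matrixP => p q; rewrite ord1 mxE; case: (split_ordP p) => k ->.
      rewrite !col_mxEu !mxE; case: eqP => [/(congr1 val) /= E|]; last by rewrite mulr0 addr0.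
      by have := ltn_ord k; rewrite E addn0 ltnn.
    by rewrite !col_mxEd !ord1 !mxE !eqxx mulr1 add0r /s mxE.
  have sphi : smooth_on Bu (fun w => f (u w)) by exact: (smooth_comp oBu sf uD su).
  have inB (c : R) : 0 <= c <= 1 -> Bu (col_mx x 0 + c *: (s *: e)).
    move=> /andP[c0 c1]; rewrite scalerA; apply: line_in => //.
    by rewrite normrM ger0_norm // (le_lt_trans _ sr) // ler_piMl.
  have [|c c01] := @segment_MVT R _ (fun w => f (u w)) (col_mx x 0) (s *: e).
    by move=> c c01; apply: smooth_diff sphi (inB c c01).
  rewrite sum_delta -wE u0 // => /eqP; rewrite subr_eq => /eqP ->.
  have Bc := inB c c01; set w' := col_mx x 0 + _ in Bc *.
  rewrite (@partial_comp R _ _ f u w' _ (fun j => smooth_diff (su j) Bc) (smooth_diff sf (uD _ Bc))).2.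
  rewrite (_ : \sum_j _ = 1) ?mulr1 1?addrC // -(tau_xi (uD _ Bc)).
  by apply: eq_bigr => j _; rewrite uode // df //; exact: uD.
have fH z : V z -> f (H z) = z last 0.
  by move=> /Vth Bz; rewrite /H fu // /theta col_mxKu col_mxKd !mxE eqxx mulr1n /fb [LHS]addrC subrK.
have Htau z a : V z -> \sum_i partial a (fun z => H z i 0) z * tau (H z) i 0 = (last == a)%:R.
  move=> Vz; rewrite -(partial_coord last a z) -(partial_eq a oV Vz fH).
  rewrite (@partial_comp R _ _ f H z a (fun j => smooth_diff (sH j) Vz) (smooth_diff sf (HD _ Vz))).2.
  by apply: eq_bigr => i _; rewrite df //; exact: HD.
pose J := jac H.
have [M HM] : exists M, forall z, M z = (J z)^T *m g (H z) *m J z.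
  by exists (fun z => (J z)^T *m g (H z) *m J z).
have MT z : V z -> (M z)^T = M z.
  by move=> Vz; rewrite HM !trmx_mul trmxK gT ?mulmxA //; exact: HD.
have Ml z : V z -> M z *m delta_mx last 0 = delta_mx last (0 : 'I_1).
  move=> Vz; rewrite HM -!mulmxA.
  have -> : J z *m delta_mx last 0 = xi (H z).
    by apply/matrixP => i j; rewrite -colE !mxE ord1 Hl.
  rewrite g_xi; last exact: HD.
  apply/matrixP => a j; rewrite ord1 !mxE andbT eq_sym -(Htau z a Vz).
  by apply: eq_bigr => i _; rewrite !mxE.
have Mlast z a : V z -> M z a last = (a == last)%:R.
  by move=> Vz; have := congr1 (fun A : 'cV[R]_(n + 1) => A a 0) (Ml z Vz); rewrite -colE !mxE eqxx andbT.
have Mblock z : V z -> M z = block_mx (ulsubmx (M z)) 0 0 1%:M.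
  move=> Vz; rewrite -{1}[M z]submxK; congr block_mx.
  - apply/matrixP => i j; rewrite !mxE ord1 Mlast //.
    by case: eqP => // /(congr1 val) /= E; have := ltn_ord i; rewrite E addn0 ltnn.
  - apply/matrixP => i j; rewrite !mxE ord1 -[M z]trmxK (MT z Vz) mxE Mlast //.
    by case: eqP => // /(congr1 val) /= E; have := ltn_ord j; rewrite E addn0 ltnn.
  - by apply/matrixP => i j; rewrite !ord1 !mxE Mlast // !eqxx.
have ME z a b : M z a b = \sum_i \sum_j partial a (fun z => H z i 0) z * g (H z) i j * partial b (fun z => H z j 0) z.
  rewrite HM -mulmxA mxE; apply: eq_bigr => i _; rewrite !mxE mulr_sumr.
  by apply: eq_bigr => j _; rewrite !mxE mulrA.
have sgH i j : smooth_on V (fun z => g (H z) i j) by exact: (smooth_comp oV (sg i j) HD sH).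
have sMt a b i j : smooth_on V (fun z => partial a (fun z => H z i 0) z * g (H z) i j * partial b (fun z => H z j 0) z).
  by apply: smoothM => //; [apply: smoothM => //; exact: smooth_partial|exact: smooth_partial].
have sM a b : smooth_on V (fun z => M z a b).
  apply: (@smooth_eq _ _ _ (fun z => \sum_i \sum_j partial a (fun z => H z i 0) z * g (H z) i j * partial b (fun z => H z j 0) z)) => //.
  by apply: smooth_sum => // i; apply: smooth_sum.
have dP z a i : V z -> partial last (partial a (fun z => H z i 0)) z =
     \sum_l partial a (fun z => H z l 0) z * partial l (fun x => xi x i 0) (H z).
  move=> Vz; rewrite (partialC last a oV (sH i) Vz).
  rewrite (partial_eq a (g := (fun x => xi x i 0) \o H) oV Vz); last by move=> z' Vz'; exact: Hl.
  exact: (@partial_comp R _ _ (fun x => xi x i 0) H z a (fun j => smooth_diff (sH j) Vz) (smooth_diff (sxi i) (HD _ Vz))).2.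
have dg z i j : V z -> partial last (fun z => g (H z) i j) z = \sum_l xi (H z) l 0 * partial l (fun x => g x i j) (H z).
  move=> Vz; rewrite (@partial_comp R _ _ (fun x => g x i j) H z last (fun j => smooth_diff (sH j) Vz) (smooth_diff (sg i j) (HD _ Vz))).2.
  by apply: eq_bigr => l _; rewrite Hl.
(* The Lie derivative of g along xi vanishes; the second derivatives of H are
   exchanged to see the derivatives of xi. *)
have dM z a b : V z -> partial last (fun z => M z a b) z = 0.
  move=> Vz; have Dz := HD _ Vz.
  rewrite (partial_eq last (g := fun z => \sum_i \sum_j partial a (fun z => H z i 0) z * g (H z) i j * partial b (fun z => H z j 0) z) oV Vz) //.
  rewrite partial_sum; last by move=> i; apply: smooth_diff (smooth_sum oV (sMt a b i)) Vz.
  under eq_bigr => i _.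
    rewrite partial_sum; last by move=> j; apply: smooth_diff (sMt a b i j) Vz.
    under eq_bigr => j _.
      have d1' := smooth_diff (smooth_partial a (sH i)) Vz.
      have d2' := smooth_diff (sgH i j) Vz.
      have d3' := smooth_diff (smooth_partial b (sH j)) Vz.
      rewrite partialM //; last exact: differentiableM.
      rewrite (partialM last d1' d2') !dP // dg //.
      over.
    over.
  set P := fun a i => partial a (fun z => H z i 0) z.
  set X := fun l i => partial l (fun x => xi x i 0) (H z).
  pose S1 := \sum_i \sum_j \sum_l P a l * X l i * g (H z) i j * P b j.
  pose S2 := \sum_i \sum_j P a i * P b j * \sum_l xi (H z) l 0 * partial l (fun x => g x i j) (H z).
  pose S3 := \sum_i \sum_j \sum_l P a i * g (H z) i j * (P b l * X l j).
  have -> : \sum_i \sum_j (((\sum_l P a l * X l i) * g (H z) i j + P a i * \sum_l xi (H z) l 0 * partial l (fun x => g x i j) (H z)) * P b j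
     + P a i * g (H z) i j * \sum_l P b l * X l j) = S1 + S2 + S3.
    rewrite /S1 /S2 /S3 -!big_split; apply: eq_bigr => i _; rewrite -!big_split; apply: eq_bigr => j _ /=.
    rewrite mulrDl; congr (_ + _ + _); [by rewrite !mulr_suml|exact: mulrAC|by rewrite mulr_sumr].
  have E1 : S1 = \sum_i \sum_j P a i * P b j * \sum_m g (H z) j m * X i m.
    rewrite /S1; under eq_bigr => i _ do rewrite exchange_big /=.
    rewrite exchange_big /=; apply: eq_bigr => l _; rewrite exchange_big /=; apply: eq_bigr => j _.
    rewrite mulr_sumr; apply: eq_bigr => i _; rewrite -(gT Dz) mxE (gT Dz); ring.
  have E3 : S3 = \sum_i \sum_j P a i * P b j * \sum_m g (H z) i m * X j m.
    rewrite /S3; apply: eq_bigr => i _; rewrite exchange_big /=; apply: eq_bigr => l _.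
    by rewrite mulr_sumr; apply: eq_bigr => j _; ring.
  rewrite E1 E3 /S2 -!big_split big1 // => i _; rewrite -!big_split big1 // => j _ /=.
  rewrite -!mulrDr [X in _ * X](_ : _ = 0) ?mulr0 //.
  by apply: etrans (killing i j Dz); congr (_ + _); exact: addrC.
(* The points of flow time zero: there H is beta, and the block of M is read off
   from jac beta. *)
pose kappa (y : 'cV[R]_n) : 'cV[R]_(n + 1) := col_mx y (fb y)%:M.
have thk y : theta (kappa y) = col_mx (beta y) 0 by rewrite /theta col_mxKu col_mxKd subrr.
have Vk y : V (kappa y).
  split=> //; rewrite thk; apply: ball_col_mx => //.
  by rewrite subrr normr0.
have Hk y : H (kappa y) = beta y by rewrite /H thk u0.
have jk y : jac kappa y = col_mx 1%:M (\row_a partial a fb y).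
  apply/matrixP => i a; rewrite mxE; case: (split_ordP i) => k ->.
    rewrite (_ : (fun _ => _) = fun y : 'cV[R]_n => y k 0); last by apply/funext => y'; rewrite col_mxEu.
    by rewrite partial_coord col_mxEu mxE.
  rewrite (_ : (fun _ => _) = fb); first by rewrite col_mxEd !ord1 !mxE.
  by apply/funext => y'; rewrite col_mxEd !ord1 mxE eqxx mulr1n.
have sk k : smooth_on setT (fun y => kappa y k 0).
  case: (split_ordP k) => j ->.
    by apply: smooth_eq (smooth_coord oT j) => // y _; rewrite col_mxEu.
  by apply: smooth_eq sfb => // y _; rewrite col_mxEd !ord1 mxE eqxx mulr1n.
have jHk y : J (kappa y) *m jac kappa y = jac beta y.
  rewrite /J -jac_comp.
  - by congr (jac _ y); apply/funext => y'; exact: Hk.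
  - by move=> j; exact: smooth_diff (sk j) I.
  - by move=> j; exact: smooth_diff (sH j) (Vk y).
pose h y := (jac beta y)^T *m g (beta y) *m jac beta y
   - (\row_a partial a fb y)^T *m (\row_a partial a fb y).
(* The derivative of the last coordinate of kappa accounts for the square of d
   (f o beta). *)
have hM y : ulsubmx (M (kappa y)) = h y.
  have : (jac kappa y)^T *m M (kappa y) *m jac kappa y = (jac beta y)^T *m g (beta y) *m jac beta y.
    by rewrite -jHk trmx_mul HM Hk !mulmxA.
  rewrite Mblock // jk tr_col_mx trmx1 mul_row_block mul_row_col !mul1mx !mulmx0 !mulmx1 addr0 add0r.
  by move=> E; rewrite block_mxKul /h -E addrK.
(* Constancy in s transports the value at kappa y along the vertical segment,
   which stays in the domain of the flow. *)
have Mconst z : V z -> M z = block_mx (h (usubmx z)) 0 0 1%:M.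
  move=> Vz; rewrite Mblock // -hM; congr (block_mx (ulsubmx _) _ _ _).
  set y := usubmx z; pose s := z last 0 - fb y.
  pose e : 'cV[R]_(n + 1) := delta_mx last 0.
  have zE : z = kappa y + s *: e.
    apply/matrixP => p q; rewrite ord1 mxE; case: (split_ordP p) => k ->.
      rewrite col_mxEu !mxE; case: eqP => [/(congr1 val) /= E|]; last by rewrite mulr0 addr0.
      by have := ltn_ord k; rewrite E addn0 ltnn.
    by rewrite col_mxEd !ord1 !mxE !eqxx mulr1 mulr1n /s addrC subrK.
  have sr : `|s| < r.
    have /ball_usubmx [_] := Vth z Vz; rewrite subr0 /theta col_mxKd => sr0.
    by apply: le_lt_trans sr0; have := norm_coord_le (dsubmx z - (fb (usubmx z))%:M) 0; rewrite !mxE eqxx mulr1n.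
  have inV (c : R) : 0 <= c <= 1 -> V (kappa y + c *: (s *: e)).
    move=> /andP[c0 c1]; split=> //; rewrite scalerA addrC thl thk addrC; apply: line_in => //.
    by rewrite normrM ger0_norm // (le_lt_trans _ sr) // ler_piMl.
  apply/matrixP => a b.
  have [|c c01] := @segment_MVT R _ (fun z => M z a b) (kappa y) (s *: e).
    by move=> c c01; apply: smooth_diff (sM a b) (inV c c01).
  by rewrite sum_delta -zE dM ?mulr0; [move/eqP; rewrite subr_eq0 => /eqP|exact: inV].
have hT y : (h y)^T = h y by rewrite -hM trmx_ulsub MT.
have sjb i j : smooth_on setT (fun y => jac beta y i j).
  by apply: smooth_eq (smooth_partial j (sb i)) => // y _; rewrite mxE.
have sh a b : smooth_on setT (fun y => h y a b).
  apply: (@smooth_eq _ _ _ (fun y => ((jac beta y)^T *m g (beta y) *m jac beta y) a b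
    - ((\row_a partial a fb y)^T *m (\row_a partial a fb y)) a b)) => //.
    by move=> y _; rewrite [RHS]mxE [X in _ = _ + X]mxE.
  apply: smoothB => //.
    apply: smooth_mulmx => // i j; apply: smooth_mulmx => // i' j'.
      by apply: smooth_eq (sjb j' i') => // y _; rewrite [RHS]mxE.
    by apply: (smooth_comp oT (sg i' j')) => // y _; exact: betaD.
  apply: smooth_mulmx => // i j.
    by apply: smooth_eq (smooth_partial i sfb) => // y _; rewrite !mxE.
  by apply: smooth_eq (smooth_partial j sfb) => // y _; rewrite !mxE.
have hP y : posdef (h y).
  move=> v v0.
  pose w' : 'cV[R]_n := eps *: (diag_mx (\row_j (1 + y j 0 ^+ 2)^-1) *m v).
  pose X := jac beta y *m v.
  have XE : X = B *m w' by rewrite /X jb /w' -scalemxAl -scalemxAr mulmxA.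
  pose T := tau (beta y); pose c := (T^T *m X) 0 0.
  have dE : \row_a partial a fb y = T^T *m jac beta y.
    apply/matrixP => i a; rewrite !mxE ord1.
    rewrite (@partial_comp R _ _ f beta y a (fun j => smooth_diff (sb j) I) (smooth_diff sf (betaD y))).2.
    apply: eq_bigr => j _; rewrite [T^T _ _]mxE [jac _ _ _ _]mxE df; last exact: betaD.
    exact: mulrC.
  have cE : T^T *m X = c%:M by rewrite [LHS]mx11_scalar.
  have cE' : X^T *m T = c%:M by rewrite -[LHS]trmxK trmx_mul trmxK cE tr_scalar_mx.
  have gx := g_xi (betaD y).
  have xT : (xi (beta y))^T *m T = 1%:M.
    apply/matrixP => i j; rewrite !ord1 !mxE eqxx mulr1n -(tau_xi (betaD y)).
    by apply: eq_bigr => k _; rewrite mxE.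
  have xg : (xi (beta y))^T *m g (beta y) = T^T.
    by rewrite /T -gx trmx_mul gT.
  (* The component of X orthogonal to xi; the value of h is g (Y, Y). *)
  pose Y := X - c *: xi (beta y).
  have -> : v^T *m h y *m v = Y^T *m g (beta y) *m Y.
    rewrite /h mulmxBr mulmxBl.
    have -> : v^T *m ((jac beta y)^T *m g (beta y) *m jac beta y) *m v = X^T *m g (beta y) *m X.
      by rewrite /X trmx_mul !mulmxA.
    have -> : v^T *m ((\row_a partial a fb y)^T *m (\row_a partial a fb y)) *m v = c%:M *m c%:M.
      rewrite dE -{1}cE' -cE /X !trmx_mul trmxK !mulmxA //.
    have -> : Y^T *m g (beta y) = X^T *m g (beta y) - c *: T^T.
      have -> : Y^T = X^T - c *: (xi (beta y))^T by apply/matrixP => i j; rewrite !mxE.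
      by rewrite mulmxBl -scalemxAl xg.
    rewrite mulmxBl /Y 2!mulmxBr -!scalemxAl -!scalemxAr -(mulmxA X^T _ (xi _)) gx -/T cE' cE.
    have -> : T^T *m xi (beta y) = 1%:M by rewrite -[LHS]trmxK trmx_mul trmxK xT trmx1.
    apply/matrixP => i j; rewrite !ord1 !mxE big_ord1 !mxE eqxx !mulr1n; ring.
  apply: gP; first exact: betaD.
  apply: contra v0 => /eqP Y0; apply/eqP.
  have : row_mx B (xi (beta y)) *m col_mx w' (- c)%:M = 0.
    by rewrite mul_row_col -XE mul_mx_scalar scaleNr; exact: Y0.
  move=> /(congr1 (mulmx (invmx (row_mx B (xi (beta y)))))).
  rewrite mulmxA mulVmx ?tr // mul1mx mulmx0 => E.
  have w0 : w' = 0 by rewrite -(col_mxKu w' (- c)%:M) E linear0.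
  apply/matrixP => a j; rewrite ord1 mxE.
  have := congr1 (fun A : 'cV[R]_n => A a 0) w0; rewrite mxE mul_diag_mx !mxE => /eqP.
  rewrite mulf_eq0 (gt_eqF eps0) /= mulf_eq0 invr_eq0 gt_eqF /=; first by move/eqP.
  by rewrite ltr_wpDr // sqr_ge0.
have uJ z : V z -> J z \in unitmx.
  move=> Vz; have : M z \in unitmx.
    rewrite Mconst // unitmxE det_ublock det1 mulr1 -unitmxE.
    exact: posdef_unit.
  by rewrite HM !unitmx_mul => /andP[].
have [W [U [G [[oW Wk WV oU] WU UW sG]]]] := local_inverse oV (Vk 0) sH uJ.
exists h, W, U, H, G; split; [by split|split; split] => //.
- by move=> x /UW [/WV Vx <-]; exact: HD.
- have <- : H (kappa 0) = x0.
    rewrite Hk /beta (_ : \col_j _ = 0) ?mulmx0 ?scaler0 ?addr0 //.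
    by apply/matrixP => i j; rewrite !mxE atan0.
  by have [] := WU _ Wk.
- by move=> k; exact: smooth_onS (sH k).
move=> x Ux; have [Wx HGx] := UW x Ux.
rewrite -Mconst; last exact: WV.
have E : J (G x) *m jac G x = 1%:M.
  rewrite /J -jac_comp.
  - rewrite -(jac_id x); apply: jac_eq oU Ux _ => y Uy /=; exact: (UW y Uy).2.
  - by move=> j; exact: smooth_diff (sG j) Ux.
  - by move=> j; exact: smooth_diff (sH j) (WV _ Wx).
have -> : (jac G x)^T *m M (G x) *m jac G x = (J (G x) *m jac G x)^T *m g (H (G x)) *m (J (G x) *m jac G x).
  by rewrite HM trmx_mul !mulmxA.
by rewrite E trmx1 mul1mx mulmx1 HGx.
Qed.

End Chart.
End Splitting.

(** * Local splitting along a parallel one-form *)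

Section LocalSplitting.
Variable R : realType.

Lemma ball_cst n (f : 'cV[R]_n -> R) x0 (d : R) :
  (forall x, `|x - x0| < d -> differentiable f x) ->
  (forall x k, `|x - x0| < d -> partial k f x = 0) ->
  forall x, `|x - x0| < d -> f x = f x0.
Proof.
move=> df pf x xd.
have inB (s : R) : 0 <= s <= 1 -> `|x0 + s *: (x - x0) - x0| < d.
  move=> /andP[s0 s1]; rewrite addrAC subrr add0r normrZ ger0_norm //.
  by apply: le_lt_trans xd; rewrite ler_piMl.
have [|c c01] := @segment_MVT R n f x0 (x - x0); first by move=> s /inB; exact: df.
rewrite [x0 + _]addrC subrK big1 => [/eqP|k _]; first by rewrite subr_eq0 => /eqP.
by rewrite pf ?mulr0 //; exact: inB.
Qed.

(** If v has a nonzero coordinate k, the other coordinate vectors complete it to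
    a basis. *)
Lemma complement_unitmx n (v : 'cV[R]_(n + 1)) : v != 0 ->
  exists B : 'M[R]_(n + 1, n), row_mx B v \in unitmx.
Proof.
move=> v0; have [k vk] : exists k, v k 0 != 0.
  apply/existsP; apply: contraT; rewrite negb_exists => /forallP H.
  by move: v0 => /eqP[]; apply/matrixP => i j; rewrite ord1 mxE; apply/eqP; have := H i; rewrite negbK.
pose e := cast_ord (addn1 n).
exists (\matrix_(i, j) (e i == lift (e k) j)%:R); apply: unitmx_inj => w.
rewrite -[w]vsubmxK mul_row_col; set w1 := usubmx w; set w2 := dsubmx w => E.
have Ei i : \sum_j (e i == lift (e k) j)%:R * w1 j 0 + v i 0 * w2 0 0 = 0.
  have := congr1 (fun M : 'cV[R]_(n + 1) => M i 0) E; rewrite mxE [RHS]mxE => {}E; apply: etrans E.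
  rewrite [(_ *m w1) i 0]mxE [(v *m w2) i 0]mxE big_ord1.
  by congr (_ + _); apply: eq_bigr => j _; rewrite [X in _ = X * _]mxE.
have w20 : w2 = 0.
  apply/matrixP => i j; rewrite !ord1 [RHS]mxE; apply/eqP.
  have := Ei k; rewrite big1 ?add0r => [/eqP|l _].
    by rewrite mulf_eq0 (negPf vk).
  by rewrite (negPf (neq_lift _ _)) mul0r.
rewrite w20 (_ : w1 = 0) ?col_mx0 //; apply/matrixP => j i; rewrite ord1 [RHS]mxE.
have := Ei (cast_ord (esym (addn1 n)) (lift (e k) j)).
rewrite w20 [X in _ * X]mxE mulr0 addr0 (bigD1 j) //= /e cast_ordKV eqxx mul1r big1 ?addr0 // => i' ne.
by rewrite (inj_eq lift_inj) eq_sym (negPf ne) mul0r.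
Qed.

Section ParallelSharp.
Variables (n : nat) (Om : set 'cV[R]_n) (g : 'cV[R]_n -> 'M[R]_n) (t : 'cV[R]_n -> 'I_n -> R).
Hypothesis gP : forall x, Om x -> posdef (g x).

Lemma norm2_form x : Om x -> norm2 g t x = ((sharp g t x)^T *m g x *m sharp g t x) 0 0.
Proof.
move=> Ox; rewrite -mulmxA mxE; apply: eq_bigr => a _.
rewrite [X in _ = _ * X]mxE [X in _ = X * _]mxE mulrC; congr (_ * _).
exact: flat_sharp Ox.
Qed.

Lemma sharp_eq0 x : Om x -> sharp g t x = 0 -> forall a, t x a = 0.
Proof.
by move=> Ox s0 a; rewrite (flat_sharp t gP a Ox) // big1 // => m _; rewrite s0 mxE mulr0.
Qed.

Lemma norm2_gt0 x : Om x -> (exists a, t x a != 0) -> 0 < norm2 g t x.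
Proof.
move=> Ox [a ta]; rewrite norm2_form //; apply: gP => //.
by apply: contra ta => /eqP s0; rewrite sharp_eq0.
Qed.

Lemma norm2_eq0 x : (forall a, t x a = 0) -> norm2 g t x = 0.
Proof. by move=> t0; rewrite /norm2 big1 // => a _; rewrite t0 mul0r. Qed.

End ParallelSharp.

(** The dual field of t divided by the constant length of t is a unit Killing
    field with closed dual form, to which splitting applies. *)
Theorem parallel_form_splitting n (Om : set 'cV[R]_(n + 1)) (g : 'cV[R]_(n + 1) -> 'M[R]_(n + 1))
    (t : 'cV[R]_(n + 1) -> 'I_(n + 1) -> R) x0 :
  open Om -> (forall a b, smooth_on Om (fun x => g x a b)) ->
  (forall x, Om x -> (g x)^T = g x) -> (forall x, Om x -> posdef (g x)) ->
  (forall a, smooth_on Om (fun x => t x a)) ->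
  (forall x, Om x -> forall k a, nabla_form1 (levi_civita g) t x k a = 0) ->
  Om x0 -> (exists a, t x0 a != 0) ->
  exists (h : 'cV[R]_n -> 'M[R]_n) (W U : set 'cV[R]_(n + 1)) (H G : 'cV[R]_(n + 1) -> 'cV[R]_(n + 1)),
  [/\ (forall a b, smooth_on setT (fun y => h y a b)), (forall y, (h y)^T = h y) & (forall y, posdef (h y))] /\
  [/\ open W, open U, U `<=` Om & U x0] /\
  [/\ (forall z, W z -> U (H z) /\ G (H z) = z), (forall x, U x -> W (G x) /\ H (G x) = x),
      (forall k, smooth_on W (fun z => H z k 0)), (forall k, smooth_on U (fun x => G x k 0)) &
      (forall x, U x -> g x = (jac G x)^T *m block_mx (h (usubmx (G x))) 0 0 1%:M *m jac G x)].
Proof.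
move=> oO sg gT gP st lct Ox0 t0.
have [d d0 Hd] := open_ball_sub oO Ox0.
pose D := [set x : 'cV[R]_(n + 1) | `|x - x0| < d].
have oD : open D by exact: open_ball_norm.
have DO : D `<=` Om by move=> x xd; rewrite -(subrK x0 x) addrC; exact: Hd.
have ss := sharp_smooth oO sg gP st.
have dn x : D x -> differentiable (norm2 g t) x.
  move=> /DO Ox; apply: (@smooth_diff _ _ Om) => //.
  by apply: smooth_sum => // a; apply: smoothM => //; exact: ss.
have ncst : forall x, D x -> norm2 g t x = norm2 g t x0.
  by apply: ball_cst => // x k Dx; exact: (partial_norm2 oO sg gT gP st lct k (DO _ Dx)).
have N0 := norm2_gt0 gP Ox0 t0; set N := norm2 g t x0 in N0 ncst.
have [c [c0 cN]] : exists c : R, c != 0 /\ c * c * N = 1.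
  exists (Num.sqrt N)^-1; split; first by rewrite invr_eq0 gt_eqF // sqrtr_gt0.
  by rewrite -invfM -expr2 sqr_sqrtr ?ltW // mulVf // gt_eqF.
pose xi x := c *: sharp g t x; pose tau x : 'cV[R]_(n + 1) := \col_a (c * t x a).
have [B uB] : exists B : 'M[R]_(n + 1, n), row_mx B (xi x0) \in unitmx.
  apply: complement_unitmx; rewrite scaler_eq0 negb_or c0 /=.
  by case: t0 => a; apply: contra => /eqP s0; rewrite (sharp_eq0 gP Ox0).
have dt a x : D x -> differentiable (fun y => t y a) x by move=> /DO; exact: smooth_diff (st a).
have ds a x : D x -> differentiable (fun y => sharp g t y a 0) x by move=> /DO; exact: smooth_diff (ss a).
have pc (f : 'cV[R]_(n + 1) -> R) k x : differentiable f x -> partial k (fun y => c * f y) x = c * partial k f x.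
  by move=> df; rewrite partialM // (partial_cst c) mul0r add0r.
have tauE a : (fun x => tau x a 0) = fun x => c * t x a by apply/funext => x; rewrite mxE.
have xiE a : (fun x => xi x a 0) = fun x => c * sharp g t x a 0 by apply/funext => x; rewrite mxE.
have [] := @splitting R n x0 d g xi tau d0 _ _ _ _ _ _ _ _ _ B uB.
- by move=> a b; exact: smooth_onS DO (sg a b).
- by move=> x /DO; exact: gT.
- by move=> x /DO; exact: gP.
- by move=> a; rewrite xiE; apply: smoothM => //; [exact: smooth_cst|exact: smooth_onS DO (ss a)].
- by move=> a; rewrite tauE; apply: smoothM => //; [exact: smooth_cst|exact: smooth_onS DO (st a)].
- move=> x a b Dx; rewrite !tauE !pc; [|exact: dt|exact: dt]; congr (_ * _).
  exact: (parallel_closed oO gT lct a b (DO _ Dx)).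
- move=> x Dx; rewrite -cN -(ncst x Dx) /dot /norm2 mulr_sumr; apply: eq_bigr => a _.
  by rewrite !mxE; ring.
- move=> x Dx; rewrite /xi -scalemxAr; apply/matrixP => i j; rewrite ord1 !mxE.
  by rewrite (flat_sharp t gP i (DO _ Dx)).
- move=> x a b Dx; have K := parallel_killing oO sg gT gP st lct a b (DO _ Dx).
  move/(congr1 ( *%R c)): K; rewrite mulr0 !mulrDr !mulr_sumr => K; apply: etrans K; congr (_ + _ + _); apply: eq_bigr => l _.
  + by rewrite mxE mulrA.
  + by rewrite xiE (pc _ _ _ (ds l x Dx)) mulrCA.
  + by rewrite xiE (pc _ _ _ (ds l x Dx)) mulrCA.
move=> h [W [U [H [G [A [[B1 B2 B3 B4] C]]]]]].
by exists h, W, U, H, G; split=> //; split=> //; split=> // x /B3; exact: DO.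
Qed.

End LocalSplitting.

(** * Three-forms on a quaternionic line *)

Section Trilinear.
Variables (R : realType) (n : nat) (T : 'I_n -> 'I_n -> 'I_n -> R).

(** Fixing the first argument of a 3-form leaves a matrix, which turns traces
    over frames into traces of matrices. *)
Definition slot_mx (X : 'cV[R]_n) : 'M[R]_n := \matrix_(b, c) \sum_a T a b c * X a 0.

Lemma slot_mxE (X Y Z : 'cV[R]_n) : trilinear T X Y Z = (Y^T *m slot_mx X *m Z) 0 0.
Proof.
rewrite /trilinear exchange_big -mulmxA mxE; apply: eq_bigr => b _.
rewrite exchange_big [X in _ * X]mxE mulr_sumr; apply: eq_bigr => c _; rewrite !mxE mulr_suml mulr_sumr.
by apply: eq_bigr => a _; ring.
Qed.

Lemma slot_mxD X X' : slot_mx (X + X') = slot_mx X + slot_mx X'.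
Proof.
apply/matrixP => b c; rewrite !mxE -big_split; apply: eq_bigr => a _.
by rewrite mxE mulrDr.
Qed.

Lemma slot_mxZ k X : slot_mx (k *: X) = k *: slot_mx X.
Proof.
apply/matrixP => b c; rewrite !mxE mulr_sumr; apply: eq_bigr => a _.
by rewrite mxE mulrCA.
Qed.

Lemma slot_mx0 : slot_mx 0 = 0.
Proof. by rewrite -(scale0r 0) slot_mxZ scale0r. Qed.

Lemma tri1D X X' Y Z : trilinear T (X + X') Y Z = trilinear T X Y Z + trilinear T X' Y Z.
Proof. by rewrite !slot_mxE slot_mxD mulmxDr mulmxDl mxE. Qed.

Lemma tri1Z k X Y Z : trilinear T (k *: X) Y Z = k * trilinear T X Y Z.
Proof. by rewrite !slot_mxE slot_mxZ -scalemxAr -scalemxAl mxE. Qed.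

Lemma tri2D X Y Y' Z : trilinear T X (Y + Y') Z = trilinear T X Y Z + trilinear T X Y' Z.
Proof. by rewrite !slot_mxE linearD !mulmxDl mxE. Qed.

Lemma tri2Z k X Y Z : trilinear T X (k *: Y) Z = k * trilinear T X Y Z.
Proof. by rewrite !slot_mxE linearZ -!scalemxAl mxE. Qed.

Lemma tri3D X Y Z Z' : trilinear T X Y (Z + Z') = trilinear T X Y Z + trilinear T X Y Z'.
Proof. by rewrite !slot_mxE mulmxDr mxE. Qed.

Lemma tri3Z k X Y Z : trilinear T X Y (k *: Z) = k * trilinear T X Y Z.
Proof. by rewrite !slot_mxE -scalemxAr mxE. Qed.

Lemma tri1N X Y Z : trilinear T (- X) Y Z = - trilinear T X Y Z.
Proof. by rewrite -scaleN1r tri1Z mulN1r. Qed.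

Lemma tri2N X Y Z : trilinear T X (- Y) Z = - trilinear T X Y Z.
Proof. by rewrite -scaleN1r tri2Z mulN1r. Qed.

Lemma tri3N X Y Z : trilinear T X Y (- Z) = - trilinear T X Y Z.
Proof. by rewrite -scaleN1r tri3Z mulN1r. Qed.

Definition triE := (tri1D, tri2D, tri3D, tri1Z, tri2Z, tri3Z, tri1N, tri2N, tri3N).

Lemma tri_delta a b c : trilinear T (delta_mx a 0) (delta_mx b 0) (delta_mx c 0) = T a b c.
Proof.
rewrite slot_mxE -mulmxA -colE mxE (bigD1 b) //= big1 ?addr0.
  rewrite !mxE !eqxx mul1r (bigD1 a) //= big1 ?addr0 ?mxE ?eqxx ?mulr1 // => k ka.
  by rewrite mxE (negPf ka) mulr0.
by move=> k kb; rewrite !mxE (negPf kb) mul0r.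
Qed.

Definition skew3 := forall a b c, T a b c = - T b a c /\ T a b c = - T a c b.

Hypothesis sT : skew3.

Lemma tri_skew12 X Y Z : trilinear T X Y Z = - trilinear T Y X Z.
Proof.
rewrite /trilinear exchange_big -sumrN; apply: eq_bigr => b _; rewrite -sumrN.
apply: eq_bigr => a _; rewrite -sumrN; apply: eq_bigr => c _.
by rewrite (sT a b c).1; ring.
Qed.

Lemma tri_skew23 X Y Z : trilinear T X Y Z = - trilinear T X Z Y.
Proof.
rewrite /trilinear -sumrN; apply: eq_bigr => a _; rewrite exchange_big -sumrN.
apply: eq_bigr => b _; rewrite -sumrN; apply: eq_bigr => c _.
by rewrite (sT a c b).2; ring.
Qed.

Lemma tri_diag12 X Z : trilinear T X X Z = 0.
Proof. have := tri_skew12 X X Z; lra. Qed.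

Lemma tri_diag23 X Z : trilinear T X Z Z = 0.
Proof. have := tri_skew23 X Z Z; lra. Qed.

Lemma tri_diag13 X Z : trilinear T X Z X = 0.
Proof. by rewrite tri_skew12 tri_diag23 oppr0. Qed.

End Trilinear.

Section QuaternionicTorsion.
Variables (R : realType) (g : 'M[R]_4) (T : 'I_4 -> 'I_4 -> 'I_4 -> R) (J : 'I_3 -> 'M[R]_4).
Hypothesis gT : g^T = g.
Hypothesis gP : posdef g.
Hypothesis sT : skew3 T.
Hypothesis qJ : quaternion_triple J.
Hypothesis hJ : forall al, (J al)^T *m g *m J al = g.

Let J0 := J 0. Let J1 := J 1. Let J2 := J 2%:R.
Local Notation tri := (trilinear T).

Lemma quaternion_table :
  [/\ J0 *m J0 = - 1%:M, J1 *m J1 = - 1%:M & J2 *m J2 = - 1%:M] /\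
  [/\ J0 *m J1 = J2, J1 *m J0 = - J2, J1 *m J2 = J0, J2 *m J1 = - J0 &
      J2 *m J0 = J1 /\ J0 *m J2 = - J1].
Proof.
have [sq E01 E10] := qJ; rewrite -/J0 -/J1 -/J2 in E01 E10.
have s0 := sq 0; have s1 := sq 1; have s2 := sq 2%:R; rewrite -/J0 in s0; rewrite -/J1 in s1; rewrite -/J2 in s2.
have E21 : J2 *m J1 = - J0 by rewrite -E01 -mulmxA s1 mulmxN mulmx1.
have E02 : J0 *m J2 = - J1 by rewrite -E01 mulmxA s0 mulNmx mul1mx.
split; [by split|split=> //; last split=> //].
- by rewrite -[J2]opprK -E10 mulmxN mulmxA s1 mulNmx mul1mx opprK.
- by rewrite -[J2]opprK -E10 mulNmx -mulmxA s0 mulmxN mulmx1 opprK.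
Qed.

Definition gdot (X Y : 'cV[R]_4) : R := (X^T *m g *m Y) 0 0.

Lemma gdotC X Y : gdot X Y = gdot Y X.
Proof.
have -> : gdot X Y = ((X^T *m g *m Y)^T) 0 0 by rewrite mxE.
by rewrite !trmx_mul trmxK gT mulmxA.
Qed.

Lemma gdotDl X Y Z : gdot (X + Y) Z = gdot X Z + gdot Y Z.
Proof. by rewrite /gdot linearD !mulmxDl mxE. Qed.

Lemma gdotZl k X Z : gdot (k *: X) Z = k * gdot X Z.
Proof. by rewrite /gdot linearZ -!scalemxAl mxE. Qed.

Lemma gdotNl X Z : gdot (- X) Z = - gdot X Z.
Proof. by rewrite -scaleN1r gdotZl mulN1r. Qed.

Lemma gdotDr X Y Z : gdot Z (X + Y) = gdot Z X + gdot Z Y.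
Proof. by rewrite gdotC gdotDl !(gdotC Z). Qed.

Lemma gdotNr X Z : gdot Z (- X) = - gdot Z X.
Proof. by rewrite gdotC gdotNl (gdotC Z). Qed.

Lemma gdotJ al X Y : gdot (J al *m X) (J al *m Y) = gdot X Y.
Proof. by rewrite /gdot trmx_mul -[in RHS](hJ al) !mulmxA. Qed.

Lemma gdotJX al X : gdot X (J al *m X) = 0.
Proof.
have [sq _ _] := qJ; have := gdotJ al X (J al *m X).
rewrite mulmxA sq mulNmx mul1mx gdotNr (gdotC (J al *m X)); lra.
Qed.

Definition frame (X : 'cV[R]_4) (i : 'I_4) : 'cV[R]_4 :=
  nth 0 [:: X; J0 *m X; J1 *m X; J2 *m X] i.
Definition frame_mx X : 'M[R]_4 := \matrix_(a, i) frame X i a 0.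

(** A hermitian complex structure is an isometry and sends X to a vector
    orthogonal to X; applied to the products of the J, this makes the frame
    orthogonal. *)
Lemma frame_gdot X i j : gdot (frame X i) (frame X j) = gdot X X * (i == j)%:R.
Proof.
have [[s0 s1 s2] [E01 E10 E12 E21 [E20 E02]]] := quaternion_table.
have n0 := gdotJX 0 X; have n1 := gdotJX 1 X; have n2 := gdotJX 2%:R X.
have p0 := gdotJ 0 X X; have p1 := gdotJ 1 X X; have p2 := gdotJ 2%:R X X.
have c01 := gdotJ 0 X (J2 *m X); have c02 := gdotJ 0 X (J1 *m X); have c12 := gdotJ 1 X (J0 *m X).
rewrite -/J0 -/J1 -/J2 in n0 n1 n2 p0 p1 p2 c01 c02 c12.
rewrite !mulmxA ?E01 ?E02 ?E10 ?mulNmx ?gdotNr ?n0 ?n1 ?n2 in c01 c02 c12.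
have r0 := gdotC (J0 *m X) X; have r1 := gdotC (J1 *m X) X; have r2 := gdotC (J2 *m X) X.
have r01 := gdotC (J1 *m X) (J0 *m X); have r02 := gdotC (J2 *m X) (J0 *m X); have r12 := gdotC (J2 *m X) (J1 *m X).
by case: i => [[|[|[|[|//]]]] i4]; case: j => [[|[|[|[|//]]]] j4];
   rewrite /frame /= ?mulr1 ?mulr0; lra.
Qed.

Lemma frame_mxP X : (frame_mx X)^T *m g *m frame_mx X = (gdot X X)%:M.
Proof.
apply/matrixP => i j; rewrite [RHS]mxE -mulr_natr -frame_gdot /gdot.
rewrite -!mulmxA !mxE; apply: eq_bigr => a _; rewrite !mxE; congr (_ * _).
by apply: eq_bigr => b _; rewrite !mxE.
Qed.

Lemma gdot_gt0 X : X != 0 -> 0 < gdot X X. Proof. exact: gP. Qed.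

Lemma frame_mx_unit X : X != 0 -> frame_mx X \in unitmx.
Proof.
move=> /gdot_gt0 X0; apply: contraT => nu.
(* The Gram matrix of the frame is invertible, hence so is the frame. *)
have : (gdot X X)%:M \in (unitmx : pred 'M[R]_4) by rewrite unitmxE det_scalar unitfE expf_neq0 // gt_eqF.
by rewrite -frame_mxP unitmx_mul (negPf nu) andbF.
Qed.

Lemma frame_expand (X Y : 'cV[R]_4) : X != 0 -> exists y0 y1 y2 y3 : R,
  Y = y0 *: X + y1 *: (J0 *m X) + y2 *: (J1 *m X) + y3 *: (J2 *m X).
Proof.
move=> X0; pose y := invmx (frame_mx X) *m Y; exists (y (inord 0) 0), (y (inord 1) 0), (y (inord 2) 0), (y (inord 3) 0).
have -> : Y = frame_mx X *m y by rewrite /y mulmxA mulmxV ?mul1mx ?frame_mx_unit.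
apply/matrixP => a j; rewrite ord1 mxE !big_ord_recl big_ord0 addr0 /frame ![frame_mx X _ _]mxE /frame /=.
clearbody y; move: (J0 *m X) (J1 *m X) (J2 *m X) => X0' X1' X2'; rewrite !addrA ![in RHS]mxE.
by congr (_ + _ + _ + _); rewrite mulrC; congr (y _ _ * _); apply: val_inj; rewrite /= inordK.
Qed.

Definition comb (c0 c1 c2 : R) := c0 *: J0 + c1 *: J1 + c2 *: J2.

(** A maps each vector of the frame to a combination of the three others, and
    skewness leaves only the component T (J0 X, J1 X, J2 X). *)
Lemma frame_trace c0 c1 c2 X : let A := comb c0 c1 c2 in
  \sum_i tri (A *m X) (frame X i) (A *m frame X i) =
  2 * (c0 ^+ 2 + c1 ^+ 2 + c2 ^+ 2) * tri (J0 *m X) (J1 *m X) (J2 *m X).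
Proof.
have [[s0 s1 s2] [E01 E10 E12 E21 [E20 E02]]] := quaternion_table.
move=> A; rewrite !big_ord_recl big_ord0 addr0 /frame /= /A /comb !mulmxDl -!scalemxAl !mulmxA.
rewrite s0 s1 s2 E01 E10 E12 E21 E20 E02 !mulNmx !mul1mx.
set X0 := J0 *m X; set X1 := J1 *m X; set X2 := J2 *m X.
rewrite !triE ?(tri_diag12 sT, tri_diag23 sT, tri_diag13 sT).
rewrite (tri_skew23 sT X0 X2 X1) (tri_skew12 sT X1 X0 X2) (tri_skew23 sT X1 X2 X0) (tri_skew12 sT X1 X0 X2).
rewrite (tri_skew12 sT X2 X0 X1) (tri_skew23 sT X0 X2 X1) (tri_skew12 sT X2 X1 X0) (tri_skew23 sT X1 X2 X0) (tri_skew12 sT X1 X0 X2).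
rewrite !(tri_skew12 sT _ X) (tri_skew23 sT X0 X1 X) (tri_skew23 sT X1 X0 X) (tri_skew23 sT X2 X0 X) (tri_skew23 sT X2 X1 X).
rewrite (tri_skew23 sT X0 X2 X) (tri_skew23 sT X1 X2 X) !(tri_skew12 sT _ X).
rewrite (tri_skew23 sT X X1 X0) (tri_skew23 sT X X2 X0) (tri_skew23 sT X X2 X1); ring.
Qed.

(** For A a complex structure of Q, this is the value of the torsion 1-form at
    X. The trace over an orthonormal frame is written with the inverse metric,
    which makes its linearity in X and its smoothness visible. *)
Definition torsion_trace (A : 'M[R]_4) (X : 'cV[R]_4) : R :=
  2^-1 * \tr (invmx g *m (slot_mx T (A *m X) *m A)).

(** A frame P of constant length satisfies P P^T = c g^-1. *)
Lemma trace_frame (N P : 'M[R]_4) (c : R) : c != 0 -> P^T *m g *m P = c%:M ->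
  \tr (P^T *m N *m P) = c * \tr (invmx g *m N).
Proof.
move=> c0 HP; have ug := posdef_unit gP.
have uP : P \in unitmx.
  have : c%:M \in (unitmx : pred 'M[R]_4) by rewrite unitmxE det_scalar unitfE expf_neq0.
  by rewrite -HP unitmx_mul => /andP[].
have PP : P *m P^T = c *: invmx g.
  have : P *m (P^T *m g *m P) *m invmx P = c%:M.
    by rewrite HP mul_mx_scalar -scalemxAl mulmxV // scalemx1.
  rewrite -!mulmxA mulmxV // mulmx1 mulmxA => E.
  by rewrite -[LHS]mulmx1 -(mulmxV ug) mulmxA E mul_scalar_mx.
by rewrite -mulmxA mxtrace_mulC -mulmxA PP -scalemxAr linearZ /= [in RHS]mxtrace_mulC.
Qed.

Lemma torsion_trace_frame A X (P : 'M[R]_4) (c : R) : c != 0 -> P^T *m g *m P = c%:M ->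
  \sum_i tri (A *m X) (col i P) (A *m col i P) = 2 * (c * torsion_trace A X).
Proof.
move=> c0 HP; have -> : 2 * (c * torsion_trace A X) = c * \tr (invmx g *m (slot_mx T (A *m X) *m A)).
  by rewrite /torsion_trace; field.
rewrite -(trace_frame _ c0 HP); apply: eq_bigr => i _; rewrite slot_mxE !mulmxA.
rewrite tr_col -!row_mul; move: (P^T *m _ *m _) => N.
by rewrite !mxE; apply: eq_bigr => k _; rewrite !mxE.
Qed.

(** The trace can be computed in any orthogonal frame of constant length, in
    particular in the one generated by X. *)
Lemma torsion_traceE c0 c1 c2 X : gdot X X * torsion_trace (comb c0 c1 c2) X =
  (c0 ^+ 2 + c1 ^+ 2 + c2 ^+ 2) * tri (J0 *m X) (J1 *m X) (J2 *m X).
Proof.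
have [->|X0] := eqVneq X 0.
  by rewrite !mulmx0 /gdot mulmx0 mxE mul0r !slot_mxE mulmx0 mxE mulr0.
have := torsion_trace_frame (comb c0 c1 c2) X (lt0r_neq0 (gdot_gt0 X0)) (frame_mxP X).
rewrite (eq_bigr (fun i => tri (comb c0 c1 c2 *m X) (frame X i) (comb c0 c1 c2 *m frame X i))).
  by rewrite frame_trace; lra.
by move=> i _; rewrite (_ : col i _ = frame X i) //; apply/matrixP => a j; rewrite ord1 !mxE.
Qed.

Lemma torsion_trace_linear A (X : 'cV[R]_4) : \sum_a torsion_trace A (delta_mx a 0) * X a 0 = torsion_trace A X.
Proof.
rewrite /torsion_trace; under eq_bigr => a _ do rewrite -mulrA.
rewrite -mulr_sumr; congr (_ * _).
have -> : slot_mx T (A *m X) = \sum_a X a 0 *: slot_mx T (A *m delta_mx a 0).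
  apply/matrixP => b c; rewrite summxE !mxE.
  under [RHS]eq_bigr => a _ do rewrite !mxE mulr_sumr.
  rewrite exchange_big; apply: eq_bigr => p _; rewrite mxE mulr_sumr; apply: eq_bigr => a _.
  by rewrite -colE mxE; ring.
rewrite mulmx_suml mulmx_sumr raddf_sum /=; apply: eq_bigr => a _.
by rewrite -scalemxAl -scalemxAr linearZ /= mulrC.
Qed.

Section DualForm.
Variable t : 'I_4 -> R.
Hypothesis tE : forall X, gdot X X * \sum_a t a * X a 0 = tri (J0 *m X) (J1 *m X) (J2 *m X).

(** The identity tE is used at X and at each J X, whose frames are signed
    permutations of the frame of X. *)
Lemma dual_frame X : [/\ gdot X X * (\sum_a t a * X a 0) = tri (J0 *m X) (J1 *m X) (J2 *m X),
  gdot X X * (\sum_a t a * (J0 *m X) a 0) = - tri X (J1 *m X) (J2 *m X),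
  gdot X X * (\sum_a t a * (J1 *m X) a 0) = tri X (J0 *m X) (J2 *m X) &
  gdot X X * (\sum_a t a * (J2 *m X) a 0) = - tri X (J0 *m X) (J1 *m X)].
Proof.
have [[s0 s1 s2] [E01 E10 E12 E21 [E20 E02]]] := quaternion_table.
split; first exact: tE.
- rewrite -(gdotJ 0 X X) tE !mulmxA -/J0 s0 E10 E20 !mulNmx mul1mx !triE.
  by rewrite (tri_skew23 sT X); ring.
- rewrite -(gdotJ 1 X X) tE !mulmxA -/J1 s1 E01 E21 !mulNmx mul1mx !triE.
  by rewrite (tri_skew12 sT _ X) (tri_skew23 sT X); ring.
- rewrite -(gdotJ 2%:R X X) tE !mulmxA -/J2 s2 E02 E12 !mulNmx mul1mx !triE.
  by rewrite (tri_skew23 sT (J1 *m X)) (tri_skew12 sT _ X) (tri_skew23 sT X); ring.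
Qed.

(** By dual_frame the four components of T in a frame generated by one vector
    are values of t. *)
Lemma dual_eq0 : (forall a, t a = 0) -> forall X Y Z, tri X Y Z = 0.
Proof.
move=> t0 X Y Z; have [->|X0] := eqVneq X 0.
  by rewrite slot_mxE slot_mx0 mulmx0 mul0mx mxE.
have tX (V : 'cV[R]_4) : \sum_a t a * V a 0 = 0 by rewrite big1 // => a _; rewrite t0 mul0r.
have [_ e1 e2 e3] := dual_frame X; rewrite !tX !mulr0 in e1 e2 e3.
have [y0 [y1 [y2 [y3 ->]]]] := frame_expand Y X0; have [z0 [z1 [z2 [z3 ->]]]] := frame_expand Z X0.
rewrite !triE ?(tri_diag12 sT, tri_diag23 sT, tri_diag13 sT).
rewrite (tri_skew23 sT X (J1 *m X) (J0 *m X)) (tri_skew23 sT X (J2 *m X) (J0 *m X)) (tri_skew23 sT X (J2 *m X) (J1 *m X)).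
move: (tri X (J0 *m X) (J1 *m X)) (tri X (J0 *m X) (J2 *m X)) (tri X (J1 *m X) (J2 *m X)) e1 e2 e3 => a b c e1 e2 e3.
have -> : a = 0 by lra.
have -> : b = 0 by lra.
have -> : c = 0 by lra.
by ring.
Qed.

(** The form t vanishes on J u for u its dual vector, so by dual_frame all
    components of T that involve u vanish. *)
Lemma dual_kernel Y Z : let u := invmx g *m \col_a t a in tri u Y Z = 0.
Proof.
move=> u; have [->|u0] := eqVneq u 0.
  by rewrite slot_mxE slot_mx0 mulmx0 mul0mx mxE.
have tu (V : 'cV[R]_4) : \sum_a t a * V a 0 = gdot u V.
  rewrite gdotC /gdot /u -!mulmxA [g *m (_ *m _)]mulmxA mulmxV ?posdef_unit // mul1mx mxE.
  by apply: eq_bigr => a _; rewrite !mxE mulrC.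
have [_ e1 e2 e3] := dual_frame u; rewrite !tu ?(gdotJX 0) ?(gdotJX 1) ?(gdotJX 2%:R) !mulr0 in e1 e2 e3.
have [y0 [y1 [y2 [y3 ->]]]] := frame_expand Y u0; have [z0 [z1 [z2 [z3 ->]]]] := frame_expand Z u0.
rewrite !triE ?(tri_diag12 sT, tri_diag23 sT, tri_diag13 sT).
rewrite (tri_skew23 sT u (J1 *m u) (J0 *m u)) (tri_skew23 sT u (J2 *m u) (J0 *m u)) (tri_skew23 sT u (J2 *m u) (J1 *m u)).
move: (tri u (J0 *m u) (J1 *m u)) (tri u (J0 *m u) (J2 *m u)) (tri u (J1 *m u) (J2 *m u)) e1 e2 e3 => a b c e1 e2 e3.
have -> : a = 0 by lra.
have -> : b = 0 by lra.
have -> : c = 0 by lra.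
by ring.
Qed.

(** Polarization of the cubic identity tE: the combination F (X + Y) - F (X - Y)
    - 2 F (Y) isolates the part linear in Y. *)
Lemma dual_polar (X Y : 'cV[R]_4) : gdot X X * (\sum_a t a * Y a 0) + 2 * gdot X Y * (\sum_a t a * X a 0) =
  tri (J0 *m Y) (J1 *m X) (J2 *m X) + tri (J0 *m X) (J1 *m Y) (J2 *m X) + tri (J0 *m X) (J1 *m X) (J2 *m Y).
Proof.
have e1 := tE (X + Y); have e2 := tE (X - Y); have e3 := tE Y.
have lD (U V : 'cV[R]_4) : \sum_a t a * (U + V) a 0 = \sum_a t a * U a 0 + \sum_a t a * V a 0.
  by rewrite -big_split; apply: eq_bigr => a _; rewrite mxE mulrDr.
have lN (U : 'cV[R]_4) : \sum_a t a * (- U) a 0 = - \sum_a t a * U a 0.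
  by rewrite -sumrN; apply: eq_bigr => a _; rewrite mxE mulrN.
rewrite !lD ?lN !mulmxDr ?mulmxN !triE !(gdotDl, gdotDr, gdotNl, gdotNr) (gdotC Y X) in e1 e2.
move: (\sum_a _) (\sum_a _) (gdot X X) (gdot X Y) (gdot Y Y) e1 e2 e3 => s s' xx xy yy.
lra.
Qed.

End DualForm.
End QuaternionicTorsion.

(** * Metric connections with skew torsion *)

Section SkewDimensionFour.
Variable R : realType.

(** The components of a 3-form in dimension four, from those with indices 012,
    013, 023 and 123. *)
Definition skew4 (p q r s : R) (a b c : nat) : R :=
  match a, b, c with
  | 0, 1, 2 => p | 1, 2, 0 => p | 2, 0, 1 => p | 0, 2, 1 => - p | 2, 1, 0 => - p | 1, 0, 2 => - p
  | 0, 1, 3 => q | 1, 3, 0 => q | 3, 0, 1 => q | 0, 3, 1 => - q | 3, 1, 0 => - q | 1, 0, 3 => - q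
  | 0, 2, 3 => r | 2, 3, 0 => r | 3, 0, 2 => r | 0, 3, 2 => - r | 3, 2, 0 => - r | 2, 0, 3 => - r
  | 1, 2, 3 => s | 2, 3, 1 => s | 3, 1, 2 => s | 1, 3, 2 => - s | 3, 2, 1 => - s | 2, 1, 3 => - s
  | _, _, _ => 0%R
  end%N.

Lemma skew4E (T : 'I_4 -> 'I_4 -> 'I_4 -> R) : skew3 T ->
  exists p q r s, forall a b c, T a b c = skew4 p q r s a b c.
Proof.
move=> sT; pose t (a b c : nat) := T (inord a) (inord b) (inord c).
have s1 a b c : t a b c = - t b a c by exact: (sT _ _ _).1.
have s2 a b c : t a b c = - t a c b by exact: (sT _ _ _).2.
exists (t 0 1 2)%N, (t 0 1 3)%N, (t 0 2 3)%N, (t 1 2 3)%N => a b c.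
have -> : T a b c = t a b c by rewrite /t !inord_val.
have := s1 a b c; have := s1 a c b; have := s1 b c a; have := s2 a b c; have := s2 b a c; have := s2 c a b.
move: (nat_of_ord a) (nat_of_ord b) (nat_of_ord c) (ltn_ord a) (ltn_ord b) (ltn_ord c) => {}a {}b {}c.
by case: a => [|[|[|[|//]]]] _; case: b => [|[|[|[|//]]]] _; case: c => [|[|[|[|//]]]] _ /=; lra.
Qed.

Lemma skew3_eq0 (T : 'I_4 -> 'I_4 -> 'I_4 -> R) : skew3 T ->
  (forall a b c : 'I_4, (a < b < c)%N -> T a b c = 0) -> forall a b c, T a b c = 0.
Proof.
move=> sT T0; have [p [q [r [s E]]]] := skew4E sT.
pose o (k : nat) : (k < 4)%N -> 'I_4 := @Ordinal 4 k.
have p0 : p = 0 by rewrite -[p](E (@o 0%N isT) (@o 1%N isT) (@o 2%N isT)) T0.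
have q0 : q = 0 by rewrite -[q](E (@o 0%N isT) (@o 1%N isT) (@o 3%N isT)) T0.
have r0 : r = 0 by rewrite -[r](E (@o 0%N isT) (@o 2%N isT) (@o 3%N isT)) T0.
have s0 : s = 0 by rewrite -[s](E (@o 1%N isT) (@o 2%N isT) (@o 3%N isT)) T0.
move=> a b c; rewrite E p0 q0 r0 s0.
move: (nat_of_ord a) (nat_of_ord b) (nat_of_ord c) (ltn_ord a) (ltn_ord b) (ltn_ord c) => {}a {}b {}c.
by case: a => [|[|[|[|//]]]] _; case: b => [|[|[|[|//]]]] _; case: c => [|[|[|[|//]]]] _ /=; rewrite ?oppr0.
Qed.

Lemma sum4 (F : 'I_4 -> R) : \sum_i F i =
  F (@Ordinal 4 0 isT) + F (@Ordinal 4 1 isT) + F (@Ordinal 4 2 isT) + F (@Ordinal 4 3 isT).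
Proof.
rewrite !big_ord_recl big_ord0 addr0 !addrA.
by congr (_ + _ + _ + _); congr F; exact: val_inj.
Qed.

(** With K the inverse metric, this is the sum over an orthonormal frame e of
    i_e T ^ i_e T. *)
Definition wedge_square (K : 'M[R]_4) (T : 'I_4 -> 'I_4 -> 'I_4 -> R) a b c d : R :=
  \sum_m \sum_l K l m * (T a b l * T m c d + T a c l * T b m d + T a d l * T b c m
                         - T b c l * T a m d - T b d l * T a c m + T c d l * T a b m).

(** One has i_e T ^ i_e T = i_e (T ^ i_e T), and 5-forms vanish in dimension
    four. By skewness in b, c, d it is enough to compute the components with b <
    c < d. *)
Lemma wedge_square_eq0 K T : K^T = K -> skew3 T -> forall a b c d, wedge_square K T a b c d = 0.
Proof.
move=> KT sT a; apply: skew3_eq0 => [b c d|b c d bcd].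
  split; rewrite /wedge_square -sumrN; apply: eq_bigr => m _; rewrite -sumrN; apply: eq_bigr => l _.
    by rewrite (sT m b d).1 (sT c m d).1 (sT c b m).1 (sT c b l).1; ring.
  by rewrite (sT m d c).2 (sT b m c).2 (sT b d m).2 (sT a m c).2 (sT a d m).2 (sT d c l).1; ring.
have [p [q [r [s E]]]] := skew4E sT.
pose k (i j : nat) := K (inord i) (inord j).
have kC i j : k i j = k j i by rewrite /k -[in LHS]KT mxE.
have kE i j : K i j = k i j by rewrite /k !inord_val.
rewrite /wedge_square.
under eq_bigr => m _ do (under eq_bigr => l _ do rewrite kE !E; rewrite sum4).
rewrite sum4 /=; rewrite (kC 1 0)%N (kC 2 0)%N (kC 3 0)%N (kC 2 1)%N (kC 3 1)%N (kC 3 2)%N.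
move: (nat_of_ord a) (nat_of_ord b) (nat_of_ord c) (nat_of_ord d) bcd (ltn_ord a) (ltn_ord b) (ltn_ord c) (ltn_ord d).
move=> {}a {}b {}c {}d.
by case: b => [|[|[|[|//]]]]; case: c => [|[|[|[|//]]]]; case: d => [|[|[|[|//]]]] //= _;
  case: a => [|[|[|[|//]]]] _ _ _ _ /=; ring.
Qed.

End SkewDimensionFour.

Section MetricConnection.
Variables (R : realType) (n : nat) (Om : set 'cV[R]_n).
Variables (g : 'cV[R]_n -> 'M[R]_n) (G : christoffel R n).
Hypothesis oO : open Om.
Hypothesis sg : forall a b, smooth_on Om (fun x => g x a b).
Hypothesis gT : forall x, Om x -> (g x)^T = g x.
Hypothesis gP : forall x, Om x -> posdef (g x).
Hypothesis sG : forall m a b, smooth_on Om (fun x => G x m a b).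
Hypothesis mG : forall x, Om x -> forall k a b, nabla_metric G g x k a b = 0.
Hypothesis kT : forall x, Om x -> skew3 (torsion g G x).

Definition lowered x a b c := \sum_m G x m a b * g x m c.

Lemma torsion_lowered x a b c : torsion g G x a b c = lowered x a b c - lowered x b a c.
Proof. by rewrite /torsion /lowered -sumrB; apply: eq_bigr => m _; rewrite mulrBl. Qed.

Lemma partial_metric x k a b : Om x ->
  partial k (fun y => g y a b) x = lowered x k a b + lowered x k b a.
Proof.
move=> Ox; have := mG Ox k a b; rewrite /nabla_metric /lowered => E.
have -> : \sum_m G x m k b * g x m a = \sum_m G x m k b * g x a m.
  by apply: eq_bigr => m _; rewrite (metric_symE gT m a Ox).
lra.
Qed.

Lemma torsion_smooth a b c : smooth_on Om (fun x => torsion g G x a b c).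
Proof. by apply: smooth_sum => // m; apply: smoothM => //; exact: smoothB. Qed.

Lemma invmx_metricC x l m : Om x -> invmx (g x) l m = invmx (g x) m l.
Proof. by move=> Ox; rewrite -[in LHS](gT Ox) -trmx_inv mxE. Qed.

Lemma raise_metric x (f : 'I_n -> R) m : Om x ->
  \sum_l invmx (g x) m l * \sum_p f p * g x p l = f m.
Proof.
move=> Ox; transitivity (\sum_p f p * (g x *m invmx (g x)) p m).
  under eq_bigr => l _ do rewrite mulr_sumr.
  rewrite exchange_big; apply: eq_bigr => p _; rewrite mxE mulr_sumr; apply: eq_bigr => l _.
  by rewrite (invmx_metricC m l Ox); ring.
rewrite mulmxV ?(posdef_unit (gP Ox)) // (bigD1 m) //= big1 ?addr0 ?mxE ?eqxx ?mulr1 // => p pm.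
by rewrite mxE (negPf pm) mulr0.
Qed.

Lemma torsion_raised x m a b : Om x ->
  G x m a b - G x m b a = \sum_l invmx (g x) m l * torsion g G x a b l.
Proof. by move=> Ox; rewrite -(raise_metric (fun m => G x m a b - G x m b a) m Ox). Qed.

(** The Koszul formula with the derivatives of the metric replaced by the
    coefficients of a metric connection: the skew torsion contributes one half
    of T. *)
Lemma levi_civita_torsion x m a b : Om x ->
  levi_civita g x m a b = G x m a b - 2^-1 * \sum_l invmx (g x) m l * torsion g G x a b l.
Proof.
move=> Ox; rewrite /levi_civita -(raise_metric (fun m => G x m a b) m Ox) mulr_sumr mulr_sumr -sumrB.
apply: eq_bigr => l _; rewrite -/(lowered x a b l) !partial_metric //.
have := kT Ox; rewrite /skew3 => sk.
have e1 := (sk a l b).2; have e2 := (sk b l a).2; have e3 := (sk a b l).1.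
rewrite !torsion_lowered in e1 e2 e3 *.
have -> : lowered x a b l + lowered x a l b + (lowered x b a l + lowered x b l a) -
    (lowered x l a b + lowered x l b a) = 2 * lowered x a b l - (lowered x a b l - lowered x b a l) by lra.
by field.
Qed.

Hypothesis pT : forall x, Om x -> forall k a b c, nabla_form3 G (torsion g G) x k a b c = 0.

Lemma partial_torsion x k a b c : Om x -> partial k (fun y => torsion g G y a b c) x =
  \sum_m G x m k a * torsion g G x m b c + \sum_m G x m k b * torsion g G x a m c
  + \sum_m G x m k c * torsion g G x a b m.
Proof. by move=> Ox; have := pT Ox k a b c; rewrite /nabla_form3; lra. Qed.

End MetricConnection.

Section ClosedTorsion.
Variables (R : realType) (Om : set 'cV[R]_4).
Variables (g : 'cV[R]_4 -> 'M[R]_4) (G : christoffel R 4).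
Hypothesis gT : forall x, Om x -> (g x)^T = g x.
Hypothesis gP : forall x, Om x -> posdef (g x).
Hypothesis kT : forall x, Om x -> skew3 (torsion g G x).
Hypothesis pT : forall x, Om x -> forall k a b c, nabla_form3 G (torsion g G) x k a b c = 0.

(** The exterior derivative of a parallel form only consists of torsion terms,
    which are here quadratic in T. *)
Lemma parallel_torsion_closed x a b c d : Om x -> ext_deriv3 (torsion g G) x a b c d = 0.
Proof.
move=> Ox; rewrite -(@wedge_square_eq0 R (invmx (g x)) (torsion g G x) _ (kT Ox) a b c d); last first.
  by rewrite trmx_inv gT.
rewrite /ext_deriv3 !(partial_torsion pT _ _ _ _ Ox).
have sk := kT Ox; set T := torsion g G x in sk *.
transitivity (\sum_m ((G x m a b - G x m b a) * T m c d + (G x m a c - G x m c a) * T b m d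
   + (G x m a d - G x m d a) * T b c m - (G x m b c - G x m c b) * T a m d
   - (G x m b d - G x m d b) * T a c m + (G x m c d - G x m d c) * T a b m)).
  rewrite -!big_split -!sumrB -!big_split -!sumrB /=; apply: eq_bigr => m _.
  by rewrite (sk m b d).1 (sk m b c).1 (sk b m c).2 (sk a m c).2; ring.
rewrite /wedge_square; apply: eq_bigr => m _.
rewrite !(torsion_raised G gT gP m _ _ Ox) -/T !mulr_suml -!big_split -!sumrB -!big_split /=.
apply: eq_bigr => l _.
by rewrite (invmx_metricC gT l m Ox); ring.
Qed.

End ClosedTorsion.

(** * The torsion one-form is parallel *)

Section TrilinearPullback.
Variables (R : realType) (n : nat).
Implicit Types (T : 'I_n -> 'I_n -> 'I_n -> R) (C : 'M[R]_n) (X Y Z : 'cV[R]_n).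

Lemma tri1M T C X Y Z :
  trilinear T (C *m X) Y Z = trilinear (fun a b c => \sum_m C m a * T m b c) X Y Z.
Proof.
rewrite /trilinear.
under eq_bigr => a _ do (under eq_bigr => b _ do
  (under eq_bigr => c _ do rewrite mxE mulr_sumr !mulr_suml; rewrite exchange_big); rewrite exchange_big).
rewrite exchange_big; apply: eq_bigr => m _; rewrite exchange_big; apply: eq_bigr => b _.
rewrite exchange_big; apply: eq_bigr => c _; rewrite !mulr_suml; apply: eq_bigr => a _; ring.
Qed.

Lemma tri2M T C X Y Z :
  trilinear T X (C *m Y) Z = trilinear (fun a b c => \sum_m C m b * T a m c) X Y Z.
Proof.
rewrite /trilinear; apply: eq_bigr => a _.
under eq_bigr => b _ do (under eq_bigr => c _ do rewrite mxE mulr_sumr !mulr_suml; rewrite exchange_big).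
rewrite exchange_big; apply: eq_bigr => m _.
rewrite exchange_big; apply: eq_bigr => c _; rewrite !mulr_suml; apply: eq_bigr => b _; ring.
Qed.

Lemma tri3M T C X Y Z :
  trilinear T X Y (C *m Z) = trilinear (fun a b c => \sum_m C m c * T a b m) X Y Z.
Proof.
rewrite /trilinear; apply: eq_bigr => a _; apply: eq_bigr => b _.
under eq_bigr => c _ do rewrite mxE mulr_sumr.
rewrite exchange_big; apply: eq_bigr => m _; rewrite !mulr_suml; apply: eq_bigr => c _; ring.
Qed.

Lemma triTD T T' X Y Z : trilinear (fun a b c => T a b c + T' a b c) X Y Z =
  trilinear T X Y Z + trilinear T' X Y Z.
Proof.
rewrite /trilinear -big_split; apply: eq_bigr => a _; rewrite -big_split; apply: eq_bigr => b _.
by rewrite -big_split; apply: eq_bigr => c _; rewrite /= !mulrDl.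
Qed.

Lemma triT_eq T T' X Y Z : (forall a b c, T a b c = T' a b c) ->
  trilinear T X Y Z = trilinear T' X Y Z.
Proof. by move=> E; congr trilinear; apply/funext => a; apply/funext => b; apply/funext => c. Qed.

End TrilinearPullback.

Section MatrixDerivative.
Variables (R : realType) (n : nat).
Implicit Types x : 'cV[R]_n.

Definition dmx p q k (A : 'cV[R]_n -> 'M[R]_(p, q)) x : 'M[R]_(p, q) :=
  \matrix_(i, j) partial k (fun y => A y i j) x.

Lemma dmx_mul p q r k (A : 'cV[R]_n -> 'M[R]_(p, q)) (B : 'cV[R]_n -> 'M[R]_(q, r)) x :
  (forall i j, differentiable (fun y => A y i j) x) ->
  (forall i j, differentiable (fun y => B y i j) x) ->
  dmx k (fun y => A y *m B y) x = dmx k A x *m B x + A x *m dmx k B x.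
Proof.
move=> dA dB; apply/matrixP => i j; rewrite !mxE.
have E : (fun y => (A y *m B y) i j) = fun y => \sum_l A y i l * B y l j.
  by apply/funext => y; rewrite mxE.
rewrite E partial_sum => [|l]; last exact: differentiableM.
by rewrite -big_split; apply: eq_bigr => l _; rewrite partialM // !mxE.
Qed.

Lemma partial_tri k (T : 'cV[R]_n -> 'I_n -> 'I_n -> 'I_n -> R) (u v w : 'cV[R]_n -> 'cV[R]_n) x :
  (forall a b c, differentiable (fun y => T y a b c) x) ->
  (forall a, differentiable (fun y => u y a 0) x) ->
  (forall a, differentiable (fun y => v y a 0) x) ->
  (forall a, differentiable (fun y => w y a 0) x) ->
  partial k (fun y => trilinear (T y) (u y) (v y) (w y)) x =
  trilinear (fun a b c => partial k (fun y => T y a b c) x) (u x) (v x) (w x)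
  + trilinear (T x) (dmx k u x) (v x) (w x) + trilinear (T x) (u x) (dmx k v x) (w x)
  + trilinear (T x) (u x) (v x) (dmx k w x).
Proof.
move=> dT du dv dw; rewrite /trilinear.
have dTu a b c : differentiable (fun y => T y a b c * u y a 0) x by exact: differentiableM.
have dTuv a b c : differentiable (fun y => T y a b c * u y a 0 * v y b 0) x by exact: differentiableM.
have dTuvw a b c : differentiable (fun y => T y a b c * u y a 0 * v y b 0 * w y c 0) x by exact: differentiableM.
have ds (F : 'I_n -> 'cV[R]_n -> R) : (forall i, differentiable (F i) x) ->
    differentiable (fun y => \sum_i F i y) x.
  move=> dF; have -> : (fun y => \sum_i F i y) = \sum_(i < n) F i by apply/funext => y; rewrite fct_sumE.
  exact: differentiable_sum.
rewrite partial_sum => [|a]; last by apply: (ds) => b; exact: (ds).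
rewrite -!big_split; apply: eq_bigr => a _.
rewrite partial_sum => [|b]; last exact: ds.
rewrite -!big_split; apply: eq_bigr => b _.
rewrite partial_sum // -!big_split; apply: eq_bigr => c _ /=.
by rewrite partialM // partialM // partialM // !mxE; ring.
Qed.

End MatrixDerivative.

Section ParallelTorsionForm.
Variables (R : realType) (Om : set 'cV[R]_4) (Q : 'cV[R]_4 -> set 'M[R]_4).
Variables (g : 'cV[R]_4 -> 'M[R]_4) (G : christoffel R 4).
Hypothesis oO : open Om.
Hypothesis sg : forall a b, smooth_on Om (fun x => g x a b).
Hypothesis gT : forall x, Om x -> (g x)^T = g x.
Hypothesis gP : forall x, Om x -> posdef (g x).
Hypothesis sG : forall m a b, smooth_on Om (fun x => G x m a b).
Hypothesis mG : forall x, Om x -> forall k a b, nabla_metric G g x k a b = 0.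
Hypothesis kT : forall x, Om x -> skew3 (torsion g G x).
Hypothesis pT : forall x, Om x -> forall k a b c, nabla_form3 G (torsion g G) x k a b c = 0.
Hypothesis hQ : forall x, Om x -> forall J, Q x J -> J *m J = - 1%:M -> J^T *m g x *m J = g x.
Hypothesis bQ : forall x, Om x -> exists (V : set 'cV[R]_4) (J : 'I_3 -> 'cV[R]_4 -> 'M[R]_4),
    [/\ open V, V x, V `<=` Om,
        forall al a b, smooth_on V (fun y => J al y a b) &
        forall y, V y -> admissible_basis (Q y) (fun al => J al y)].
Hypothesis cQ : forall (V : set 'cV[R]_4) (B : 'cV[R]_4 -> 'M[R]_4),
  open V -> V `<=` Om -> (forall a b, smooth_on V (fun y => B y a b)) ->
  (forall y, V y -> Q y (B y)) -> forall y k, V y -> Q y (nabla_end G B y k).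

Let T := torsion g G.

Definition connection_mx x k : 'M[R]_4 := \matrix_(a, b) G x a k b.

Lemma admissible_mem (S : set 'M[R]_4) J al : admissible_basis S J -> S (J al).
Proof.
case=> _ H; apply/H; exists (fun be => (al == be)%:R).
rewrite (bigD1 al) //= eqxx scale1r big1 ?addr0 // => be ne.
by rewrite eq_sym (negPf ne) scale0r.
Qed.

Lemma admissible_comb (S : set 'M[R]_4) J A : admissible_basis S J -> S A ->
  exists c0 c1 c2 : R, A = comb J c0 c1 c2.
Proof.
case=> _ H /H [c ->]; exists (c 0), (c 1), (c 2%:R); rewrite /comb !big_ord_recl big_ord0 addr0 addrA.
by congr (_ *: J _ + _ *: J _ + _ *: J _); try congr (c _); exact: val_inj.
Qed.

Lemma admissible_hermitian x J : Om x -> admissible_basis (Q x) J ->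
  forall al, (J al)^T *m g x *m J al = g x.
Proof. by move=> Ox aJ al; apply: hQ => //; [exact: (admissible_mem al aJ)|case: aJ => -[]]. Qed.

(** A derivative C of a complex structure J of constant square anticommutes with
    it, whereas the component of C along J commutes with J. *)
Lemma comb_anticommute (J : 'I_3 -> 'M[R]_4) (c0 c1 c2 : R) : quaternion_triple J ->
  let C := comb J c0 c1 c2 in
  [/\ C *m J 0 + J 0 *m C = 0 -> c0 = 0, C *m J 1 + J 1 *m C = 0 -> c1 = 0 &
      C *m J 2%:R + J 2%:R *m C = 0 -> c2 = 0].
Proof.
move=> qJ C; have [[s0 s1 s2] [E01 E10 E12 E21 [E20 E02]]] := quaternion_table qJ.
have key c : (- (2 * c)) *: (1%:M : 'M[R]_4) = 0 -> c = 0.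
  by move=> /(congr1 (fun M : 'M[R]_4 => M 0 0)); rewrite !mxE eqxx mulr1n; lra.
rewrite /C /comb; split; rewrite !mulmxDl !mulmxDr -!scalemxAl -!scalemxAr;
  rewrite ?s0 ?s1 ?s2 ?E01 ?E10 ?E12 ?E21 ?E20 ?E02 => H; apply: key; rewrite -{}[RHS]H;
  apply/matrixP => i j; rewrite !mxE; ring.
Qed.

Lemma tri_parallel x k X Y Z : Om x ->
  trilinear (fun a b c => partial k (fun y => T y a b c) x) X Y Z =
  trilinear (T x) (connection_mx x k *m X) Y Z + trilinear (T x) X (connection_mx x k *m Y) Z
  + trilinear (T x) X Y (connection_mx x k *m Z).
Proof.
move=> Ox; rewrite tri1M tri2M tri3M -!triTD; apply: triT_eq => a b c.
rewrite /T (partial_torsion pT _ _ _ _ Ox).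
by congr (_ + _ + _); apply: eq_bigr => m _; rewrite mxE.
Qed.

Variable t : 'cV[R]_4 -> 'I_4 -> R.
Hypothesis st : forall a, smooth_on Om (fun x => t x a).
Hypothesis tE : forall x J X, Om x -> admissible_basis (Q x) J ->
  gdot (g x) X X * \sum_a t x a * X a 0 = trilinear (T x) (J 0 *m X) (J 1 *m X) (J 2%:R *m X).

Let sT a b c : smooth_on Om (fun x => T x a b c). Proof. exact: torsion_smooth. Qed.

(** Differentiate tE at a constant vector e. The metric and T being parallel,
    their derivatives insert the connection matrix C into each argument; the
    derivative of J_a adds the commutator with C and a section K_a of Q without
    component along J_a, whose terms vanish by skewness. The remaining terms are
    dual_polar at e and C e. *)
Lemma torsion_form_parallel x k a : Om x ->
  partial k (fun y => t y a) x = \sum_m G x m k a * t x m.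
Proof.
move=> Ox; have [V [J [oV Vx VO sJ aJ]]] := bQ Ox.
pose e : 'cV[R]_4 := delta_mx a 0; pose C := connection_mx x k.
pose K al := nabla_end G (J al) x k.
have dJ al i j : differentiable (fun y => J al y i j) x by exact: smooth_diff (sJ al i j) Vx.
have KE al : dmx k (J al) x = K al - C *m J al x + J al x *m C.
  have -> : K al = dmx k (J al) x + C *m J al x - J al x *m C by [].
  by move: (dmx _ _ _) (C *m _) (_ *m C) => A B D; apply/matrixP => i j; rewrite !mxE; ring.
have [qJ _] := aJ x Vx.
(* The square of J is constant and the commutator with C is a derivation. *)
have Kac al : K al *m J al x + J al x *m K al = 0.
  have D0 : dmx k (fun y => J al y *m J al y) x = 0.
    apply/matrixP => i j; rewrite !mxE.
    rewrite (partial_eq k (g := fun y => (- 1%:M : 'M[R]_4) i j) oV Vx) ?partial_cst // => y Vy.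
    by have [[-> _ _] _] := aJ y Vy.
  move: D0; rewrite dmx_mul // KE => D0; apply: etrans D0.
  have [sq _ _] := qJ.
  rewrite !(mulmxDl, mulmxDr, mulmxBl, mulmxBr) !mulNmx !mulmxN -!mulmxA sq.
  rewrite [J al x *m (J al x *m C)]mulmxA sq mulNmx mul1mx mulmxN mulmx1 !mulmxA.
  by apply/matrixP => i j; rewrite !mxE; ring.
have [a0 [a1 [a2 K0]]] : exists c0 c1 c2, K 0 = comb (fun al => J al x) c0 c1 c2.
  apply: admissible_comb (aJ x Vx) _; apply: (cQ oV VO) => // y Vy; exact: admissible_mem (aJ y Vy).
have [b0 [b1 [b2 K1]]] : exists c0 c1 c2, K 1 = comb (fun al => J al x) c0 c1 c2.
  apply: admissible_comb (aJ x Vx) _; apply: (cQ oV VO) => // y Vy; exact: admissible_mem (aJ y Vy).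
have [c0 [c1 [c2 K2]]] : exists c0 c1 c2, K 2%:R = comb (fun al => J al x) c0 c1 c2.
  apply: admissible_comb (aJ x Vx) _; apply: (cQ oV VO) => // y Vy; exact: admissible_mem (aJ y Vy).
have za : a0 = 0 by have [H _ _] := comb_anticommute a0 a1 a2 qJ; apply: H; rewrite -K0.
have zb : b1 = 0 by have [_ H _] := comb_anticommute b0 b1 b2 qJ; apply: H; rewrite -K1.
have zc : c2 = 0 by have [_ _ H] := comb_anticommute c0 c1 c2 qJ; apply: H; rewrite -K2.
clearbody K.
have te y : \sum_b t y b * e b 0 = t y a.
  rewrite (bigD1 a) //= big1 ?addr0 /e ?mxE ?eqxx ?mulr1 // => b ba.
  by rewrite mxE (negPf ba) mulr0.
have gee y : gdot (g y) e e = g y a a.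
  rewrite /gdot /e -mulmxA -colE mxE (bigD1 a) //= big1 ?addr0 ?mxE ?eqxx ?mul1r ?mxE // => b ba.
  by rewrite !mxE (negPf ba) mul0r.
pose u al (y : 'cV[R]_4) := J al y *m e.
have du al i : differentiable (fun y => u al y i 0) x.
  have -> : (fun y => u al y i 0) = fun y => J al y i a.
    by apply/funext => y; rewrite /u /e -colE mxE.
  exact: dJ.
have dt : differentiable (fun y => t y a) x by exact: smooth_diff (st a) Ox.
have dg : differentiable (fun y => g y a a) x by exact: smooth_diff (sg a a) Ox.
have main : partial k (fun y => g y a a * t y a) x =
    partial k (fun y => trilinear (T y) (u 0 y) (u 1 y) (u 2%:R y)) x.
  by apply: partial_eq oV Vx _ => y Vy; rewrite -(tE e (VO _ Vy) (aJ y Vy)) te gee.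
rewrite partialM // partial_tri // in main; last by move=> p q r; exact: smooth_diff (sT p q r) Ox.
rewrite tri_parallel // in main.
have dmu al : dmx k (u al) x = (K al - C *m J al x + J al x *m C) *m e.
  rewrite -KE -[RHS]addr0 -[in RHS](mulmx0 _ (J al x)) /u dmx_mul //.
    by congr (_ + _ *m _); apply/matrixP => i j; rewrite !mxE partial_cst.
have pol := dual_polar (gT Ox) (fun X => tE X Ox (aJ x Vx)) e (C *m e).
have dga : partial k (fun y => g y a a) x = 2 * gdot (g x) e (C *m e).
  rewrite (partial_metric gT mG k a a Ox) -mulr2n -[LHS]mulr_natl (gdotC (gT Ox)); congr (_ * _).
  rewrite /gdot /lowered /e -mulmxA -colE mxE; apply: eq_bigr => m _.
  by rewrite -colE !mxE mulrC.
have tC : \sum_b t x b * (C *m e) b 0 = \sum_m G x m k a * t x m.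
  by apply: eq_bigr => m _; rewrite /e -colE !mxE mulrC.
have gpos : 0 < g x a a by rewrite -gee; apply: (gP Ox); rewrite /e; apply/eqP => /(congr1 (fun M : 'cV[R]_4 => M a 0)) /eqP; rewrite !mxE eqxx oner_eq0.
apply: (mulfI (lt0r_neq0 gpos)).
rewrite -tC -gee; move: main; rewrite dga te in pol *; rewrite !dmu.
rewrite !(mulmxDl, mulmxBl) K0 K1 K2 za zb zc /comb !scale0r !add0r !addr0 !mulmxDl !mulNmx -!scalemxAl -!mulmxA.
rewrite -/C -/(u 0 x) -/(u 1 x) -/(u 2%:R x) !triE.
rewrite !(tri_diag12 (kT Ox), tri_diag23 (kT Ox), tri_diag13 (kT Ox)).
rewrite -/(u 0 x) -/(u 1 x) -/(u 2%:R x) in pol.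
rewrite -gee !mulr0 !addr0; lra.
Qed.

(** The two connections differ by T / 2, and the dual vector of t is in the
    kernel of T. *)
Lemma torsion_form_levi_civita x k a : Om x -> nabla_form1 (levi_civita g) t x k a = 0.
Proof.
move=> Ox; rewrite /nabla_form1 torsion_form_parallel // -sumrB.
have [V [J [oV Vx VO sJ aJ]]] := bQ Ox; have [qJ _] := aJ x Vx.
have := dual_kernel (gT Ox) (gP Ox) (kT Ox) qJ (admissible_hermitian Ox (aJ x Vx))
  (fun X => tE X Ox (aJ x Vx)) (delta_mx k 0) (delta_mx a 0).
rewrite /= (tri_skew12 (kT Ox)) (tri_skew23 (kT Ox)) opprK => E.
transitivity (2^-1 * trilinear (T x) (delta_mx k 0) (delta_mx a 0) (invmx (g x) *m \col_a0 t x a0)); last by rewrite E mulr0.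
rewrite slot_mxE mxE.
under eq_bigr => m _ do rewrite (levi_civita_torsion gT gP mG kT _ _ _ Ox) mulrBl opprB addrC subrK -mulrA mulr_suml.
rewrite -[LHS]mulr_sumr; congr (_ * _); rewrite exchange_big; apply: eq_bigr => l _.
rewrite [X in _ = _ * X]mxE mulr_sumr; apply: eq_bigr => m _.
rewrite (invmx_metricC gT m l Ox) [X in _ = _ * (_ * X)]mxE.
have -> : ((delta_mx a 0 : 'cV[R]_4)^T *m slot_mx (T x) (delta_mx k 0)) 0 l = T x k a l.
  by rewrite -[RHS]tri_delta slot_mxE -[in RHS]colE [RHS]mxE.
by rewrite /T; ring.
Qed.

End ParallelTorsionForm.

(** * Changes of charts *)

Lemma open_within (T U : topologicalType) (A : set T) (B : set U) (f : T -> U) :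
  open A -> {within A, continuous f} -> open B -> open (A `&` f @^-1` B).
Proof.
move=> oA; rewrite continuous_open_subspace // => cf oB.
rewrite openE => x [Ax Bfx]; apply: filterI; first by apply: open_nbhs_nbhs.
by apply: (cf x); [exact: mem_set|exact: open_nbhs_nbhs].
Qed.

Section ChartChange.
Variables (R : realType) (M : topologicalType) (n : nat) (A : atlas R M n).
Hypothesis hM : smooth_manifold A.
Implicit Types (i j : chart A) (x : 'cV[R]_n).

Lemma cod_psi i x : cod i x -> dom i (psi i x) /\ phi i (psi i x) = x.
Proof. by move=> [p dp <-]; rewrite (manifold_phiK hM). Qed.

Lemma cod_phi i p : dom i p -> cod i (phi i p).
Proof. by move=> dp; exists p. Qed.

Lemma overlapE i j : overlap i j = cod i `&` psi i @^-1` dom j.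
Proof.
apply/seteqP; split=> x.
  by move=> [p [di dj] <-]; split; [exact: cod_phi|rewrite /= (manifold_phiK hM)].
by move=> [/cod_psi[dx Ex] dj]; exists (psi i x).
Qed.

Lemma open_overlap i j : open (overlap i j).
Proof.
rewrite overlapE; apply: open_within; [exact: manifold_open_cod|exact: manifold_psi_cont|exact: manifold_open_dom].
Qed.

Lemma overlap_phi i j p : dom i p -> dom j p -> overlap i j (phi i p) /\ transition i j (phi i p) = phi j p.
Proof. by move=> di dj; split; [exists p|rewrite /transition (manifold_phiK hM)]. Qed.

Lemma overlap_cod i j x : overlap i j x -> [/\ cod i x, cod j (transition i j x),
  overlap j i (transition i j x) & transition j i (transition i j x) = x].
Proof.
move=> [p [di dj] <-]; have [_ E] := overlap_phi di dj; have [oji E'] := overlap_phi dj di.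
by rewrite E; split=> //; exact: cod_phi.
Qed.

Lemma smooth_transition i j k : smooth_on (overlap i j) (fun x => transition i j x k 0).
Proof. exact: manifold_smooth. Qed.

Lemma transition_jac i j x : overlap i j x ->
  jac (transition j i) (transition i j x) *m jac (transition i j) x = 1%:M.
Proof.
move=> ox; have [_ _ oy _] := overlap_cod ox.
rewrite -jac_comp => [|k|k]; first last.
- exact: smooth_diff (@smooth_transition j i k) oy.
- exact: smooth_diff (@smooth_transition i j k) ox.
rewrite -(jac_id x); apply: jac_eq (@open_overlap i j) ox _ => y oy' /=.
by have [] := overlap_cod oy'.
Qed.

Lemma transition_unit i j x : overlap i j x -> jac (transition i j) x \in unitmx.
Proof. by move=> /transition_jac /mulmx1_unit []. Qed.

Variables (g : chart A -> 'cV[R]_n -> 'M[R]_n) (G : chart A -> christoffel R n).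
Hypothesis hg : riemannian_metric g.
Hypothesis hG : connection G.

(** The second derivatives of the transition map, which make the connection
    non-tensorial, are symmetric and cancel in the torsion. *)
Lemma torsion_trans i j x X Y Z : overlap i j x -> let D := jac (transition i j) x in
  trilinear (torsion (g i) (G i) x) X Y Z =
  trilinear (torsion (g j) (G j) (transition i j x)) (D *m X) (D *m Y) (D *m Z).
Proof.
move=> ox D; have := connection_trans hG ox; rewrite -/D; set y := transition i j x => E.
rewrite tri1M tri2M tri3M; apply: triT_eq => a b c.
have E2 m : \sum_l D m l * (G i x l a b - G i x l b a) =
    \sum_p \sum_q (G j y m p q - G j y m q p) * D p a * D q b.
  under eq_bigr => l _ do rewrite mulrBr.
  rewrite sumrB !E (partialC a b (@open_overlap i j) (@smooth_transition i j m) ox).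
  rewrite opprD addrACA subrr addr0 [X in _ - X]exchange_big -sumrB; apply: eq_bigr => p _.
  by rewrite -sumrB; apply: eq_bigr => q _; ring.
rewrite /torsion (metric_trans hg ox) -/D -/y.
transitivity (\sum_r \sum_m (\sum_l D m l * (G i x l a b - G i x l b a)) * g j y m r * D r c).
  under [RHS]eq_bigr => r _ do (under eq_bigr => m _ do rewrite !mulr_suml; rewrite exchange_big).
  rewrite exchange_big; apply: eq_bigr => l _; rewrite -mulmxA mxE.
  under [RHS]eq_bigr => r _ do rewrite /=.
  rewrite mulr_sumr exchange_big; apply: eq_bigr => m _; rewrite !mxE !mulr_sumr.
  by apply: eq_bigr => r _; ring.
apply: eq_bigr => r _.
under eq_bigr => m _ do (rewrite E2 mulr_suml mulr_suml; under eq_bigr => p _ do rewrite !mulr_suml).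
rewrite exchange_big mulr_sumr.
under [RHS]eq_bigr => q _ do rewrite !mulr_sumr.
rewrite [RHS]exchange_big; apply: eq_bigr => p _.
rewrite exchange_big; apply: eq_bigr => q _; rewrite !mulr_sumr; apply: eq_bigr => m _; ring.
Qed.

Lemma metric_gdot i j x (X Y : 'cV[R]_n) : overlap i j x -> let D := jac (transition i j) x in
  X^T *m g i x *m Y = (D *m X)^T *m g j (transition i j x) *m (D *m Y).
Proof. by move=> ox D; rewrite (metric_trans hg ox) trmx_mul -/D !mulmxA. Qed.

End ChartChange.

(** * The torsion one-form of a QKT manifold *)

Section TorsionForm.
Variables (R : realType) (M : topologicalType) (A : atlas R M 4).
Variables (Q : chart A -> 'cV[R]_4 -> set 'M[R]_4) (g : chart A -> 'cV[R]_4 -> 'M[R]_4).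
Variable (G : chart A -> christoffel R 4).
Hypothesis hM : smooth_manifold A.
Hypothesis hQKT : QKT Q g G.
Hypothesis hpar : parallel_torsion g G.
Implicit Types (i j : chart A) (x : 'cV[R]_4).

Let hg := QKT_riemannian hQKT.
Let tor i := torsion (g i) (G i).

Lemma chart_posdef i x : cod i x -> posdef (g i x).
Proof. exact: metric_pos hg i x. Qed.

Lemma chart_sym i x : cod i x -> (g i x)^T = g i x.
Proof. exact: Defs.metric_sym hg i x. Qed.

Lemma chart_skew i x : cod i x -> skew3 (tor i x).
Proof. exact: (QKT_skew hQKT). Qed.

Lemma chart_hermitian i x J : cod i x -> admissible_basis (Q i x) J ->
  forall al, (J al)^T *m g i x *m J al = g i x.
Proof.
move=> cx aJ al; apply: (QKT_hermitian hQKT cx); first exact: (admissible_mem al aJ).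
by case: aJ => -[].
Qed.

Lemma chart_basis i x : cod i x -> exists J, admissible_basis (Q i x) J.
Proof.
move=> cx; have [V [J [_ Vx _ _ aJ]]] := quaternionic_local_basis (QKT_quaternionic hQKT) cx.
by exists (fun al => J al x); exact: aJ.
Qed.

(** An arbitrary choice at each point; by torsion_form_unique the torsion form
    does not depend on it. *)
Definition some_basis i x : 'I_3 -> 'M[R]_4 :=
  if pselect (exists J, admissible_basis (Q i x) J) is left h then projT1 (cid h) else fun _ => 0.

Lemma some_basisP i x : cod i x -> admissible_basis (Q i x) (some_basis i x).
Proof.
move=> cx; rewrite /some_basis; case: pselect => [h|[]]; last exact: chart_basis.
exact: projT2 (cid h).
Qed.

Definition torsion_form i x (a : 'I_4) : R :=
  torsion_trace (g i x) (tor i x) (some_basis i x 0) (delta_mx a 0).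

Lemma torsion_form_trace i x (X : 'cV[R]_4) :
  \sum_a torsion_form i x a * X a 0 = torsion_trace (g i x) (tor i x) (some_basis i x 0) X.
Proof. exact: torsion_trace_linear. Qed.

Lemma comb_sqr (J : 'I_3 -> 'M[R]_4) (c0 c1 c2 : R) : quaternion_triple J ->
  comb J c0 c1 c2 *m comb J c0 c1 c2 = - 1%:M -> c0 ^+ 2 + c1 ^+ 2 + c2 ^+ 2 = 1.
Proof.
move=> qJ; have [[s0 s1 s2] [E01 E10 E12 E21 [E20 E02]]] := quaternion_table qJ.
rewrite /comb !mulmxDl !mulmxDr -!scalemxAl -!scalemxAr s0 s1 s2 E01 E10 E12 E21 E20 E02.
have -> : forall B0 B1 B2 : 'M[R]_4, c0 *: (c0 *: - 1%:M) + c0 *: (c1 *: B2) + c0 *: (c2 *: - B1) +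
   (c1 *: (c0 *: - B2) + c1 *: (c1 *: - 1%:M) + c1 *: (c2 *: B0)) +
   (c2 *: (c0 *: B1) + c2 *: (c1 *: - B0) + c2 *: (c2 *: - 1%:M)) =
   (c0 ^+ 2 + c1 ^+ 2 + c2 ^+ 2) *: - 1%:M.
  by move=> B0 B1 B2; apply/matrixP => i j; rewrite !mxE; ring.
by move=> /(congr1 (fun M : 'M[R]_4 => M 0 0)); rewrite !mxE eqxx mulr1n; lra.
Qed.

(** A complex structure in Q is a unit combination of the admissible basis, so
    torsion_traceE applies with coefficient one. *)
Lemma torsion_trace_basis i x J A0 X : cod i x -> admissible_basis (Q i x) J -> Q i x A0 ->
  A0 *m A0 = - 1%:M ->
  gdot (g i x) X X * torsion_trace (g i x) (tor i x) A0 X =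
  trilinear (tor i x) (J 0 *m X) (J 1 *m X) (J 2%:R *m X).
Proof.
move=> cx aJ /(admissible_comb aJ) [c0 [c1 [c2 ->]]] sq; have [qJ _] := aJ.
rewrite (torsion_traceE (chart_sym cx) (chart_posdef cx) (chart_skew cx) qJ (chart_hermitian cx aJ)).
by rewrite (comb_sqr qJ sq) mul1r.
Qed.

Lemma torsion_formE i x J (X : 'cV[R]_4) : cod i x -> admissible_basis (Q i x) J ->
  gdot (g i x) X X * (\sum_a torsion_form i x a * X a 0) =
  trilinear (tor i x) (J 0 *m X) (J 1 *m X) (J 2%:R *m X).
Proof.
move=> cx aJ; have bJ := some_basisP cx.
rewrite torsion_form_trace; apply: torsion_trace_basis => //.
  exact: (admissible_mem 0 bJ).
by case: bJ => -[].
Qed.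

Lemma torsion_form_unique i x J A0 (X : 'cV[R]_4) : cod i x -> admissible_basis (Q i x) J -> Q i x A0 ->
  A0 *m A0 = - 1%:M -> \sum_a torsion_form i x a * X a 0 = torsion_trace (g i x) (tor i x) A0 X.
Proof.
move=> cx aJ QA sq; have [->|X0] := eqVneq X 0.
  by rewrite /torsion_trace mulmx0 slot_mx0 mul0mx mulmx0 linear0 mulr0 big1 // => a _; rewrite mxE mulr0.
have g0 := lt0r_neq0 (gdot_gt0 (chart_posdef cx) X0).
by apply: (mulfI g0); rewrite (torsion_formE X cx aJ) (torsion_trace_basis X cx aJ QA sq).
Qed.

Lemma torsion_form_frame i x J (e : 'I_4 -> 'cV[R]_4) al (X : 'cV[R]_4) : cod i x ->
  admissible_basis (Q i x) J -> Defs.orthonormal (g i x) e ->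
  \sum_a torsion_form i x a * X a 0 = - t_alpha (tor i x) (J al) e (J al *m X).
Proof.
move=> cx aJ oe.
have sq : J al *m J al = - 1%:M by case: aJ => -[].
rewrite (torsion_form_unique X cx aJ (admissible_mem al aJ) sq) /t_alpha mulNr opprK.
pose P : 'M[R]_4 := \matrix_(a, k) e k a 0.
have cP k : col k P = e k by apply/matrixP => a l; rewrite ord1 !mxE.
have HP : P^T *m g i x *m P = 1%:M.
  apply/matrixP => k l; transitivity (((e k)^T *m g i x *m e l) 0 0); last first.
    by rewrite oe !mxE eqxx mulr1n.
  by rewrite -cP -(cP l) tr_col -row_mul; move: (P^T *m g i x) => N; rewrite !mxE; apply: eq_bigr => b _; rewrite !mxE.
have := torsion_trace_frame (tor i x) (chart_posdef cx) (J al) X (oner_neq0 R) HP.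
under eq_bigr => k _ do rewrite cP.
by move=> ->; rewrite mul1r; field.
Qed.

Lemma slot_smooth (V : set 'cV[R]_4) i (B : 'cV[R]_4 -> 'M[R]_4) a b c : open V -> V `<=` cod i ->
  (forall a b, smooth_on V (fun y => B y a b)) ->
  smooth_on V (fun y => slot_mx (tor i y) (B y *m delta_mx a 0) b c).
Proof.
move=> oV VO sB; apply: (@smooth_eq _ _ _ (fun y => \sum_p tor i y p b c * B y p a)) => //.
  by move=> y _; rewrite mxE; apply: eq_bigr => p _; rewrite -colE mxE.
apply: smooth_sum => // p; apply: smoothM => //; apply: (smooth_onS VO).
apply: torsion_smooth; first exact: (manifold_open_cod hM).
  exact: (metric_smooth hg).
by move=> m p' q; exact: (connection_smooth (QKT_connection hQKT)).
Qed.

(** Near each point the arbitrary choice of a basis may be replaced by a smooth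
    local basis. *)
Lemma torsion_form_smooth i a : smooth_on (cod i) (fun x => torsion_form i x a).
Proof.
apply: smooth_on_local => x cx.
have [V [J [oV Vx VO sJ aJ]]] := quaternionic_local_basis (QKT_quaternionic hQKT) cx.
exists V => //.
apply: (@smooth_eq _ _ _ (fun y => 2^-1 * \sum_b (invmx (g i y) *m (slot_mx (tor i y) (J 0 y *m delta_mx a 0) *m J 0 y)) b b)) => //.
  move=> y Vy; have cy := VO _ Vy.
  have sq : J 0 y *m J 0 y = - 1%:M by case: (aJ y Vy) => -[].
  transitivity (torsion_trace (g i y) (tor i y) (J 0 y) (delta_mx a 0)) => //.
  rewrite -(torsion_form_unique _ cy (aJ y Vy) (admissible_mem 0 (aJ y Vy)) sq).
  exact: torsion_form_trace.
apply: smoothM => //; first exact: smooth_cst.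
apply: smooth_sum => // b; apply: (smooth_mulmx oV) => [p q|p q].
  apply: smooth_invmx => // [p' q'|y Vy]; first by apply: (smooth_onS VO); exact: (metric_smooth hg).
  by apply: posdef_unit; apply: chart_posdef; exact: VO.
by apply: (smooth_mulmx oV) => [p' q'|p' q']; [exact: slot_smooth|exact: sJ].
Qed.

(** Conjugation by the Jacobian carries one fibre of Q to the other. *)
Lemma basis_trans i j x J : overlap i j x -> admissible_basis (Q i x) J ->
  let D := jac (transition i j) x in
  exists J', admissible_basis (Q j (transition i j x)) J' /\ forall al, D *m J al = J' al *m D.
Proof.
move=> ox [[sq E01 E10] sp] D; have uD : D \in unitmx by exact: (transition_unit hM).
have QE := quaternionic_trans (QKT_quaternionic hQKT) ox; rewrite -/D /= in QE.
pose J' al := D *m J al *m invmx D.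
have mul al be : J' al *m J' be = D *m (J al *m J be) *m invmx D.
  by rewrite /J' !mulmxA mulmxKV.
exists J'; split; last by move=> al; rewrite /J' mulmxKV.
split; first split.
- by move=> al; rewrite mul sq mulmxN mulmx1 mulNmx mulmxV.
- by rewrite mul E01.
- by rewrite mul E10 mulmxN mulNmx.
move=> C; rewrite -(QE (invmx D *m C *m D) C); last by rewrite !mulmxA mulmxV ?mul1mx.
split=> [/sp[c E]|[c ->]].
  exists c; transitivity (D *m (invmx D *m C *m D) *m invmx D).
    by rewrite !mulmxA mulmxV // mul1mx mulmxK.
  rewrite E mulmx_sumr mulmx_suml; apply: eq_bigr => al _.
  by rewrite -scalemxAr -scalemxAl.
apply/sp; exists c; rewrite mulmx_sumr mulmx_suml; apply: eq_bigr => al _.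
by rewrite -scalemxAr -scalemxAl /J' !mulmxA mulVmx // mul1mx mulmxKV.
Qed.

(** Both sides satisfy the cubic identity torsion_formE, whose ingredients are
    carried over by the Jacobian. *)
Lemma torsion_form_trans i j x : overlap i j x -> forall a,
  torsion_form i x a = \sum_b jac (transition i j) x b a * torsion_form j (transition i j x) b.
Proof.
move=> ox a; have [cx cy _ _] := overlap_cod hM ox.
have [J aJ] := chart_basis cx; have [J' [aJ' DJ]] := basis_trans ox aJ.
set D := jac _ _ in DJ *; set y := transition i j x in cy aJ' *.
pose e : 'cV[R]_4 := delta_mx a 0.
have e0 : e != 0.
  by apply/eqP => /(congr1 (fun B : 'cV[R]_4 => B a 0)) /eqP; rewrite !mxE eqxx oner_eq0.
have g0 := lt0r_neq0 (gdot_gt0 (chart_posdef cx) e0).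
have L : \sum_b torsion_form i x b * e b 0 = torsion_form i x a.
  exact: torsion_form_trace.
have Rr : \sum_b torsion_form j y b * (D *m e) b 0 = \sum_b D b a * torsion_form j y b.
  by apply: eq_bigr => b _; rewrite /e -colE mxE mulrC.
rewrite -L -Rr; apply: (mulfI g0); rewrite (torsion_formE e cx aJ).
rewrite /gdot (metric_gdot hg e e ox) -/D -/y -/(gdot _ _ _) (torsion_formE _ cy aJ').
rewrite /tor (torsion_trans hM hg (QKT_connection hQKT) _ _ _ ox) -/D -/y.
by rewrite !mulmxA !DJ.
Qed.

Lemma torsion_form_parallel_lc : levi_civita_parallel g torsion_form.
Proof.
move=> i x cx k a.
apply: (@torsion_form_levi_civita R (cod i) (Q i) (g i) (G i)) => //.
- exact: (manifold_open_cod hM).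
- exact: (metric_smooth hg).
- exact: (Defs.metric_sym hg).
- exact: chart_posdef.
- by move=> m b c; exact: (connection_smooth (QKT_connection hQKT)).
- by move=> y cy p q r; exact: (QKT_metric_connection hQKT).
- exact: chart_skew.
- by move=> y cy p b c d; exact: hpar.
- exact: (QKT_hermitian hQKT).
- by move=> y cy; exact: (quaternionic_local_basis (QKT_quaternionic hQKT)).
- by move=> V B oV VO sB QB y p Vy; exact: (QKT_quaternionic_connection hQKT oV VO sB QB).
- exact: torsion_form_smooth.
- by move=> y J X cy aJ; exact: torsion_formE.
Qed.

Theorem torsion_formP : torsion_one_form Q g G torsion_form.
Proof.
split; first split.
- exact: torsion_form_smooth.
- exact: torsion_form_trans.
- by move=> i x cx J e aJ oe al X; exact: torsion_form_frame.
Qed.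

Theorem torsion_closed : closed_torsion g G.
Proof.
move=> i x cx a b c d.
apply: (@parallel_torsion_closed R (cod i)) => //.
- exact: (Defs.metric_sym hg).
- exact: chart_posdef.
- exact: chart_skew.
- by move=> y cy p q r s; exact: hpar.
Qed.

Lemma torsion_form_eq0 i x : cod i x ->
  (forall a, torsion_form i x a = 0) <-> (forall a b c, tor i x a b c = 0).
Proof.
move=> cx; have [J aJ] := chart_basis cx; have [qJ _] := aJ; split=> H.
  move=> a b c; rewrite -tri_delta.
  exact: (dual_eq0 (chart_sym cx) (chart_posdef cx) (chart_skew cx) qJ (chart_hermitian cx aJ)
    (fun X => torsion_formE X cx aJ) H).
move=> a; rewrite /torsion_form /torsion_trace (_ : slot_mx _ _ = 0) ?mul0mx ?mulmx0 ?linear0 ?mulr0 //.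
by apply/matrixP => b c; rewrite !mxE big1 // => p _; rewrite H mul0r.
Qed.

(** A parallel form has locally constant length, so it vanishes near each of its
    zeros and nowhere near the other points. *)
Lemma torsion_form_neq0_near i p : dom i p ->
  \forall q \near p, dom i q /\
    ((exists a, torsion_form i (phi i q) a != 0) <-> (exists a, torsion_form i (phi i p) a != 0)).
Proof.
move=> dp; have cx := cod_phi dp; set x := phi i p in cx *.
have oO : open (cod i) by exact: (manifold_open_cod hM).
have sg : forall a b, smooth_on (cod i) (fun x => g i x a b) by exact: (metric_smooth hg).
have sO a : smooth_on (cod i) (fun x => torsion_form i x a) by exact: torsion_form_smooth.
have gP : forall x, cod i x -> posdef (g i x) by exact: chart_posdef.
have [d d0 Hd] := open_ball_sub oO cx.
have bO y : `|y - x| < d -> cod i y by move=> yd; rewrite -(subrK x y) addrC; exact: Hd.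
have lc := torsion_form_parallel_lc (i := i).
have ncst : forall y, `|y - x| < d -> norm2 (g i) (torsion_form i) y = norm2 (g i) (torsion_form i) x.
  apply: ball_cst => [y yd|y k yd]; last exact: (partial_norm2 oO sg (Defs.metric_sym hg (i := i)) gP sO lc k (bO _ yd)).
  apply: (@smooth_diff _ _ (cod i)); last exact: bO.
  by apply: smooth_sum => // a; apply: smoothM => //; exact: (sharp_smooth oO sg gP sO).
have nz y : cod i y -> (exists a, torsion_form i y a != 0) <-> norm2 (g i) (torsion_form i) y != 0.
  move=> cy; split=> [H|]; first by apply: lt0r_neq0; exact: (norm2_gt0 gP cy H).
  apply: contraNP => H; rewrite norm2_eq0 // => a; apply/eqP; apply: contra_notT H => ta; by exists a.
have : nbhs p (dom i `&` phi i @^-1` [set y | `|y - x| < d]).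
  apply: open_nbhs_nbhs; split; last by split=> //=; rewrite subrr normr0.
  apply: open_within; [exact: (manifold_open_dom hM)|exact: (manifold_phi_cont hM)|exact: open_ball_norm].
apply: filterS => q [dq yd]; split=> //.
rewrite !nz //; last exact: cod_phi.
by rewrite ncst.
Qed.

Lemma torsion_nonzeroE i p : dom i p ->
  torsion_nonzero_at g G p <-> exists a, torsion_form i (phi i p) a != 0.
Proof.
move=> dp; have cx := cod_phi dp; split; last first.
  move=> [a ta]; apply: contrapT => H; move: ta; rewrite (torsion_form_eq0 cx).2 ?eqxx // => b c d.
  by apply/eqP; apply: contra_notT H => tb; exists i, b, c, d.
move=> [j [a [b [c [dj tj]]]]]; apply: contrapT => H; move: tj.
have t0 : forall a, torsion_form i (phi i p) a = 0.
  by move=> d; apply/eqP; apply: contra_notT H => td; exists d.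
have [ox E] := overlap_phi hM dj dp.
rewrite -tri_delta (torsion_trans hM hg (QKT_connection hQKT) _ _ _ ox) E.
have T0 := (torsion_form_eq0 cx).1 t0.
rewrite /trilinear big1 ?eqxx // => a' _; rewrite big1 // => b' _; rewrite big1 // => c' _.
by rewrite [torsion _ _ _ _ _ _]T0 !mul0r.
Qed.

(** The set where the torsion does not vanish is open and closed. *)
Lemma torsion_nonzero_component p q : connected_component [set: M] p q ->
  torsion_nonzero_at g G q -> torsion_nonzero_at g G p.
Proof.
move=> [C [Cp _ cC] Cq] Tq; pose S := [set q | torsion_nonzero_at g G q].
have near_S r : \forall s \near r, S s <-> S r.
  have [i dr] := manifold_cover hM r.
  apply: filterS (torsion_form_neq0_near dr) => s [ds H].
  by rewrite /S /= (torsion_nonzeroE ds) (torsion_nonzeroE dr).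
have oS : open S.
  by rewrite openE => r Sr; apply: filterS (near_S r) => s H; exact/H.
have cS : closed S.
  rewrite -[S]setCK; apply: open_closedC; rewrite openE => r Sr.
  by apply: filterS (near_S r) => s H /H.
suff : C `&` S = C by move=> E; have := Cp; rewrite -E => -[].
apply: cC; first by exists q.
- by exists S.
- by exists S.
Qed.

End TorsionForm.

(** * Local products with a line *)

Section LeviCivita.
Variables (R : realType) (n : nat) (h : 'cV[R]_n -> 'M[R]_n).
Hypothesis sh : forall a b, smooth_on setT (fun y => h y a b).
Hypothesis hT : forall y, (h y)^T = h y.
Hypothesis hP : forall y, posdef (h y).

Lemma levi_civita_lowered y a b c : \sum_m levi_civita h y m a b * h y m c =
  2^-1 * (partial a (fun z => h z b c) y + partial b (fun z => h z a c) y - partial c (fun z => h z a b) y).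
Proof.
pose F l := partial a (fun z => h z b l) y + partial b (fun z => h z a l) y - partial l (fun z => h z a b) y.
rewrite /levi_civita; under eq_bigr => m _ do rewrite -mulrA mulr_suml.
rewrite -mulr_sumr exchange_big; congr (_ * _).
transitivity (\sum_l F l * (invmx (h y) *m h y) l c).
  apply: eq_bigr => l _; rewrite mxE mulr_sumr; apply: eq_bigr => m _.
  have -> : invmx (h y) m l = invmx (h y) l m by rewrite -[in LHS](hT y) -trmx_inv mxE.
  by rewrite /F; ring.
rewrite mulVmx ?posdef_unit // (bigD1 c) //= big1 ?addr0 ?mxE ?eqxx ?mulr1 // => l lc.
by rewrite mxE (negPf lc) mulr0.
Qed.

Lemma partial_swap y k a b : partial k (fun z => h z a b) y = partial k (fun z => h z b a) y.
Proof. by congr (partial k _ y); apply/funext => z; rewrite -[in LHS](hT z) mxE. Qed.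

Lemma levi_civita_metric y k a b : nabla_metric (levi_civita h) h y k a b = 0.
Proof.
rewrite /nabla_metric levi_civita_lowered.
have -> : \sum_m levi_civita h y m k b * h y a m = \sum_m levi_civita h y m k b * h y m a.
  by apply: eq_bigr => m _; rewrite -[in LHS](hT y) mxE.
rewrite levi_civita_lowered (partial_swap y k b a); lra.
Qed.

Lemma levi_civita_torsion_free y a b c : torsion h (levi_civita h) y a b c = 0.
Proof.
rewrite /torsion big1 // => m _; rewrite /levi_civita -mulrBr -sumrB big1 ?mulr0 ?mul0r // => l _.
by rewrite (partial_swap y l b a); ring.
Qed.

Lemma levi_civita_smooth m a b : smooth_on setT (fun y => levi_civita h y m a b).
Proof.
have oT : open [set: 'cV[R]_n] := openT.
apply: smoothM => //; first exact: smooth_cst.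
apply: smooth_sum => // l; apply: smoothM => //.
  by apply: smooth_invmx => // y _; exact: posdef_unit.
by apply: smoothB => //; [apply: smoothD => //|]; exact: smooth_partial.
Qed.

End LeviCivita.

Section EuclideanAtlas.
Variables (R : realType) (n : nat).

Definition euclidean_atlas : atlas R 'cV[R]_n n :=
  {| chart := unit; dom := fun _ => setT; phi := fun _ x => x; psi := fun _ x => x |}.

(** The balls with rational centre and radius 1 / (k + 1) form a basis. *)
Lemma col_second_countable : @second_countable 'cV[R]_n.
Proof.
pose U (q : 'cV[rat]_n * nat) := [set x : 'cV[R]_n | `|x - map_mx ratr q.1| < q.2.+1%:R^-1].
exists (range U); first by apply: card_le_trans (card_image_le _ _) _; exact: countableP.
split=> [_ [q _ <-]|x V /= /nbhs_ballP[r /= r0 Hr]]; first exact: open_ball_norm.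
have [k _ Hk] := near_infty_natSinv_lt (PosNum (divr_gt0 r0 (ltr0n R 2))).
have [e [eE e0 er]] : exists e : R, [/\ e = k.+1%:R^-1, 0 < e & e < r / 2].
  by exists k.+1%:R^-1; split; [|rewrite invr_gt0 ltr0n|exact: Hk k (leqnn k)].
have /choice[c Hc] : forall i : 'I_n, exists q : rat, ratr q \in `]x i 0 - e, x i 0 + e[.
  by move=> i; apply: rat_in_itvoo; lra.
pose z : 'cV[R]_n := map_mx ratr (\col_i c i).
have xc : `|x - z| < e.
  apply: norm_lt_coord => // i; rewrite !mxE ltr_norml.
  by have := Hc i; rewrite in_itv /= => /andP[? ?]; apply/andP; split; lra.
exists (U (\col_i c i, k)); first by split; [exists (\col_i c i, k)|rewrite /U /= -eE].
rewrite /U /= -eE -/z => y yc; apply: Hr; rewrite -ball_normE /=.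
apply: le_lt_trans (ler_distD z _ _) _; rewrite [`|z - y|]distrC.
have {}yc : `|y - z| < e := yc.
move: (`|x - z|) (`|y - z|) xc yc => u v xc yc; lra.
Qed.

Lemma euclidean_smooth_manifold : smooth_manifold euclidean_atlas.
Proof.
have cE i : cod (A := euclidean_atlas) i = setT by apply/seteqP; split=> x // _; exists x.
split.
- exact: norm_hausdorff.
- exact: col_second_countable.
- by move=> p; exists tt.
- by move=> i; exact: openT.
- by move=> i; rewrite cE; exact: openT.
- by [].
- by move=> i; apply: continuous_subspaceT => x.
- by move=> i; apply: continuous_subspaceT => x.
- move=> i j k; apply: (@smooth_onS _ _ _ setT) => //.
  exact: smooth_coord openT k.
Qed.

Variable h : 'cV[R]_n -> 'M[R]_n.
Hypothesis sh : forall a b, smooth_on setT (fun y => h y a b).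
Hypothesis hT : forall y, (h y)^T = h y.
Hypothesis hP : forall y, posdef (h y).

Lemma euclidean_jac (i j : chart euclidean_atlas) x : jac (transition i j) x = 1%:M.
Proof. exact: jac_id. Qed.

Lemma euclidean_metric : riemannian_metric (A := euclidean_atlas) (fun _ => h).
Proof.
split.
- by move=> i a b; exact: smooth_onS (sh a b).
- by move=> i x _; exact: hT.
- by move=> i x _; exact: hP.
- by move=> i j x _; rewrite euclidean_jac trmx1 mul1mx mulmx1.
Qed.

Lemma euclidean_connection : connection (A := euclidean_atlas) (fun _ => levi_civita h).
Proof.
split; first by move=> i m a b; apply: smooth_onS (levi_civita_smooth sh hP m a b).
move=> i j x _; rewrite euclidean_jac /= => m a b.
have one (F : 'I_n -> R) (k : 'I_n) : \sum_l F l * (1%:M : 'M[R]_n) l k = F k.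
  by rewrite (bigD1 k) //= big1 ?addr0 ?mxE ?eqxx ?mulr1 // => l lk; rewrite mxE (negPf lk) mulr0.
have -> : partial a (partial b (fun y : 'cV[R]_n => y m 0)) x = 0.
  rewrite (_ : partial b _ = cst (m == b)%:R) ?partial_cst //.
  by apply/funext => y; rewrite partial_coord.
rewrite addr0; under [RHS]eq_bigr => c _ do rewrite one.
rewrite one (bigD1 m) //= big1 ?addr0 ?mxE ?eqxx ?mul1r // => l lm.
by rewrite mxE eq_sym (negPf lm) mul0r.
Qed.

Lemma euclidean_skew : skew_torsion (A := euclidean_atlas) (fun _ => h) (fun _ => levi_civita h).
Proof. by move=> i x _ a b c; rewrite !levi_civita_torsion_free // oppr0. Qed.

Lemma euclidean_parallel : parallel_torsion (A := euclidean_atlas) (fun _ => h) (fun _ => levi_civita h).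
Proof.
move=> i x _ k a b c; rewrite /nabla_form3.
have -> : torsion h (levi_civita h) = fun _ _ _ _ => 0.
  by apply/funext => y; apply/funext => p; apply/funext => q; apply/funext => r; exact: levi_civita_torsion_free.
by rewrite partial_cst !big1 ?subr0 // => m _; rewrite mulr0.
Qed.

End EuclideanAtlas.

Section ProductWithLine.
Variables (R : realType) (n : nat).
Local Notation B := (prod_line (euclidean_atlas R n)).
Local Notation Phi := (@phi R _ _ B tt).
Local Notation Psi := (@psi R _ _ B tt).

Lemma prod_lineK y : Phi (Psi y) = y.
Proof.
rewrite /= -[RHS]vsubmxK; congr col_mx; apply/matrixP => i j; rewrite !ord1 !mxE //.
Qed.

Lemma prod_linePsiK q : Psi (Phi q) = q.
Proof. by case: q => y s /=; rewrite col_mxKu col_mxKd mxE. Qed.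

Lemma prod_line_psi_continuous : continuous Psi.
Proof.
move=> y.
have c1 : {for y, continuous (fun z : 'cV[R]_(n + 1) => usubmx z)}.
  apply: col_continuous => k.
  rewrite (_ : (fun _ => _) = fun z : 'cV[R]_(n + 1) => z (lshift 1 k) 0); first exact: differentiable_coord.
  by apply/funext => z; rewrite mxE.
have c2 : {for y, continuous (fun z : 'cV[R]_(n + 1) => dsubmx z 0 0)}.
  rewrite (_ : (fun _ => _) = fun z : 'cV[R]_(n + 1) => z (rshift n 0) 0); first exact: coord_continuous.
  by apply/funext => z; rewrite mxE.
exact: cvg_pair c1 c2.
Qed.

Lemma prod_line_phi_continuous : continuous Phi.
Proof.
move=> q; apply/cvgrPdist_lt => e e0.
have c1 : \forall r \near q, `|q.1 - r.1| < e by apply: (cvgr_dist_lt _ _ cvg_fst).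
have c2 : \forall r \near q, `|q.2 - r.2| < e by apply: (cvgr_dist_lt _ _ cvg_snd).
apply: filterS2 c1 c2 => r r1 r2; apply: norm_lt_coord => // i /=.
rewrite opp_col_mx add_col_mx; case: (split_ordP i) => k ->; rewrite ?col_mxEu ?col_mxEd.
  exact: le_lt_trans (norm_coord_le _ k) r1.
by rewrite !mxE.
Qed.

Variables (M : topologicalType) (A : atlas R M (n + 1)) (g : chart A -> 'cV[R]_(n + 1) -> 'M[R]_(n + 1)).
Hypothesis hM : smooth_manifold A.
Hypothesis hg : riemannian_metric g.

(** In every chart i of M the isometry is G after the transition from i to i0,
    so that the claims reduce to the chart i0 by the chain rule. *)
Theorem isometric_near_chart (i0 : chart A) (p : M) (h : 'cV[R]_n -> 'M[R]_n)
    (W U : set 'cV[R]_(n + 1)) (H G : 'cV[R]_(n + 1) -> 'cV[R]_(n + 1)) :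
  dom i0 p -> open W -> open U -> U `<=` cod i0 -> U (phi i0 p) ->
  (forall z, W z -> U (H z) /\ G (H z) = z) -> (forall x, U x -> W (G x) /\ H (G x) = x) ->
  (forall k, smooth_on W (fun z => H z k 0)) -> (forall k, smooth_on U (fun x => G x k 0)) ->
  (forall x, U x -> g i0 x = (jac G x)^T *m block_mx (h (usubmx (G x))) 0 0 1%:M *m jac G x) ->
  isometric_near (B := B) g (prod_line_metric (B := euclidean_atlas R n) (fun _ => h)) p.
Proof.
move=> dp oW oU UO Up WU UW sH sG gE.
pose UM := dom i0 `&` phi i0 @^-1` U; pose WN := Phi @^-1` W.
have oUM : open UM.
  by apply: open_within => //; [exact: (manifold_open_dom hM)|exact: (manifold_phi_cont hM)].
have oWN : open WN by apply: open_comp => // q _; exact: prod_line_phi_continuous.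
pose F q := Psi (G (phi i0 q)); pose K r := psi i0 (H (Phi r)).
have cG x : U x -> {for x, continuous G} by move=> Ux; apply: col_continuous => k; exact: smooth_diff (sG k) Ux.
have cH z : W z -> {for z, continuous H} by move=> Wz; apply: col_continuous => k; exact: smooth_diff (sH k) Wz.
have FK q : UM q -> WN (F q) /\ K (F q) = q.
  move=> [dq Uq]; have [Wq E] := UW _ Uq.
  split; last by rewrite /K /F prod_lineK E (manifold_phiK hM).
  by change (W (Phi (Psi (G (phi i0 q))))); rewrite prod_lineK.
have KF r : WN r -> UM (K r) /\ F (K r) = r.
  move=> Wr; have [Ur E] := WU _ Wr; have [dr Er] := cod_psi hM (UO _ Ur).
  split; last by rewrite /F /K Er E prod_linePsiK.
  by split=> //; change (U (phi i0 (K r))); rewrite /K Er.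
have FE i x : map_in_charts (A := A) (B := B) F i tt x = G (transition i i0 x).
  exact: prod_lineK.
have mapF i j x : map_dom (A := A) (B := B) UM F i j x -> overlap i i0 x /\ U (transition i i0 x).
  by move=> [q [[dq [d0 Uq]] _] <-]; have [? ->] := overlap_phi hM dq d0.
have oV i : open [set x | overlap i i0 x /\ U (transition i i0 x)].
  apply: open_preimage => //; first exact: (open_overlap hM).
  by move=> x ox; apply: col_continuous => k; exact: smooth_diff (@smooth_transition _ _ _ _ hM i i0 k) ox.
have sV i k : smooth_on [set x | overlap i i0 x /\ U (transition i i0 x)] (fun x => transition i i0 x k 0).
  by apply: smooth_onS (@smooth_transition _ _ _ _ hM i i0 k) => x [].
exists UM, WN, F, K; split; first by split.
- by split.
- split.
    rewrite continuous_open_subspace // => q /set_mem [dq Uq].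
    apply: (@continuous_comp _ _ _ (G \o phi i0) Psi); last exact: prod_line_psi_continuous.
    apply: continuous_comp; last exact: cG.
    have := manifold_phi_cont hM (i := i0); rewrite continuous_open_subspace; last exact: (manifold_open_dom hM).
    by apply; exact: mem_set.
  move=> i [] k; apply: (@smooth_onS _ _ _ [set x | overlap i i0 x /\ U (transition i i0 x)]).
    by move=> x /mapF.
  apply: (@smooth_eq _ _ _ (fun x => G (transition i i0 x) k 0)) => //.
    by move=> x _; rewrite FE.
  by apply: (smooth_comp (oV i) (sG k)) => // x [].
- split.
    rewrite continuous_open_subspace // => r /set_mem Wr; have [Ur _] := WU _ Wr.
    apply: (@continuous_comp _ _ _ (H \o Phi) (psi i0)).
      by apply: continuous_comp; [exact: prod_line_phi_continuous|exact: cH].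
    have := manifold_psi_cont hM (i := i0); rewrite continuous_open_subspace; last exact: (manifold_open_cod hM).
    by apply; apply: mem_set; exact: UO.
  move=> [] i k.
  have KE z : map_in_charts (A := B) (B := A) K tt i z = transition i0 i (H z).
    by rewrite /map_in_charts /K prod_lineK.
  have oV' : open [set z | W z /\ overlap i0 i (H z)].
    by apply: open_preimage => //; exact: (open_overlap hM).
  apply: (@smooth_onS _ _ _ [set z | W z /\ overlap i0 i (H z)]).
    move=> z [r [[_ Wr] dr] <-]; split=> //.
    by rewrite (overlapE hM); split=> //; apply: UO; exact: (WU _ Wr).1.
  apply: (@smooth_eq _ _ _ (fun z => transition i0 i (H z) k 0)) => //.
    by move=> z _; rewrite KE.
  apply: (smooth_comp oV' (@smooth_transition _ _ _ _ hM i0 i k)) => [z []//|l].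
  by apply: smooth_onS (sH l) => z [].
move=> i [] x /mapF [ox Ux] D.
have -> : D = jac G (transition i i0 x) *m jac (transition i i0) x.
  rewrite /D -jac_comp; first by congr (jac _ x); apply/funext => y; exact: FE.
    by move=> k; exact: smooth_diff (@smooth_transition _ _ _ _ hM i i0 k) ox.
  by move=> k; exact: smooth_diff (sG k) Ux.
by rewrite (metric_trans hg ox) (gE _ Ux) FE trmx_mul !mulmxA.
Qed.

End ProductWithLine.

Unset Implicit Arguments.

(** * Four-dimensional QKT manifolds with parallel torsion *)

Theorem theorem5p2 (R : realType) (M : topologicalType) (A : atlas R M 4)
    (Q : chart A -> 'cV[R]_4 -> set 'M[R]_4)
    (g : chart A -> 'cV[R]_4 -> 'M[R]_4)
    (G : chart A -> christoffel R 4)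
    (hM : smooth_manifold A)
    (hQKT : QKT Q g G)
    (hpar : parallel_torsion g G) :
  [/\ strong_QKT Q g G,
      exists t : chart A -> 'cV[R]_4 -> 'I_4 -> R,
        torsion_one_form Q g G t /\ levi_civita_parallel g t
    & forall p : M,
        (exists2 q : M, connected_component [set: M] p q
                        & torsion_nonzero_at g G q) ->
        locally_product_at g p].
Proof.
split.
- by split=> //; exact: torsion_closed hQKT hpar.
- exists (torsion_form Q g G); split; first exact: torsion_formP hM hQKT.
  exact: torsion_form_parallel_lc hM hQKT hpar.
move=> p [q pq Tq]; have Tp := torsion_nonzero_component hM hQKT hpar pq Tq.
have [i dp] := manifold_cover hM p; have cx := cod_phi dp.
have tp := (torsion_nonzeroE hM hQKT dp).1 Tp.
have hg := QKT_riemannian hQKT.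
have [||||||h [W [U [H [K [[sh hT hP] [[oW oU UO Up] [WU UW sH sK gE]]]]]]]] :=
  @parallel_form_splitting R 3 (cod i) (g i) (torsion_form Q g G i) (phi i p) _ _ _ _ _ _ cx tp.
- exact: (manifold_open_cod hM).
- exact: (metric_smooth hg).
- exact: (Defs.metric_sym hg).
- exact: (chart_posdef hQKT).
- by move=> a; exact: (torsion_form_smooth hM hQKT).
- exact: (torsion_form_parallel_lc hM hQKT hpar).
exists 'cV[R]_3, (euclidean_atlas R 3), (fun _ => h), (fun _ => levi_civita h); split.
- by split; [exact: euclidean_smooth_manifold|exact: euclidean_metric].
- split; first exact: euclidean_connection.
  by move=> j x _ k a b; exact: levi_civita_metric.
- exact: euclidean_skew.
- exact: euclidean_parallel.
exact: (@isometric_near_chart R 3 M A g hM hg i p h W U H K dp oW oU UO Up WU UW sH sK gE).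
Qed.
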